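(* Let $k\in\{1,2,4\}$ and let $\mu=(\mu_1,\dots,\mu_n)$ be integers with $\mu_i>-k$ and $\sum_i\mu_i=0$. Let $n_0$ be the number of nonzero $\mu_i$. The stratum of primitive $k$-differentials with orders $\mu$ on a genus-$1$ surface is non-empty (i.e. there exist a compact Riemann surface $E$ of genus $1$, distinct points $c_1,\dots,c_n\in E$ and a primitive $k$-differential on $E$ with divisor $\sum_i\mu_ic_i$) if and only if one of the following holds: (i) $n_0=0$ and $k=1$; or (ii) $n_0=2$, in which case the nonzero orders are $(\mu,-\mu)$ for an integer $\mu$, and $|\mu|\ge2$; or (iii) $n_0\ge3$. ($n_0=1$ cannot occur, since the orders sum to zero.)
   Context: A (meromorphic) $k$-differential on a Riemann surface $X$ is a nonzero meromorphic section of $K_X^{k}$, where $K_X$ is the canonical bundle. It is primitive if it is not the $e$-th power of a $(k/e)$-differential for any $e>1$ dividing $k$; every abelian differential ($k=1$) is primitive. Points $c_i$ with $\mu_i=0$ are merely marked points. *)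

(* Defs.v *)
From HB Require Import structures.
From mathcomp Require Import all_boot all_order all_algebra.
From mathcomp Require Import complex.
From mathcomp Require Import boolp classical_sets functions reals topology.
From mathcomp Require Import normedtype derive.

Set Implicit Arguments.
Unset Strict Implicit.
Unset Printing Implicit Defensive.
Import Order.TTheory GRing.Theory Num.Theory.
Import numFieldNormedType.Exports.
Local Open Scope classical_set_scope.
Local Open Scope ring_scope.

(* R[i] as a numFieldType: the topology and the normed-module structure over
   itself are those that MathComp-Analysis puts on every numFieldType, so that
   [derivable f a 1] for f : Cplx R -> Cplx R is complex differentiability. *)
Definition Cplx (R : realType) : numFieldType := R[i].

Section LocalTheory.
Context {R : realType}.
Local Notation C := (Cplx R).
Implicit Types (f g : C -> C) (a : C).

Definition holomorphic_at f a := \forall z \near a, derivable f z 1.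

(* Values at a itself are ignored: a^' is the filter of punctured
   neighbourhoods of a, and [x ^ m] is the power with integer exponent. *)
Definition meromorphic_at f a := exists (m : int) g,
  holomorphic_at g a /\ \forall z \near a^', f z = (z - a) ^ m * g z.

Definition order_at f a (m : int) := exists g,
  [/\ holomorphic_at g a, g a != 0 &
      \forall z \near a^', f z = (z - a) ^ m * g z].

End LocalTheory.

(* A homeomorphism from the open set [chart_dom] onto an open subset of C;
   the values of [chart_fun] outside [chart_dom] and of [chart_inv] outside
   the image of [chart_dom] are irrelevant. *)
Record chart (R : realType) (X : topologicalType) := Chart {
  chart_dom : set X;
  chart_fun :> X -> Cplx R;
  chart_inv : Cplx R -> X;
  chart_dom_open : open chart_dom;
  chart_cod_open : open (chart_fun @` chart_dom);
  chart_funK : forall x, chart_dom x -> chart_inv (chart_fun x) = x;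
  chart_fun_continuous : {within chart_dom, continuous chart_fun};
  chart_inv_continuous :
    {within chart_fun @` chart_dom, continuous chart_inv}
}.

Definition chart_cod (R : realType) (X : topologicalType) (phi : chart R X) :
  set (Cplx R) := phi @` chart_dom phi.

Definition transition (R : realType) (X : topologicalType)
  (phi psi : chart R X) : Cplx R -> Cplx R := psi \o chart_inv phi.

Record riemann_surface (R : realType) := RiemannSurface {
  rs_space :> topologicalType;
  atlas : set (chart R rs_space);
  rs_hausdorff : hausdorff_space rs_space;
  rs_connected : connected [set: rs_space];
  atlas_cover : forall x, exists2 phi, atlas phi & chart_dom phi x;
  atlas_holomorphic : forall phi psi, atlas phi -> atlas psi ->
    forall x, chart_dom phi x -> chart_dom psi x ->
    derivable (transition phi psi) (phi x) 1
}.

Arguments atlas {R} r _.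

Section Differentials.
Context {R : realType} (X : riemann_surface R).
Local Notation C := (Cplx R).

(* A section of K_X^k given by its coefficients: in the chart phi with
   coordinate z it is q phi z dz^k. Only the charts of the atlas and the
   coordinates in the image of the chart matter. *)
Definition local_coefs := chart R X -> C -> C.
Implicit Types (q : local_coefs) (k : nat).

(* Meromorphic sections of K_X^k, the zero section included. Coefficients are
   compared on punctured neighbourhoods, i.e., off a closed discrete set. *)
Definition meromorphic_section k q :=
  (forall phi, atlas X phi -> forall a, chart_cod phi a ->
     meromorphic_at (q phi) a) /\
  (forall phi psi, atlas X phi -> atlas X psi ->
     forall x : X, chart_dom phi x -> chart_dom psi x ->
     \forall z \near (phi x)^',
       q phi z = q psi (transition phi psi z)
                 * (derive1 (transition phi psi) z) ^+ k).

Definition eq_section q q' := forall phi, atlas X phi ->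
  forall a, chart_cod phi a -> \forall z \near a^', q phi z = q' phi z.

Definition zero_section : local_coefs := fun _ _ => 0.

Definition kdifferential k q :=
  meromorphic_section k q /\ ~ eq_section q zero_section.

Definition power_section q (e : nat) : local_coefs :=
  fun phi z => q phi z ^+ e.

Definition primitive_kdifferential k q :=
  kdifferential k q /\
  forall e, (1 < e)%N -> (e %| k)%N ->
    ~ exists2 p, kdifferential (k %/ e) p & eq_section q (power_section p e).

Definition has_divisor q (n : nat) (c : 'I_n -> X) (mu : 'I_n -> int) :=
  forall phi, atlas X phi -> forall x : X, chart_dom phi x ->
    order_at (q phi) (phi x) (\sum_(i < n | c i == x) mu i).

Definition holomorphic_section k q :=
  meromorphic_section k q /\
  forall phi, atlas X phi -> forall a, chart_cod phi a ->
    derivable (q phi) a 1.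

(* g = dim H^0(X, K_X): there is a family of g holomorphic 1-forms in which
   every holomorphic 1-form has unique coordinates. *)
Definition has_genus (g : nat) := exists w : 'I_g -> local_coefs,
  (forall j, holomorphic_section 1 (w j)) /\
  forall h, holomorphic_section 1 h ->
    exists! l : 'rV[C]_g, forall phi, atlas X phi ->
      forall a, chart_cod phi a -> h phi a = \sum_j l 0 j * w j phi a.

End Differentials.

Definition primitive_stratum_nonempty (R : realType) (g k n : nat)
    (mu : 'I_n -> int) :=
  exists E : riemann_surface R,
    [/\ compact [set: E], has_genus E g &
    exists (c : 'I_n -> E) (q : local_coefs E),
      [/\ injective c, primitive_kdifferential k q & has_divisor q c mu]].

(* Main.v *)
(* Necessity. Let om span the holomorphic 1-forms. If q has no zeros and poles,
   om^k / q is holomorphic, hence constant, and q is a k-th power, so k = 1. If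
   div q = x1 - x2, then f = om^k / q has a single simple pole, and comparing pole
   parts shows that f' = om T(f) for a quadratic polynomial T. By uniqueness for
   this equation f omits the roots t of T, so 1 / (f - t) is holomorphic, hence
   constant: a contradiction.

   Existence. On C^* / q^Z let theta be the theta function vanishing to order one
   along q^Z. The k-differential prod_i theta(z / c_i)^mu_i (dz/z)^k is invariant
   when prod_i c_i^mu_i = 1. The divisors e > 1 of k are even, so an odd mu_i
   makes it primitive. Otherwise mu = 2 nu, and the c_i are chosen such that
   prod_i c_i^nu_i = -1: then the obvious square root is anti-invariant, and no
   invariant one exists.

   The function theory rests on Riemann sums: midpoint sums for Goursat's theorem,
   and averages over 2^n-th roots of unity, in the limit along an ultrafilter, for
   Cauchy's formula. *)

Require Import Defs.
From HB Require Import structures.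
From mathcomp Require Import all_boot all_order all_algebra.
From mathcomp Require Import complex ring lra zify.
From mathcomp Require Import boolp classical_sets reals topology.
From mathcomp Require Import normedtype derive sequences exp.
Import Order.TTheory GRing.Theory Num.Theory.
Import numFieldNormedType.Exports.
Set Implicit Arguments.
Unset Strict Implicit.
Unset Printing Implicit Defensive.
Local Open Scope classical_set_scope.
Local Open Scope ring_scope.

(** * Modulus and complex derivatives *)

(** Necessity takes place on an abstract surface of which only a nonzero holomorphic 1-form [om] is
    known. Since [om] might have zeros, the argument neither counts zeros and poles nor sums
    residues: every contradiction comes from the fact that holomorphic functions on the surface are
    constant. This is why orders (1, -1) are excluded through a differential equation: omitting a
    value [t] is what turns the one-pole function [f] into a holomorphic function 1 / (f - t).

    In the existence part the product condition is imposed in C^* itself, not modulo q^Z. So the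
    points come first, and q is taken afterwards, small enough to keep their orbits apart. The
    threshold |mu| >= 2 enters through the ratio x of the two points: x must differ from 1, with
    x^mu = 1 for odd mu and x^(mu/2) = -1 for even mu. With three nonzero orders, two of them have
    nonzero sum, and moving the two corresponding points along a curve that fixes the product makes
    all points distinct.

    Coefficients of sections matter only off a discrete set, so pointwise statements about a section
    pass through local holomorphic extensions. *)

Section Modulus.
Context {R : realType}.
Local Notation C := (Cplx R).

(** Real-valued, unlike [|z|], which is a complex number here; estimates can then use the ordered
    field [R]. *)
Definition cmod (z : C) : R := Normc.normc z.

Lemma norm_cmod (z : C) : `|z| = (cmod z)%:C%C :> C.
Proof. by []. Qed.

Lemma cmod_ge0 z : 0 <= cmod z.
Proof. by case: z => a b; rewrite /cmod /= sqrtr_ge0. Qed.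

Lemma cmodD x y : cmod (x + y) <= cmod x + cmod y.
Proof. exact: le_normcD. Qed.

Lemma cmodM x y : cmod (x * y) = cmod x * cmod y.
Proof. exact: Normc.normcM. Qed.

Lemma cmodN x : cmod (- x) = cmod x.
Proof. exact: normcN. Qed.

Lemma cmodV x : cmod x^-1 = (cmod x)^-1.
Proof. exact: Normc.normcV. Qed.

Lemma cmod0 : cmod 0 = 0.
Proof. exact: Normc.normc0. Qed.

Lemma cmod1 : cmod 1 = 1.
Proof. exact: Normc.normc1. Qed.

Lemma cmod_eq0 x : (cmod x == 0) = (x == 0).
Proof.
apply/eqP/eqP => [|->]; last exact: cmod0.
exact: Normc.eq0_normc.
Qed.

Lemma cmod_gt0 x : (0 < cmod x) = (x != 0).
Proof. by rewrite lt_def cmod_eq0 cmod_ge0 andbT. Qed.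

Lemma cmodB x y : cmod (x - y) = cmod (y - x).
Proof. by rewrite -cmodN opprB. Qed.

Lemma cmod_tri z x y : cmod (x - y) <= cmod (x - z) + cmod (z - y).
Proof. by rewrite -{1}(subrKA z); exact: cmodD. Qed.

Lemma cmodBr x y : cmod x - cmod y <= cmod (x - y).
Proof. by rewrite lerBlDr; have := cmodD (x - y) y; rewrite subrK. Qed.

Lemma cmodX x n : cmod (x ^+ n) = cmod x ^+ n.
Proof. by elim: n => [|n IH]; rewrite ?expr0 ?cmod1 // !exprS cmodM IH. Qed.

Lemma cmod_real (x : R) : cmod x%:C%C = `|x|.
Proof. by rewrite /cmod /= expr0n /= addr0 sqrtr_sqr. Qed.

Lemma cmod_nat n : cmod n%:R = n%:R.
Proof. by rewrite -[n%:R](rmorph_nat (real_complex R)) cmod_real normr_nat. Qed.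

Lemma cmod_sum I (r : seq I) (P : pred I) (F : I -> C) :
  cmod (\sum_(i <- r | P i) F i) <= \sum_(i <- r | P i) cmod (F i).
Proof.
elim/big_ind2: _ => [|x u y v ux vy|//]; first by rewrite cmod0.
exact: le_trans (cmodD _ _) (lerD ux vy).
Qed.

Lemma cmod2 (z : C) : cmod z ^+ 2 = complex.Re z ^+ 2 + complex.Im z ^+ 2.
Proof. by case: z => a b; rewrite /cmod /= sqr_sqrtr // addr_ge0 ?sqr_ge0. Qed.

Lemma Re_le_cmod (z : C) : `|complex.Re z| <= cmod z.
Proof.
by rewrite -ler_sqr ?nnegrE ?cmod_ge0 // cmod2 real_normK ?num_real // lerDl sqr_ge0.
Qed.

Lemma nbhs_cmodP (a : C) (P : set C) :
  nbhs a P <-> exists2 r : R, 0 < r & forall z, cmod (z - a) < r -> P z.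
Proof.
split=> [/nbhs_normP [e /= e0 eP]|[r r0 rP]].
  (* Positivity in the order of the complex numbers forces the radius [e] to be real. *)
  have eE : e = (complex.Re e)%:C%C.
    by move: e0; rewrite ltcE /= => /andP[/eqP i0 _]; case: (e) i0 => ? ? /= ->.
  exists (complex.Re e); first by move: e0; rewrite ltcE /= => /andP[].
  by move=> z za; apply: eP; rewrite /ball_ /= eE distrC norm_cmod ltcR.
apply/nbhs_normP; exists r%:C%C => /=; first by rewrite ltcR.
by move=> z /=; rewrite distrC norm_cmod ltcR; exact: rP.
Qed.

Lemma dnbhs_cmodP (a : C) (P : set C) :
  (\forall z \near a^', P z) <->
  exists2 r : R, 0 < r & forall z, z != a -> cmod (z - a) < r -> P z.
Proof.
rewrite /dnbhs /within /=; split=> [/nbhs_cmodP[r r0 rP]|[r r0 rP]].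
  by exists r => // z za zr; exact: rP.
by apply/nbhs_cmodP; exists r => // z zr za; exact: rP.
Qed.

Lemma cvg_cmodP (T : Type) (F : set_system T) (FF : Filter F) (f : T -> C) (l : C) :
  f @ F --> l <-> forall e : R, 0 < e -> \forall x \near F, cmod (f x - l) < e.
Proof.
split=> [fl e e0|H].
  have : nbhs l [set z | cmod (z - l) < e] by apply/nbhs_cmodP; exists e.
  exact: fl.
move=> A /nbhs_cmodP [r r0 rA]; have := H _ r0; apply: filterS => x; exact: rA.
Qed.

(** The inequality is not strict, so [z = a] satisfies it trivially and no punctured neighbourhood
    is involved. *)
Definition cder (f : C -> C) (a l : C) := forall e : R, 0 < e ->
  exists2 d : R, 0 < d & forall z, cmod (z - a) < d ->
    cmod (f z - f a - l * (z - a)) <= e * cmod (z - a).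

Lemma cderP (f : C -> C) (a l : C) : cder f a l <-> derivable f a 1 /\ derive1 f a = l.
Proof.
have E (h : C) : h != 0 ->
    h^-1 *: ((f \o shift a) (h *: 1) - f a) - l
    = h^-1 * (f (h + a) - f a - l * h).
  move=> h0; rewrite /= /shift /GRing.scale /= mulr1 [RHS]mulrBr.
  by rewrite [_ * (l * h)]mulrCA mulVf ?mulr1.
have E1 : cder f a l <->
    h^-1 *: ((f \o shift a) (h *: 1) - f a) @[h --> 0^'] --> l.
  split=> [fl|fl e e0].
    apply/cvg_cmodP => e e0.
    have [d d0 dP] := fl _ (divr_gt0 e0 (ltr0n _ 2)).
    apply/dnbhs_cmodP; exists d => // h h0; rewrite subr0 => hd.
    rewrite E // cmodM cmodV mulrC ltr_pdivrMr ?cmod_gt0 //.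
    have := dP (h + a); rewrite addrK => /(_ hd) /le_lt_trans; apply.
    by rewrite ltr_pM2r ?cmod_gt0 // ltr_pdivrMr // ltr_pMr // ltrDl.
  move/cvg_cmodP: fl => /(_ _ e0) /dnbhs_cmodP [d d0 dP].
  exists d => // z zd; have [->|za] := eqVneq z a.
    by rewrite !subrr mulr0 subr0 cmod0 mulr0.
  have h0 : z - a != 0 by rewrite subr_eq0.
  have := dP _ h0; rewrite subr0 => /(_ zd); rewrite E // subrK.
  rewrite cmodM cmodV mulrC ltr_pdivrMr ?cmod_gt0 //; exact: ltW.
rewrite E1; split=> [fl|[df <-]]; last first.
  by rewrite derive1E; exact: df.
by split; [exact: cvgP fl | rewrite derive1E; exact: cvg_lim fl].
Qed.

Lemma derivable_cder (f : C -> C) (a : C) : derivable f a 1 -> cder f a (derive1 f a).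
Proof. by move=> df; apply/cderP. Qed.

Lemma cder_derivable (f : C -> C) (a l : C) : cder f a l -> derivable f a 1.
Proof. by case/cderP. Qed.

Lemma cder_cont (f : C -> C) (a l : C) : cder f a l -> forall e : R, 0 < e ->
  exists2 d : R, 0 < d & forall z, cmod (z - a) < d -> cmod (f z - f a) < e.
Proof.
move=> /cder_derivable /derivable1_diffP /differentiable_continuous fa e e0.
by have /nbhs_cmodP := (cvg_cmodP (nbhs_filter a) f (f a)).1 fa _ e0.
Qed.

Lemma Im_le_cmod (z : C) : `|complex.Im z| <= cmod z.
Proof.
by rewrite -ler_sqr ?nnegrE ?cmod_ge0 // cmod2 real_normK ?num_real // lerDr sqr_ge0.
Qed.

Lemma cmod_continuous : continuous cmod.
Proof.
move=> z; apply/(@cvgrPdist_lt _ _ _ _ (nbhs_filter z)) => e e0; apply/nbhs_cmodP; exists e => // w wz.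
apply: le_lt_trans wz; rewrite ler_norml.
by rewrite lerNl opprB cmodBr cmodB cmodBr.
Qed.

(** The disc is a closed subset of the image of the compact square [-r, r]^2 under (x, y) -> x +
    iy. *)
Lemma compact_disc (r : R) : compact [set z : C | cmod z <= r].
Proof.
pose g (p : R * R) : C := (p.1 +i* p.2)%C.
pose K : set (R * R) := `[- r, r] `*` `[- r, r].
have cK : compact K by apply: compact_setX; exact: segment_compact.
have cg : continuous g.
  move=> p; apply/cvg_cmodP => e e0.
  have e20 : 0 < e / 2 by rewrite divr_gt0.
  exists (ball p.1 (e / 2), ball p.2 (e / 2)) => /=.
    by split; exact: nbhsx_ballx.
  move=> [x y] /= []; rewrite -!ball_normE /= => px py.
  have E : g (x, y) - g p = (x - p.1)%:C%C + 'i%C * (y - p.2)%:C%C.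
    by rewrite /g; simpc.
  change (cmod (g (x, y) - g p) < e); rewrite E.
  apply: le_lt_trans (cmodD _ _) _; rewrite cmodM.
  have -> : cmod 'i%C = 1 by rewrite /cmod /= expr0n expr1n add0r sqrtr1.
  rewrite mul1r !cmod_real [e]splitr distrC [`|y - _|]distrC; exact: ltrD.
have cgK := continuous_compact (continuous_subspaceT cg) cK.
apply: (subclosed_compact _ cgK) => [|[x y] /= zr].
  apply: (@closed_comp _ _ cmod [set x | x <= r]); last exact: closed_le.
  by move=> z _; exact: cmod_continuous.
have zR := Re_le_cmod (x +i* y)%C; have zI := Im_le_cmod (x +i* y)%C.
exists (x, y) => //; split; rewrite /= in_itv /= -ler_norml.
  exact: le_trans zR zr.
exact: le_trans zI zr.
Qed.

End Modulus.

Section DerivativeRules.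
Context {R : realType}.
Local Notation C := (Cplx R).
Implicit Types (f g : C -> C) (a b l m z : C).

Lemma continuous_cmodP f a : f @ a --> f a <-> forall e : R, 0 < e ->
  exists2 d : R, 0 < d & forall z, cmod (z - a) < d -> cmod (f z - f a) < e.
Proof.
split=> [fa e e0|H].
  by have /nbhs_cmodP := (cvg_cmodP (nbhs_filter a) f (f a)).1 fa _ e0.
by apply/(cvg_cmodP (nbhs_filter a)) => e e0; apply/nbhs_cmodP; exact: H.
Qed.

Lemma cvg_cadd T (F : set_system T) (FF : Filter F) (f g : T -> C) a b :
  f @ F --> a -> g @ F --> b -> (fun x => f x + g x) @ F --> (a + b : C).
Proof. exact: (@cvgD C C T F FF f g a b). Qed.

Lemma cvg_cmul T (F : set_system T) (FF : Filter F) (f g : T -> C) a b :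
  f @ F --> a -> g @ F --> b -> (fun x => f x * g x) @ F --> (a * b : C).
Proof. exact: (@cvgM C T F FF f g a b). Qed.

Lemma cvg_copp T (F : set_system T) (FF : Filter F) (f : T -> C) a :
  f @ F --> a -> (fun x => - f x) @ F --> (- a : C).
Proof. exact: (@cvgN C C T F FF f a). Qed.

Lemma cvg_ccst T (F : set_system T) (FF : Filter F) a : (fun=> a) @ F --> (a : C).
Proof. exact: (@cvg_cst C a T F). Qed.

(** Caratheodory's criterion: the difference quotient extends continuously by the value [l]. Sum,
    product and chain rule then reduce to algebra and to the continuity of [h]. *)
Lemma caratheodory f a l : cder f a l <-> exists h : C -> C,
  [/\ forall z, f z = f a + h z * (z - a), h a = l & h @ a --> h a].
Proof.
split=> [fl|[h [fh <- /continuous_cmodP ha]] e e0].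
  exists (fun z => if z == a then l else (f z - f a) / (z - a)).
  rewrite eqxx; split=> [z|//|].
    case: eqP => [->|/eqP]; first by rewrite subrr mulr0 addr0.
    by rewrite -subr_eq0 => za; field.
  apply/(cvg_cmodP (nbhs_filter a)) => e e0; apply/nbhs_cmodP.
  have [d d0 dP] := fl _ (divr_gt0 e0 (ltr0n _ 2)).
  exists d => // z zd; case: eqP => [_|/eqP]; first by rewrite subrr cmod0.
  rewrite -subr_eq0 => za; have := dP _ zd.
  have -> : (f z - f a) / (z - a) - l = (f z - f a - l * (z - a)) / (z - a) by field.
  rewrite cmodM cmodV ltr_pdivrMr ?cmod_gt0 // => /le_lt_trans; apply.
  by rewrite ltr_pM2r ?cmod_gt0 // ltr_pdivrMr // ltr_pMr // ltr1n.
have [d d0 dP] := ha _ e0; exists d => // z zd; rewrite [f z]fh.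
have -> : f a + h z * (z - a) - f a - h a * (z - a) = (h z - h a) * (z - a) by ring.
by rewrite cmodM ler_wpM2r ?cmod_ge0 // ltW // dP.
Qed.

Lemma cder_continuous f a l : cder f a l -> f @ a --> f a.
Proof. by move=> fl; apply/continuous_cmodP; exact: cder_cont fl. Qed.

Lemma cder_cst (c a : C) : cder (fun => c) a 0.
Proof.
apply/caratheodory; exists (fun => 0); split=> [z|//|]; first by rewrite mul0r addr0.
exact: (cvg_ccst (nbhs_filter a)).
Qed.

Lemma cder_id a : cder id a 1.
Proof.
apply/caratheodory; exists (fun => 1); split=> [z|//|]; first by rewrite mul1r addrC subrK.
exact: (cvg_ccst (nbhs_filter a)).
Qed.

Lemma cderD f g a l m : cder f a l -> cder g a m -> cder (fun z => f z + g z) a (l + m).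
Proof.
move=> /caratheodory[h [fh <- ha]] /caratheodory[k [gk <- ka]].
apply/caratheodory; exists (fun z => h z + k z); split=> [z|//|].
  by rewrite [f z]fh [g z]gk; ring.
exact: (cvg_cadd (nbhs_filter a) ha ka).
Qed.

Lemma cderM f g a l m : cder f a l -> cder g a m ->
  cder (fun z => f z * g z) a (l * g a + f a * m).
Proof.
move=> fl /caratheodory[k [gk <- ka]].
have fa := cder_continuous fl; move: fl => /caratheodory[h [fh <- ha]].
apply/caratheodory; exists (fun z => h z * g a + f z * k z); split=> [z|//|].
  by rewrite [g z]gk [f z]fh; ring.
have h1 := cvg_cmul (nbhs_filter a) ha (@cvg_ccst _ _ (nbhs_filter a) (g a)).
exact: (cvg_cadd (nbhs_filter a) h1 (cvg_cmul (nbhs_filter a) fa ka)).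
Qed.

Lemma cderZ c f a l : cder f a l -> cder (fun z => c * f z) a (c * l).
Proof.
move=> fl; have := cderM (cder_cst c a) fl.
by rewrite mul0r add0r.
Qed.

Lemma cderN f a l : cder f a l -> cder (fun z => - f z) a (- l).
Proof.
move=> /caratheodory[h [fh <- ha]].
apply/caratheodory; exists (fun z => - h z); split=> [z|//|].
  by rewrite [f z]fh; ring.
exact: (cvg_copp (nbhs_filter a) ha).
Qed.

Lemma cderB f g a l m : cder f a l -> cder g a m -> cder (fun z => f z - g z) a (l - m).
Proof. by move=> fl /cderN; exact: cderD. Qed.

Lemma cder_near f g a l : (\forall z \near a, f z = g z) -> cder g a l -> cder f a l.
Proof.
move=> /nbhs_cmodP [d0 d00 fg] gl e e0; have [d d1 dP] := gl e e0.
exists (Num.min d d0) => [|w]; first by rewrite lt_min d1.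
rewrite lt_min => /andP[wd wd0]; rewrite fg // fg ?dP //.
by rewrite subrr cmod0.
Qed.

Lemma cder_comp f g a l m : cder g a m -> cder f (g a) l ->
  cder (fun z => f (g z)) a (l * m).
Proof.
move=> gm /caratheodory[h [fh <- ha]].
have ga := cder_continuous gm; move: gm => /caratheodory[k [gk <- ka]].
apply/caratheodory; exists (fun z => h (g z) * k z); split=> [z|//|].
  by rewrite [f (g z)]fh [in g z - _]gk; ring.
apply: (cvg_cmul (nbhs_filter a) _ ka); by move=> A /ha /ga.
Qed.

Lemma cder_inv (a : C) : a != 0 -> cder (fun z => z^-1) a (- (a ^- 2)).
Proof.
move=> a0; have ca : (fun z : C => z^-1) @ a --> a^-1 by exact: inv_continuous.
have a2 : \forall z \near a, z^-1 =
   (fun z => a^-1 + (- (z^-1 / a)) * (z - a)) z.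
  apply/nbhs_cmodP; exists (cmod a); first by rewrite cmod_gt0.
  move=> z za; have z0 : z != 0.
    by apply: contraTneq za => ->; rewrite sub0r cmodN ltxx.
  by field; rewrite a0 z0.
apply: (cder_near a2); apply/caratheodory.
exists (fun z => - (z^-1 / a)); split=> [z||].
- by rewrite subrr mulr0 addr0.
- by rewrite -invfM -expr2.
- have h1 := cvg_cmul (nbhs_filter a) ca (@cvg_ccst _ _ (nbhs_filter a) a^-1).
  exact: (cvg_copp (nbhs_filter a) h1).
Qed.

Lemma cderV f a l : f a != 0 -> cder f a l -> cder (fun z => (f z)^-1) a (- (f a ^- 2) * l).
Proof. by move=> fa0 fl; exact: (cder_comp fl (cder_inv fa0)). Qed.

Lemma cderX f a l n : cder f a l -> cder (fun z => f z ^+ n) a (n%:R * f a ^+ n.-1 * l).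
Proof.
move=> fl; elim: n => [|n IH].
  by rewrite !mul0r; apply: cder_cst.
have -> : (fun z => f z ^+ n.+1) = (fun z => f z * f z ^+ n).
  by apply/funext => z; rewrite exprS.
rewrite (_ : _ * l = l * f a ^+ n + f a * (n%:R * f a ^+ n.-1 * l)); first exact: cderM.
rewrite -pred_Sn; case: n {IH} => [|n]; first by rewrite !expr0; ring.
by rewrite -pred_Sn [n.+2%:R]mulrS exprS; ring.
Qed.

Lemma cder_unique f a l m : cder f a l -> cder f a m -> l = m.
Proof. by move=> /cderP[_ <-] /cderP[_ <-]. Qed.

Lemma cder_derive1 f a l : cder f a l -> derive1 f a = l.
Proof. by case/cderP. Qed.

End DerivativeRules.

(** * Goursat's theorem for midpoint sums *)

Section Compactness.
Context {R : realType}.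
Local Notation C := (Cplx R).
Implicit Types (K : set C) (f g : C -> C) (a b c p z : C).

Lemma invSn_lt (d : R) : 0 < d ->
  exists N : nat, forall n, (N <= n)%N -> n.+1%:R^-1 < d.
Proof.
move=> d0; exists (Num.bound d^-1) => n Nn.
rewrite invf_plt ?posrE ?ltr0n //.
apply: lt_le_trans (archi_boundP _) _; first by rewrite invr_ge0 ltW.
by rewrite ler_nat ltnW.
Qed.

(** Bolzano-Weierstrass with cluster points instead of subsequences. *)
Lemma compact_seq K (u : nat -> C) : compact K -> (forall n, K (u n)) ->
  exists2 p, K p & forall e : R, 0 < e -> forall N,
    exists2 n, (N <= n)%N & cmod (u n - p) < e.
Proof.
move=> cK uK.
have [|p [Kp clp]] := cK (u @ \oo) _.
  exact: (@nearW _ \oo (fun n => K (u n))).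
exists p => // e e0 N.
have := clp (u @` [set n | (N <= n)%N]) [set z | cmod (z - p) < e].
case; first by exists N => //= n Nn; exists n.
  by apply: (nbhs_cmodP p _).2; exists e.
by move=> _ [[n Nn <-] nz]; exists n.
Qed.

Definition cont_on K f := forall a, K a -> forall e : R, 0 < e ->
  exists2 d : R, 0 < d & forall z, K z -> cmod (z - a) < d -> cmod (f z - f a) < e.

(** Heine's theorem: pairs violating uniformity at every scale 1/(n+1) would accumulate at a point
    where continuity fails. *)
Lemma cont_on_unif K f : compact K -> cont_on K f -> forall e : R, 0 < e ->
  exists2 d : R, 0 < d & forall a b, K a -> K b -> cmod (a - b) < d ->
    cmod (f a - f b) < e.
Proof.
move=> cK fK e e0; apply: contrapT => H.
have /choice [u uP] (n : nat) : exists u : C * C, [/\ K u.1, K u.2,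
    cmod (u.1 - u.2) < n.+1%:R^-1 & e <= cmod (f u.1 - f u.2)].
  apply: contrapT => Hn; apply: H; exists n.+1%:R^-1 => [|a b Ka Kb ab].
    by rewrite invr_gt0.
  by rewrite ltNge; apply/negP => le; apply: Hn; exists (a, b).
have [|p Kp pP] := compact_seq (u := fst \o u) cK; first by move=> n; case: (uP n).
have [d d0 dP] := fK _ Kp _ (divr_gt0 e0 (ltr0n _ 2)).
have d20 : 0 < d / 2 by rewrite divr_gt0.
have [N NP] := invSn_lt d20.
have [n Nn nP] := pP _ d20 N.
have [K1 K2 u12] := uP n; apply/negP; rewrite -ltNge.
have n1 : cmod ((u n).1 - p) < d.
  by apply: lt_le_trans nP _; rewrite ler_pdivrMr // ler_pMr // ler1n.
have n2 : cmod ((u n).2 - p) < d.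
  apply: le_lt_trans (cmod_tri (u n).1 _ _) _; rewrite [d]splitr ltrD //.
  by rewrite cmodB; exact: lt_trans u12 (NP _ Nn).
have f1 := dP _ K1 n1; have f2 := dP _ K2 n2.
apply: le_lt_trans (cmod_tri (f p) _ _) _.
by rewrite [e]splitr ltrD // cmodB.
Qed.

Lemma cont_on_bounded K f : compact K -> cont_on K f ->
  exists2 B : R, 0 < B & forall a, K a -> cmod (f a) <= B.
Proof.
move=> cK fK; apply: contrapT => H.
have /choice [u uP] (n : nat) : exists u : C, K u /\ n.+1%:R <= cmod (f u).
  apply: contrapT => Hn; apply: H; exists n.+1%:R => // a Ka.
  by rewrite leNgt; apply/negP => lt; apply: Hn; exists a; rewrite ltW.
have [|p Kp pP] := compact_seq (u := u) cK; first by move=> n; case: (uP n).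
have [d d0 dP] := fK _ Kp _ ltr01.
have [N Nf] : exists N : nat, cmod (f p) + 1 < N%:R.
  by exists (Num.bound (cmod (f p) + 1)); apply: archi_boundP; rewrite addr_ge0 // cmod_ge0.
have [n Nn nP] := pP _ d0 N.
have [Kn nf] := uP n; have := dP _ Kn nP.
apply/negP; rewrite -leNgt; apply: le_trans (cmodBr _ _).
rewrite lerBrDr; apply: le_trans nf; rewrite addrC.
apply: le_trans (ltW Nf) _; by rewrite ler_nat (leq_trans Nn).
Qed.

Lemma cder_cont_on K f : (forall a, K a -> derivable f a 1) -> cont_on K f.
Proof.
move=> df a Ka e e0.
by have [d d0 dP] := cder_cont (derivable_cder (df a Ka)) e0; exists d => // z _; exact: dP.
Qed.

End Compactness.

Section Goursat.
Context {R : realType}.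
Local Notation C := (Cplx R).
Implicit Types (K : set C) (f g : C -> C) (a b c p z : C).

Definition mid a b := (a + b) / 2.

(** Dyadic subdivision only ever forms midpoints, so this weak form of convexity is the natural
    one. *)
Definition midconvex K := forall a b, K a -> K b -> K (mid a b).

Lemma midC a b : mid a b = mid b a.
Proof. by rewrite /mid addrC. Qed.

(* [(b - a) * segmean f n a b] is the midpoint Riemann sum of f along [a, b] with
   2^n steps. *)
Fixpoint segmean f n a b := if n is m.+1
  then (segmean f m a (mid a b) + segmean f m (mid a b) b) / 2 else f (mid a b).

(** The Riemann sum of the integral of [f] along the boundary of the triangle, oriented a, b, c. *)
Definition tri_sum f n a b c :=
  (b - a) * segmean f n a b + (c - b) * segmean f n b c
  + (a - c) * segmean f n c a.

Lemma segmeanC f n a b : segmean f n a b = segmean f n b a.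
Proof.
elim: n a b => [|n IH] a b /=; first by rewrite midC.
by rewrite midC addrC IH [segmean f n a _]IH.
Qed.

Lemma segmeanB f g n a b :
  segmean (fun z => f z - g z) n a b = segmean f n a b - segmean g n a b.
Proof. by elim: n a b => [//|n IH] a b /=; rewrite !IH; field. Qed.

(** The midpoint rule is exact on affine functions, so subtracting a tangent from [f] changes no sum
    over a closed triangle. *)
Lemma segmean_affine u v n a b :
  segmean (fun z => u + v * z) n a b = u + v * mid a b.
Proof. by elim: n a b => [//|n IH] a b /=; rewrite !IH /mid; field. Qed.

Lemma segmean_le K f n a b (e : R) : midconvex K -> K a -> K b ->
  (forall z, K z -> cmod (f z) <= e) -> cmod (segmean f n a b) <= e.
Proof.
move=> mK + + fe; elim: n a b => [|n IH] a b Ka Kb /=; first exact/fe/mK.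
rewrite cmodM cmodV cmod_nat ler_pdivrMr //.
apply: le_trans (cmodD _ _) _; rewrite mulr_natr mulr2n.
by apply: lerD; apply: IH => //; exact: mK.
Qed.

(** An exact identity, not an estimate: the edges of the middle triangle cancel against those of the
    outer three, and each side with n+1 subdivisions splits into two halves with n. *)
Lemma tri_sum_sub f n a b c :
  tri_sum f n.+1 a b c = tri_sum f n a (mid a b) (mid c a)
    + tri_sum f n (mid a b) b (mid b c) + tri_sum f n (mid c a) (mid b c) c
    + tri_sum f n (mid a b) (mid b c) (mid c a).
Proof.
rewrite /tri_sum /=.
rewrite (segmeanC f n (mid c a) (mid a b)) (segmeanC f n (mid b c) (mid a b))
  (segmeanC f n (mid c a) (mid b c)) (segmeanC f n c (mid c a)).
by rewrite /mid; field.
Qed.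

Definition perim a b c : R := cmod (b - a) + cmod (c - b) + cmod (a - c).

Lemma perim_ge0 a b c : 0 <= perim a b c.
Proof. by rewrite !addr_ge0 // cmod_ge0. Qed.

Lemma perim_sub a b c : [/\ perim a (mid a b) (mid c a) = perim a b c / 2,
  perim (mid a b) b (mid b c) = perim a b c / 2,
  perim (mid c a) (mid b c) c = perim a b c / 2 &
  perim (mid a b) (mid b c) (mid c a) = perim a b c / 2].
Proof.
have H x : cmod (x / 2) = cmod x / 2 by rewrite cmodM cmodV cmod_nat.
have E u v w x y z : u = (x / 2) -> v = (y / 2) -> w = (z / 2) ->
    cmod u + cmod v + cmod w = (cmod x + cmod y + cmod z) / 2.
  by move=> -> -> ->; rewrite !H -!mulrDl.
rewrite /perim; split; last first.
  transitivity ((cmod (c - a) + cmod (a - b) + cmod (b - c)) / 2).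
    by apply: E; rewrite /mid; field.
  by rewrite (cmodB c a) (cmodB a b) (cmodB b c); ring.
all: apply: E; rewrite /mid; by field.
Qed.

Lemma tri_sum_le K f n a b c (e : R) : midconvex K -> K a -> K b -> K c ->
  (forall z, K z -> cmod (f z) <= e) -> cmod (tri_sum f n a b c) <= e * perim a b c.
Proof.
move=> mK Ka Kb Kc fe; rewrite /tri_sum /perim !mulrDr.
apply: le_trans (cmodD _ _) _; apply: lerD; last first.
  by rewrite cmodM mulrC ler_wpM2r ?cmod_ge0 // (segmean_le _ mK).
apply: le_trans (cmodD _ _) _; apply: lerD;
  by rewrite cmodM mulrC ler_wpM2r ?cmod_ge0 // (segmean_le _ mK).
Qed.

(** Goursat's quadrisection, run on finite sums: a triangle whose sums stay large contains a quarter
    whose sums stay large, and the nested quarters shrink to a point [p] where [f] is close to its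
    tangent. *)
Lemma goursat K f a b c : compact K -> midconvex K ->
  (forall z, K z -> derivable f z 1) -> K a -> K b -> K c ->
  forall e : R, 0 < e -> exists N, forall n, (N <= n)%N ->
    cmod (tri_sum f n a b c) <= e.
Proof.
move=> cK mK df Ka Kb Kc e e0; apply: contrapT => H.
(* The sums over [T] exceed [r] for arbitrarily large [n]; no limit is assumed to exist. By
   [tri_sum_sub], one of the four subtriangles inherits this with [r / 4]. *)
pose fr (T : C * C * C) (r : R) := forall N, exists2 n, (N <= n)%N &
  r < cmod (tri_sum f n T.1.1 T.1.2 T.2).
pose inK (T : C * C * C) := [/\ K T.1.1, K T.1.2 & K T.2].
pose per (T : C * C * C) := perim T.1.1 T.1.2 T.2.
have /choice [step stepP] (Tr : (C * C * C) * R) : exists T', inK Tr.1 ->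
    fr Tr.1 Tr.2 -> [/\ inK T', fr T' (Tr.2 / 4), per T' = per Tr.1 / 2 &
      cmod (T'.1.1 - Tr.1.1.1) <= per Tr.1].
  case: Tr => -[[x y] z] r /=.
  apply: contrapT => nT; have [[Kx Ky Kz] frT] : inK (x, y, z) /\ fr (x, y, z) r.
    by apply: contrapT => h; apply: nT; exists (x, y, z) => h1 h2; case: h.
  have Kxy := mK _ _ Kx Ky; have Kyz := mK _ _ Ky Kz; have Kzx := mK _ _ Kz Kx.
  have [p1 p2 p3 p4] := perim_sub x y z.
  have px : cmod (x - x) <= perim x y z by rewrite subrr cmod0 perim_ge0.
  have pxy : cmod (y - x) <= perim x y z.
    by rewrite /perim -addrA lerDl addr_ge0 ?cmod_ge0.
  have pzx : cmod (z - x) <= perim x y z.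
    by rewrite /perim (cmodB z) lerDr addr_ge0 ?cmod_ge0.
  have half u : cmod (mid x u - x) <= cmod (u - x).
    have -> : mid x u - x = (u - x) / 2 by rewrite /mid; field.
    by rewrite cmodM cmodV cmod_nat ler_pdivrMr // ler_peMr ?cmod_ge0 // ler1n.
  have small T' : inK T' -> per T' = perim x y z / 2 ->
      cmod (T'.1.1 - x) <= perim x y z ->
      exists N, forall n, (N <= n)%N -> cmod (tri_sum f n T'.1.1 T'.1.2 T'.2) <= r / 4.
    move=> h1 h2 h3; apply: contrapT => h; apply: nT; exists T' => _ _; split=> // N.
    apply: contrapT => h'; apply: h; exists N => n Nn; rewrite leNgt.
    by apply/negP => lt; apply: h'; exists n.
  have [|//|//|N1 N1P] := small (x, mid x y, mid z x) => /=; first by split.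
  have [|//||N2 N2P] := small (mid x y, y, mid y z) => /=; first by split.
    by apply: le_trans (half _) _.
  have [|//||N3 N3P] := small (mid z x, mid y z, z) => /=; first by split.
    by rewrite midC; apply: le_trans (half _) _.
  have [|//||N4 N4P] := small (mid x y, mid y z, mid z x) => /=; first by split.
    by apply: le_trans (half _) _.
  have [n] := frT (maxn (maxn N1 N2) (maxn N3 N4)).+1; case: n => // n nN.
  apply/negP; rewrite -leNgt /= tri_sum_sub.
  have -> : r = r / 4 + r / 4 + r / 4 + r / 4 by field.
  move: nN; rewrite ltnS !geq_max => /andP[/andP[n1 n2] /andP[n3 n4]].
  apply: le_trans (cmodD _ _) _; apply: lerD (N4P _ n4).
  apply: le_trans (cmodD _ _) _; apply: lerD (N3P _ n3).
  by apply: le_trans (cmodD _ _) _; apply: lerD (N1P _ n1) (N2P _ n2).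
pose T := fix T n := if n is m.+1 then step (T m, e / 4 ^+ m) else (a, b, c).
have TP n : inK (T n) /\ fr (T n) (e / 4 ^+ n).
  elim: n => [|n [IK If]] /=.
    split; first by split.
    rewrite expr0 divr1 => N; apply: contrapT => h; apply: H; exists N => n Nn; rewrite leNgt.
    by apply/negP => lt; apply: h; exists n.
  have [h1 h2 _ _] := stepP (T n, e / 4 ^+ n) IK If; split=> //.
  by move: h2 => /=; rewrite -mulrA -invfM -exprSr.
pose P0 := perim a b c.
have Tper n : per (T n) = P0 / 2 ^+ n.
  elim: n => [|n IH]; first by rewrite expr0 divr1.
  have [IK If] := TP n; have [_ _ h _] := stepP (T n, e / 4 ^+ n) IK If.
  by rewrite /= h /= IH -mulrA -invfM -exprSr.
have Tstep n : cmod ((T n.+1).1.1 - (T n).1.1) <= P0 / 2 ^+ n.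
  by have [IK If] := TP n; have [_ _ _ /=] := stepP (T n, e / 4 ^+ n) IK If; rewrite Tper.
have P0ge : 0 <= P0 by exact: perim_ge0.
(* The steps are dominated by a geometric series; the right-hand side is its exact partial sum. *)
have Tcau n k : cmod ((T (n + k)%N).1.1 - (T n).1.1) <= 2 * P0 / 2 ^+ n - 2 * P0 / 2 ^+ (n + k).
  elim: k => [|k IH]; first by rewrite addn0 !subrr cmod0.
  rewrite addnS; apply: le_trans (cmod_tri (T (n + k)%N).1.1 _ _) _.
  apply: le_trans (lerD (Tstep _) IH) _.
  rewrite exprS; set q := 2 ^+ (n + k); have q0 : q != 0 by rewrite expf_neq0 ?pnatr_eq0.
  rewrite le_eqVlt; apply/orP; left; apply/eqP; field.
  by rewrite q0 expf_neq0 ?pnatr_eq0.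
have [|p Kp pP] := compact_seq (u := fun n => (T n).1.1) cK.
  by move=> n; case: (TP n) => -[].
have Tp n : cmod ((T n).1.1 - p) <= 2 * P0 / 2 ^+ n.
  apply/ler_addgt0Pr => d d0; have [m nm mp] := pP _ d0 n.
  apply: le_trans (cmod_tri (T m).1.1 _ _) _; apply: lerD (ltW mp).
  rewrite cmodB -(subnKC nm); apply: le_trans (Tcau _ _) _.
  by rewrite gerBl divr_ge0 ?mulr_ge0 ?exprn_ge0.
have [l pl] : exists l, cder f p l.
  by exists (derive1 f p); apply: derivable_cder; exact: df.
(* The final bound is e' times 3 P0 / 2^n times P0 / 2^n, and has to be at most e / 4^n. The summand
   1 keeps the denominator positive when P0 = 0. *)
pose e' := e / (4 * P0 ^+ 2 + 1).
have Q0 : 0 < 4 * P0 ^+ 2 + 1 by rewrite ltr_wpDl // mulr_ge0 ?sqr_ge0.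
have e'0 : 0 < e' by rewrite divr_gt0.
have [d d0 dP] := pl _ e'0.
have [n nd] : exists n, 3 * P0 / 2 ^+ n < d.
  have D0 : 0 <= 3 * P0 / d by rewrite divr_ge0 ?mulr_ge0 // ltW.
  exists (Num.bound (3 * P0 / d)).
  rewrite ltr_pdivrMr ?exprn_gt0 // -ltr_pdivrMl // mulrC.
  apply: lt_le_trans (archi_boundP D0) _.
  by rewrite -natrX ler_nat ltnW // ltn_expl.
have [[K1 K2 K3] frn] := TP n; have [m _ mP] := frn 0%N.
move: mP; apply/negP; rewrite -leNgt.
set D := 3 * P0 / 2 ^+ n in nd.
(* The tangent estimate holds only near [p], so the sum is bounded on this smaller set. Its radius
   is 2 P0 / 2^n, for the distance from [p] to the first vertex, plus one perimeter P0 / 2^n. *)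
pose K' := K `&` [set z | cmod (z - p) <= D].
have mK' : midconvex K'.
  move=> u v [Ku up] [Kv vp]; split => /=; first exact: mK.
  have -> : mid u v - p = ((u - p) + (v - p)) / 2 by rewrite /mid; field.
  rewrite cmodM cmodV cmod_nat ler_pdivrMr // mulr_natr mulr2n.
  by apply: le_trans (cmodD _ _) _; exact: lerD.
pose L z := (f p - l * p) + l * z.
have E : tri_sum f m (T n).1.1 (T n).1.2 (T n).2 =
    tri_sum (fun z => f z - L z) m (T n).1.1 (T n).1.2 (T n).2.
  by rewrite /tri_sum !segmeanB !segmean_affine /mid; field.
rewrite E.
have near x : cmod (x - (T n).1.1) <= per (T n) -> cmod (x - p) <= D.
  rewrite Tper => xn; apply: le_trans (cmod_tri (T n).1.1 _ _) _.
  by apply: le_trans (lerD xn (Tp n)) _; rewrite /D le_eqVlt; apply/orP; left; apply/eqP; ring.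
have K'1 : K' (T n).1.1 by split=> //; apply: near; rewrite subrr cmod0 perim_ge0.
have K'2 : K' (T n).1.2.
  by split=> //; apply: near; rewrite /per /perim -addrA lerDl addr_ge0 ?cmod_ge0.
have K'3 : K' (T n).2.
  by split=> //; apply: near; rewrite cmodB /per /perim lerDr addr_ge0 ?cmod_ge0.
apply: le_trans (tri_sum_le (e := e' * D) m mK' K'1 K'2 K'3 _) _.
  move=> z [Kz zp]; have -> : f z - L z = f z - f p - l * (z - p) by rewrite /L; ring.
  apply: le_trans (dP _ (le_lt_trans zp nd)) _.
  by rewrite ler_wpM2l // ltW.
rewrite -/(per (T n)) Tper /D /e'.
have -> : (4 : R) = 2 ^+ 2 by rewrite expr2 -natrM.
set q := 2 ^+ n; have q0 : 0 < q by rewrite exprn_gt0.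
have -> : (2 ^+ 2 : R) ^+ n = q ^+ 2 by rewrite /q exprAC.
rewrite [leLHS](_ : _ = (e / q ^+ 2) * (3 * P0 ^+ 2 / (2 ^+ 2 * P0 ^+ 2 + 1))).
  rewrite ler_piMr ?divr_ge0 ?sqr_ge0 ?(ltW e0) //.
  have -> : (2 ^+ 2 : R) = 4 by rewrite expr2 -natrM.
  rewrite ler_pdivrMr // mul1r.
  by have := sqr_ge0 P0; lra.
field.
by rewrite gt_eqF // gt_eqF.
Qed.

End Goursat.

(** * Circle means and Cauchy's formula *)

Section Circle.
Context {R : realType}.
Local Notation C := (Cplx R).
Implicit Types (K : set C) (f g : C -> C) (a b c p z u v w : C) (r : R).

Lemma cvg_seq_cmodP (s : nat -> C) (l : C) : s @ \oo --> l <->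
  forall e : R, 0 < e -> exists N, forall n, (N <= n)%N -> cmod (s n - l) <= e.
Proof.
split=> [/cvg_cmodP sl e e0|H].
  have [N _ NP] := sl _ e0; exists N => n Nn; exact/ltW/NP.
apply/cvg_cmodP => e e0; have [N NP] := H _ (divr_gt0 e0 (ltr0n _ 2)).
exists N => // n /= Nn; apply: le_lt_trans (NP _ Nn) _.
by rewrite ltr_pdivrMr // ltr_pMr // ltr1n.
Qed.

Definition disc r : set C := [set z | cmod z <= r].

Lemma disc_midconvex r : midconvex (disc r).
Proof.
move=> a b; rewrite /disc /= => ar br.
rewrite /mid cmodM cmodV cmod_nat ler_pdivrMr // mulr_natr mulr2n.
by apply: le_trans (cmodD _ _) _; exact: lerD.
Qed.

Definition dotc z u : R :=
  complex.Re z * complex.Re u + complex.Im z * complex.Im u.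

Lemma dotcD z w u : dotc (z + w) u = dotc z u + dotc w u.
Proof. by case: z => ? ?; case: w => ? ?; case: u => ? ?; rewrite /dotc /=; ring. Qed.

Lemma dotc_half z u : dotc (z / 2) u = dotc z u / 2.
Proof.
have -> : z / 2 = (2^-1)%:C%C * z by rewrite fmorphV rmorph_nat mulrC.
by case: z => ? ?; case: u => ? ?; rewrite /dotc /=; simpc; rewrite /=; ring.
Qed.

Lemma dotc_norm u : dotc u u = cmod u ^+ 2.
Proof. by rewrite cmod2 /dotc -!expr2. Qed.

(** Cauchy-Schwarz in the plane, from Lagrange's identity. *)
Lemma dotc_le z u : `|dotc z u| <= cmod z * cmod u.
Proof.
rewrite -ler_sqr ?nnegrE ?mulr_ge0 ?cmod_ge0 // exprMn !cmod2 real_normK ?num_real //.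
rewrite /dotc -subr_ge0; set x := complex.Re z; set y := complex.Im z.
set x' := complex.Re u; set y' := complex.Im u.
have -> : (x ^+ 2 + y ^+ 2) * (x' ^+ 2 + y' ^+ 2) - (x * x' + y * y') ^+ 2
  = (x * y' - y * x') ^+ 2 by ring.
exact: sqr_ge0.
Qed.

Definition discside r p u (d : R) : set C :=
  disc r `&` [set z | d <= dotc (z - p) u].

Lemma discside_compact r p u d : compact (discside r p u d).
Proof.
apply: compact_closedI; first exact: compact_disc.
apply: (@closed_comp _ _ (fun z => dotc (z - p) u) [set x | d <= x]); last exact: closed_ge.
move=> z _; apply/(@cvgrPdist_lt _ _ _ _ (nbhs_filter z)) => e e0.
apply/nbhs_cmodP; exists (e / (cmod u + 1)).
  by rewrite divr_gt0 // ltr_wpDl // cmod_ge0.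
move=> w; rewrite ltr_pdivlMr ?ltr_wpDl ?cmod_ge0 // => wz.
have -> : dotc (z - p) u - dotc (w - p) u = dotc (z - w) u.
  have -> : z - p = (z - w) + (w - p) by ring.
  by rewrite (dotcD (z - w) (w - p)) addrK.
apply: le_lt_trans (dotc_le _ _) _; rewrite cmodB; apply: le_lt_trans wz.
by rewrite ler_wpM2l ?cmod_ge0 // lerDl.
Qed.

Lemma discside_midconvex r p u d : midconvex (discside r p u d).
Proof.
move=> a b [ar ad] [br bd]; split=> /=; first exact: disc_midconvex.
have -> : mid a b - p = (a - p) / 2 + (b - p) / 2 by rewrite /mid; field.
by rewrite dotcD !dotc_half -mulrDl ler_pdivlMr // mulr_natr mulr2n lerD.
Qed.

(* At the vertex p the function is only continuous: subdivide, apply [goursat] to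
   the three subtriangles away from p and iterate on the fourth. The half-plane
   [d <= dotc (z - p) u] separates those three from p. *)
Lemma goursat_vertex r f p u : cont_on (disc r) f -> disc r p ->
  (forall z, disc r z -> z != p -> derivable f z 1) ->
  forall d w w', 0 < d -> discside r p u d w -> discside r p u d w' ->
  forall e : R, 0 < e -> exists N, forall n, (N <= n)%N ->
    cmod (tri_sum f n p w w') <= e.
Proof.
move=> cf pr df.
have [B B0 fB] := cont_on_bounded (@compact_disc R r) cf.
(* After [m] subdivisions only the triangle at [p] is uncontrolled. The trivial bound on its sum is
   [B] times its perimeter, which has shrunk by the factor 2^m. *)
have H m : forall d w w', 0 < d -> discside r p u d w -> discside r p u d w' ->
    forall e : R, 0 < e -> exists N, forall n, (N <= n)%N ->
    cmod (tri_sum f n p w w') <= e + B * perim p w w' / 2 ^+ m.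
  elim: m => [|m IH] d w w' d0 Kw Kw' e e0.
    exists 0%N => n _; rewrite expr0 divr1; apply: ler_wpDl; first exact: ltW.
    by case: Kw Kw' => [rw _] [rw' _]; apply: (tri_sum_le n (@disc_midconvex r)).
  (* Taking the midpoint with [p] halves the distance from [p] in direction [u], hence the threshold
     d / 2. *)
  pose S := discside r p u (d / 2).
  have d20 : 0 < d / 2 by rewrite divr_gt0.
  have dd : d / 2 <= d by rewrite ler_pdivrMr // ler_peMr ?(ltW d0) // ler1n.
  have SS x : discside r p u d x -> S x.
    by case=> rx dx; split=> //=; apply: le_trans dd dx.
  have Sh x : discside r p u d x -> S (mid p x).
    case=> rx dx; split=> /=; first exact: disc_midconvex.
    have -> : mid p x - p = (x - p) / 2 by rewrite /mid; field.
    by rewrite dotc_half ler_pM2r // invr_gt0.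
  have cS : compact S by exact: discside_compact.
  have mS : midconvex S by exact: discside_midconvex.
  have dS z : S z -> derivable f z 1.
    case=> rz dz; apply: df => //; apply/eqP => zp; move: dz; rewrite /= zp subrr.
    by rewrite /dotc /= !mul0r addr0 leNgt d20.
  have e40 : 0 < e / 4 by rewrite divr_gt0.
  have [N1 N1P] := IH _ _ _ d20 (Sh _ Kw) (Sh _ Kw') _ e40.
  have [N2 N2P] := goursat cS mS dS (Sh _ Kw) (SS _ Kw) (mS _ _ (SS _ Kw) (SS _ Kw')) e40.
  have [N3 N3P] := goursat cS mS dS (Sh _ Kw') (mS _ _ (SS _ Kw) (SS _ Kw')) (SS _ Kw') e40.
  have [N4 N4P] := goursat cS mS dS (Sh _ Kw) (mS _ _ (SS _ Kw) (SS _ Kw')) (Sh _ Kw') e40.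
  exists (maxn (maxn N1 N2) (maxn N3 N4)).+1; case=> // n.
  rewrite ltnS !geq_max => /andP[/andP[n1 n2] /andP[n3 n4]].
  rewrite tri_sum_sub (midC w' p).
  have [p1 _ _ _] := perim_sub p w w'.
  move: (N1P _ n1); rewrite -(midC w' p) p1 (midC w' p) => h1.
  have -> : e + B * perim p w w' / 2 ^+ m.+1 =
    (e / 4 + B * (perim p w w' / 2) / 2 ^+ m) + e / 4 + e / 4 + e / 4.
    by rewrite exprS; field; rewrite expf_neq0 ?pnatr_eq0.
  apply: le_trans (cmodD _ _) _; apply: lerD (N4P _ n4).
  apply: le_trans (cmodD _ _) _; apply: lerD (N3P _ n3).
  by apply: le_trans (cmodD _ _) _; apply: lerD h1 (N2P _ n2).
move=> d w w' d0 Kw Kw' e e0.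
have e20 : 0 < e / 2 by rewrite divr_gt0.
have Q0 : 0 <= B * perim p w w' / (e / 2) by rewrite divr_ge0 ?(ltW e20) // mulr_ge0 ?(ltW B0) // perim_ge0.
have [N NP] := H (Num.bound (B * perim p w w' / (e / 2))) _ _ _ d0 Kw Kw' _ e20.
exists N => n Nn; apply: le_trans (NP _ Nn) _.
rewrite [leRHS]splitr lerD2l ler_pdivrMr ?exprn_gt0 // -ler_pdivrMl // mulrC.
apply: le_trans (ltW (archi_boundP Q0)) _.
by rewrite -natrX ler_nat ltnW // ltn_expl.
Qed.

(** Repeated principal square roots of -1 are primitive roots of unity of order 2^(n+1). The
    principal root has nonnegative real part, which makes [uroot n] tend to 1. *)
Fixpoint uroot n : C := if n is m.+1 then sqrtc (uroot m) else -1.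

Lemma uroot_order n : uroot n ^+ (2 ^ n) = -1.
Proof.
elim: n => [|n IH]; first by rewrite expn0 expr1.
by rewrite expnS exprM /= sqr_sqrtc.
Qed.

Lemma cmod_uroot n : cmod (uroot n) = 1.
Proof.
have : cmod (uroot n) ^+ (2 ^ n) = 1 by rewrite -cmodX uroot_order cmodN cmod1.
by move/eqP; rewrite pexpr_eq1 ?expn_gt0 ?cmod_ge0 // => /eqP.
Qed.

Lemma uroot_prim n : (2 ^ n.+1).-primitive_root (uroot n).
Proof.
have u1 : uroot n ^+ (2 ^ n.+1) = 1.
  by rewrite expnSr exprM uroot_order sqrrN expr1n.
have [m mp] := prim_order_exists (expn_gt0 2 n.+1) u1.
move=> /(dvdn_pfactor _ _ (isT : prime 2)) [i il mE].
move: il mp; rewrite mE leq_eqVlt => /orP[/eqP -> //|il] mp.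
have : uroot n ^+ (2 ^ n) = 1.
  apply/eqP; rewrite -(prim_order_dvd mp); exact: dvdn_exp2l.
rewrite uroot_order => /eqP; rewrite eq_sym -subr_eq0 opprK -(natrD _ 1 1).
by rewrite pnatr_eq0.
Qed.

(** With s = [uroot n.+1], |s^2 - 1| = |s - 1| |s + 1|, and |s + 1|^2 >= 2 because |s| = 1 and Re s
    >= 0. So the squared distance to 1 at least halves at each step. *)
Lemma uroot_near1 (e : R) : 0 < e ->
  exists N, forall n, (N <= n)%N -> cmod (uroot n - 1) < e.
Proof.
move=> e0.
have H n : cmod (uroot n - 1) ^+ 2 <= 4 / 2 ^+ n.
  elim: n => [|n IH].
    have -> : uroot 0 - 1 = - 2 by rewrite /=; ring.
    by rewrite expr0 divr1 cmodN cmod_nat -natrX.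
  have -> : 4 / 2 ^+ n.+1 = (4 / 2 ^+ n) / 2 :> R.
    by rewrite exprS; field; rewrite expf_neq0 ?pnatr_eq0.
  set s := uroot n.+1.
  have sE : uroot n = s ^+ 2 by rewrite /s /= sqr_sqrtc.
  have s1 : cmod (uroot n - 1) = cmod (s - 1) * cmod (s + 1).
    by rewrite sE -cmodM; congr cmod; ring.
  have s2 : 2 <= cmod (s + 1) ^+ 2.
    have : 0 <= complex.Re s.
      rewrite /s /=; case: (uroot n) => x y /=; exact: sqrtr_ge0.
    have := cmod_uroot n.+1; rewrite -/s.
    move=> /(congr1 (fun x : R => x ^+ 2)); rewrite !cmod2.
    by case: s {sE s1} => x y /=; rewrite addr0 expr1n; nra.
  rewrite ler_pdivlMr // (le_trans _ IH) // s1 exprMn.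
  by rewrite ler_wpM2l ?sqr_ge0.
have E0 : 0 <= 4 / e ^+ 2 by rewrite divr_ge0 ?sqr_ge0.
exists (Num.bound (4 / e ^+ 2)) => n Nn.
rewrite -ltr_sqr ?nnegrE ?cmod_ge0 ?(ltW e0) //; apply: le_lt_trans (H _) _.
rewrite ltr_pdivrMr ?exprn_gt0 // -ltr_pdivrMl ?exprn_gt0 // mulrC.
apply: lt_le_trans (archi_boundP E0) _.
by rewrite -natrX ler_nat (leq_trans Nn) // ltnW // ltn_expl.
Qed.

Definition cpt r n j : C := r%:C%C * uroot n ^+ j.

Definition cmean r n f : C := (\sum_(j < 2 ^ n.+1) f (cpt r n j)) / (2 ^+ n.+1).

Lemma cmod_cpt r n j : 0 <= r -> cmod (cpt r n j) = r.
Proof. by move=> r0; rewrite cmodM cmodX cmod_uroot expr1n mulr1 cmod_real ger0_norm. Qed.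

Lemma uroot_neq1 n : uroot n != 1.
Proof.
apply/eqP => u1; have := uroot_order n; rewrite u1 expr1n => /eqP.
by rewrite eq_sym -subr_eq0 -opprD oppr_eq0 -(natrD _ 1 1) pnatr_eq0.
Qed.

Lemma cptS r n j : cpt r n j.+1 = uroot n * cpt r n j.
Proof. by rewrite /cpt exprS mulrCA. Qed.

Lemma cpt_per r n : cpt r n (2 ^ n.+1) = cpt r n 0.
Proof. by rewrite /cpt (prim_expr_order (uroot_prim n)). Qed.

(** The spokes from [p] are traversed once in each direction and telescope around the circle. *)
Lemma tri_sum_fan r n f p k :
  \sum_(j < 2 ^ n.+1) tri_sum f k p (cpt r n j) (cpt r n j.+1) =
  \sum_(j < 2 ^ n.+1) (cpt r n j.+1 - cpt r n j)
    * segmean f k (cpt r n j) (cpt r n j.+1).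
Proof.
pose h j := (cpt r n j - p) * segmean f k p (cpt r n j).
rewrite -[RHS](addr0) -[X in _ + X](_ : \sum_(0 <= j < 2 ^ n.+1) (h j - h j.+1) = 0).
  rewrite big_mkord -big_split /=; apply: eq_bigr => j _.
  by rewrite /tri_sum /h (segmeanC f k (cpt r n j.+1) p); ring.
under eq_bigr do rewrite -opprB.
by rewrite sumrN telescope_sumr ?expn_gt0 // /h cpt_per subrr oppr0.
Qed.

(* f w * w is the integrand of the path integral of f, since dw = i w dt on the
   circle. *)
Lemma circle_sum r f p : 0 < r -> cmod p < r -> cont_on (disc r) f ->
  (forall z, disc r z -> z != p -> derivable f z 1) ->
  cmean r n (fun w => f w * w) @[n --> \oo] --> (0 : C).
Proof.
move=> r0 pr cf df; apply/cvg_seq_cmodP => e e0.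
have e1 : 0 < e / r by rewrite divr_gt0.
have [d d0 dP] := cont_on_unif (@compact_disc R r) cf e1.
(* Chords shorter than [d] make [f] nearly constant along them; chords shorter than half the
   distance from [p] to the circle have both ends in a half-plane away from [p]. *)
pose d' := Num.min d ((r - cmod p) / 2).
have d'0 : 0 < d' by rewrite lt_min d0 divr_gt0 // subr_gt0.
have [N NP] := uroot_near1 (divr_gt0 d'0 r0).
exists N => n Nn; rewrite subr0.
set u := uroot n; pose w := cpt r n.
have wr j : cmod (w j) = r by rewrite cmod_cpt // ltW.
have ws j : cmod (w j.+1 - w j) = r * cmod (u - 1).
  by rewrite /w cptS -/u -{2}[cpt r n j]mul1r -mulrBl cmodM -/(w j) wr mulrC.
have ud' : r * cmod (u - 1) < d' by rewrite mulrC -ltr_pdivlMr // NP.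
have tri0 m : forall e' : R, 0 < e' -> exists M, forall k, (M <= k)%N ->
    cmod (\sum_(j < m) tri_sum f k p (w j) (w j.+1)) <= e'.
  elim: m => [|m IH] e' e'0.
    by exists 0%N => k _; rewrite big_ord0 cmod0 ltW.
  have e'2 : 0 < e' / 2 by rewrite divr_gt0.
  have [K1 K1P] := IH _ e'2.
  pose v := w m - p.
  have v0 : r - cmod p <= cmod v by rewrite -(wr m) cmodBr.
  have vp : 0 < r - cmod p by rewrite subr_gt0.
  (* The half-plane is orthogonal to v = w m - p. There [w m] has inner product |v|^2 and [w m.+1]
     loses at most |v| (r - |p|) / 2; as |v| >= r - |p|, both stay above [dl]. *)
  pose dl := cmod v * ((r - cmod p) / 2).
  have dl0 : 0 < dl by rewrite mulr_gt0 ?divr_gt0 // (lt_le_trans vp).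
  have D1 : discside r p v dl (w m).
    split; first by rewrite /disc /= wr.
    rewrite /= dotc_norm expr2 ler_wpM2l ?cmod_ge0 // (le_trans _ v0) //.
    by rewrite ler_pdivrMr // ler_peMr ?(ltW vp) // ler1n.
  have D2 : discside r p v dl (w m.+1).
    split=> /=; first by rewrite /disc /= wr.
    have -> : w m.+1 - p = v + (w m.+1 - w m) by rewrite /v; ring.
    rewrite /= dotcD dotc_norm.
    have := dotc_le (w m.+1 - w m) v; rewrite ws ler_norml => /andP[+ _].
    move: ud'; rewrite lt_min => /andP[_ ud'].
    have cv := cmod_ge0 v; rewrite /dl.
    set X := r * _ in ud' *; set Y := cmod v in v0 cv *; nra.
  have [K2 K2P] := goursat_vertex cf (ltW pr) df dl0 D1 D2 e'2.
  exists (maxn K1 K2) => k; rewrite geq_max => /andP[k1 k2].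
  rewrite big_ord_recr /= (le_trans (cmodD _ _)) // [e']splitr.
  by apply: lerD; [exact: K1P | exact: K2P].
pose S := \sum_(j < 2 ^ n.+1) f (w j) * w j.
(* Since w j.+1 - w j = (u - 1) w j, the sum of f w * w is a Riemann sum over the chords divided by
   u - 1. The error bound carries a factor |u - 1| too, which cancels this division. *)
have SE : (u - 1) * S = \sum_(j < 2 ^ n.+1) (w j.+1 - w j) * f (w j).
  rewrite mulr_sumr; apply: eq_bigr => j _.
  by rewrite /w cptS -/u; ring.
have P2 : (2 : R) ^+ n.+1 = (2 ^ n.+1)%:R by rewrite natrX.
have Sle : cmod ((u - 1) * S) <= cmod (u - 1) * (e * 2 ^+ n.+1).
  apply/ler_addgt0Pr => e' e'0.
  have [M MP] := tri0 (2 ^ n.+1)%N _ e'0.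
  have := MP _ (leqnn M); rewrite tri_sum_fan -/w => h.
  rewrite SE -[X in cmod X](subrK (\sum_(j < 2 ^ n.+1) (w j.+1 - w j)
    * segmean f M (w j) (w j.+1))).
  apply: le_trans (cmodD _ _) _; apply: lerD => //.
  rewrite -sumrB; apply: le_trans (cmod_sum _ _ _) _.
  have -> : cmod (u - 1) * (e * 2 ^+ n.+1) =
      \sum_(j < 2 ^ n.+1) (r * cmod (u - 1)) * (e / r).
    rewrite sumr_const card_ord -[RHS]mulr_natr P2; field; exact: lt0r_neq0.
  apply: ler_sum => j _; rewrite -mulrBr cmodM ws.
  rewrite ler_wpM2l ?mulr_ge0 ?(ltW r0) ?cmod_ge0 // cmodB.
  pose K' := disc r `&` [set z | cmod (z - w j) <= r * cmod (u - 1)].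
  have mK' : midconvex K'.
    move=> x y [xr xw] [yr yw]; split => /=; first exact: disc_midconvex.
    have -> : mid x y - w j = ((x - w j) + (y - w j)) / 2 by rewrite /mid; field.
    rewrite cmodM cmodV cmod_nat ler_pdivrMr // mulr_natr mulr2n.
    by apply: le_trans (cmodD _ _) _; exact: lerD.
  have K'1 : K' (w j).
    split; first by rewrite /disc /= wr.
    by rewrite /= subrr cmod0 mulr_ge0 ?(ltW r0) ?cmod_ge0.
  have K'2 : K' (w j.+1) by split; rewrite /disc /= ?wr ?ws.
  have -> : segmean f M (w j) (w j.+1) - f (w j)
      = segmean (fun z => f z - (f (w j) + 0 * z)) M (w j) (w j.+1).
    by rewrite segmeanB segmean_affine mul0r addr0.
  apply: (segmean_le _ mK' K'1 K'2) => z [zr zw]; rewrite mul0r addr0.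
  apply/ltW/dP => //; first by rewrite /disc /= wr.
  by apply: le_lt_trans zw _; move: ud'; rewrite lt_min => /andP[].
move: Sle; rewrite cmodM ler_pM2l ?cmod_gt0 ?subr_eq0 ?uroot_neq1 // => Sle.
by rewrite /cmean cmodM cmodV cmodX cmod_nat ler_pdivrMr ?exprn_gt0.
Qed.

End Circle.

(** * Limits along an ultrafilter *)

Section UltraLimit.
Context {R : realType}.
Local Notation C := (Cplx R).

Definition ufilt : set_system nat :=
  projT1 (cid (@ultraFilterLemma nat \oo _)).

#[global] Instance ufilt_ultra : UltraFilter ufilt.
Proof. by rewrite /ufilt; case: cid => ? []. Qed.

Lemma ufilt_eventually : \oo `<=` ufilt.
Proof. by rewrite /ufilt; case: cid => ? []. Qed.

Definition ulim (s : nat -> C) : C := lim (s @ ufilt).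

Definition cbounded (s : nat -> C) := exists B : R, forall n, cmod (s n) <= B.

(** A bounded sequence stays in a compact disc, and a cluster point of an ultrafilter is a limit. *)
Lemma ulim_cvg s : cbounded s -> s @ ufilt --> ulim s.
Proof.
move=> [B sB]; suff [l sl] : exists l : C, s @ ufilt --> l.
  by rewrite /ulim (cvg_lim (@norm_hausdorff _ _) sl).
have [|p [_ clp]] := @compact_disc R B (s @ ufilt) _.
  exact: (@nearW _ ufilt (fun n => cmod (s n) <= B)).
exists p => A pA; have [//|nA] := in_ultra_setVsetC (s @^-1` A) ufilt_ultra.
by have [] := clp (~` A) A nA pA => x [].
Qed.

Lemma ulim_eqP (s : nat -> C) l : s @ ufilt --> l -> ulim s = l.
Proof. exact: (cvg_lim (@norm_hausdorff _ _)). Qed.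

Lemma ulim_cvgn (s : nat -> C) l : s @ \oo --> l -> ulim s = l.
Proof.
by move=> sl; apply: ulim_eqP => A /sl sA; apply: ufilt_eventually; exact: sA.
Qed.

Lemma ulimD s t : cbounded s -> cbounded t ->
  ulim (fun n => s n + t n) = ulim s + ulim t.
Proof. by move=> bs bt; apply: ulim_eqP; apply: cvgD; exact: ulim_cvg. Qed.

Lemma ulimZ a s : cbounded s -> ulim (fun n => a * s n) = a * ulim s.
Proof. by move=> bs; apply: ulim_eqP; apply: cvgMr; exact: ulim_cvg. Qed.

Lemma ulim_le s (B : R) : (forall n, cmod (s n) <= B) -> cmod (ulim s) <= B.
Proof.
move=> sB; have /ulim_cvg /cvg_cmodP sl : cbounded s by exists B.
apply/ler_addgt0Pr => e e0; have [n ne] := filter_ex (sl _ e0).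
apply: le_trans (_ : cmod (s n) + e <= _); last by rewrite lerD2r.
rewrite addrC -lerBlDr; apply: le_trans (ltW ne).
by rewrite cmodB cmodBr.
Qed.

Lemma cboundedD s t : cbounded s -> cbounded t -> cbounded (fun n => s n + t n).
Proof.
move=> [B sB] [D tD]; exists (B + D) => n.
by apply: le_trans (cmodD _ _) _; exact: lerD.
Qed.

Lemma cboundedZ a s : cbounded s -> cbounded (fun n => a * s n).
Proof.
move=> [B sB]; exists (cmod a * B) => n.
by rewrite cmodM ler_wpM2l ?cmod_ge0.
Qed.

End UltraLimit.

Section CircleMean.
Context {R : realType}.
Local Notation C := (Cplx R).
Implicit Types (f g : C -> C) (z w : C) (r : R).

Lemma cmeanD r n f g : cmean r n (fun w => f w + g w) = cmean r n f + cmean r n g.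
Proof. by rewrite /cmean big_split mulrDl. Qed.

Lemma cmeanZ r n a f : cmean r n (fun w => a * f w) = a * cmean r n f.
Proof. by rewrite /cmean -mulr_sumr mulrA. Qed.

Lemma eq_cmean r n f g : 0 <= r -> (forall w, cmod w = r -> f w = g w) ->
  cmean r n f = cmean r n g.
Proof.
by move=> r0 fg; congr (_ / _); apply: eq_bigr => j _; apply: fg; rewrite cmod_cpt.
Qed.

Lemma cmean_le r n f (B : R) : 0 <= r -> (forall w, cmod w = r -> cmod (f w) <= B) ->
  cmod (cmean r n f) <= B.
Proof.
move=> r0 fB; rewrite /cmean cmodM cmodV cmodX cmod_nat ler_pdivrMr ?exprn_gt0 //.
apply: le_trans (cmod_sum _ _ _) _.
have -> : B * 2 ^+ n.+1 = \sum_(j < 2 ^ n.+1) B.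
  by rewrite sumr_const card_ord -[RHS]mulr_natr natrX.
by apply: ler_sum => j _; apply: fB; rewrite cmod_cpt.
Qed.

Lemma cmean_sum r n m (F : nat -> C -> C) :
  cmean r n (fun w => \sum_(i < m) F i w) = \sum_(i < m) cmean r n (F i).
Proof.
by rewrite /cmean -mulr_suml exchange_big.
Qed.

(** A full geometric sum of the root of unity u^(-m), which differs from 1 because 0 < m is below
    the order of u. *)
Lemma cmean_negX r n m : 0 < r -> (0 < m < 2 ^ n.+1)%N ->
  cmean r n (fun w => w^-1 ^+ m) = 0.
Proof.
move=> r0 /andP[m0 mN]; rewrite /cmean; pose u : C := uroot n.
suff -> : \sum_(j < 2 ^ n.+1) (cpt r n j)^-1 ^+ m = 0 by rewrite mul0r.
have u0 : u != 0 by rewrite -cmod_gt0 cmod_uroot.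
have um : (u^-1 ^+ m) != 1.
  rewrite exprVn invr_eq1 /u -(prim_order_dvd (uroot_prim n)).
  by apply/negP => /(dvdn_leq m0); rewrite leqNgt mN.
have E j : (cpt r n j)^-1 ^+ m = r%:C%C^-1 ^+ m * (u^-1 ^+ m) ^+ j.
  by rewrite /cpt -/u invfM exprMn -[(u ^+ j)^-1]exprVn -!exprM mulnC.
under eq_bigr do rewrite E.
rewrite -mulr_sumr; apply/eqP; rewrite mulf_eq0; apply/orP; right.
have := subrX1 (u^-1 ^+ m) (2 ^ n.+1).
have -> : (u^-1 ^+ m) ^+ (2 ^ n.+1) = 1.
  by rewrite exprAC exprVn (prim_expr_order (uroot_prim n)) invr1 expr1n.
rewrite subrr.
by move/esym/eqP; rewrite mulf_eq0 subr_eq0 (negPf um).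
Qed.

Lemma cmean_cst r n c : cmean r n (fun => c) = c.
Proof.
rewrite /cmean sumr_const card_ord -(mulr_natr c) natrX mulfK //.
by rewrite expf_neq0 // pnatr_eq0.
Qed.

Lemma circle_subr_ge r z w : cmod w = r -> r - cmod z <= cmod (w - z).
Proof. by move=> <-; exact: cmodBr. Qed.

Lemma circle_subr_neq0 r z w : cmod z < r -> cmod w = r -> w - z != 0.
Proof.
by move=> zr wr; rewrite -cmod_gt0 (lt_le_trans _ (circle_subr_ge z wr)) // subr_gt0.
Qed.

(** On the sample points w^N = r^N for N = 2^(n+1), so (1 - (z/r)^N) w / (w - z) is the finite
    geometric sum of the (z/w)^m with m < N. Only m = 0 has nonzero mean: the mean of w / (w - z) is
    exactly 1 / (1 - (z/r)^N). *)
Lemma cmean_kernel r z : cmod z < r ->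
  cmean r n (fun w => w / (w - z)) @[n --> \oo] --> (1 : C).
Proof.
move=> zr; have r0 : 0 < r by exact: le_lt_trans (cmod_ge0 z) zr.
pose q := z / r%:C%C.
have rC0 : r%:C%C != 0 :> C by rewrite -cmod_gt0 cmod_real gtr0_norm.
have H n : (1 - q ^+ (2 ^ n.+1)) * cmean r n (fun w => w / (w - z)) = 1.
  rewrite -cmeanZ.
  rewrite (_ : cmean _ _ _ = \sum_(m < 2 ^ n.+1) z ^+ m * cmean r n (fun w => w^-1 ^+ m)).
    have : (0 < 2 ^ n.+1)%N by rewrite expn_gt0.
    case: (2 ^ n.+1)%N (fun m => @cmean_negX r n m r0) => // N HN _.
    rewrite big_ord_recl /= expr0 mul1r.
    under [in X in cmean r n X]eq_fun do rewrite expr0.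
    rewrite cmean_cst big1 ?addr0 // => i _.
    by rewrite HN ?mulr0 // /bump leq0n add1n /= ltnS ltn_ord.
  under [RHS]eq_bigr do rewrite -cmeanZ.
  rewrite -(cmean_sum _ _ _ (fun m w => z ^+ m * w^-1 ^+ m)) /cmean.
  congr (_ / _); apply: eq_bigr => j _.
  set w := cpt r n j; have wr : cmod w = r by rewrite cmod_cpt // ltW.
  have w0 : w != 0 by rewrite -cmod_gt0 wr.
  have wz := circle_subr_neq0 zr wr.
  have wN : w ^+ (2 ^ n.+1) = r%:C%C ^+ (2 ^ n.+1).
    by rewrite /w /cpt exprMn exprAC (prim_expr_order (uroot_prim n)) expr1n mulr1.
  under eq_bigr do rewrite -exprMn.
  have := subrX1 (z * w^-1) (2 ^ n.+1).
  rewrite exprMn exprVn wN -exprVn -exprMn -/q => h.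
  rewrite -[1 - _]opprB h; field.
  by rewrite wz w0.
apply/cvg_seq_cmodP => e e0.
have qE : cmod q = cmod z / r by rewrite cmodM cmodV cmod_real gtr0_norm.
have q1 : cmod q < 1 by rewrite qE ltr_pdivrMr // mul1r.
pose B := r / (r - cmod z).
have B0 : 0 < B by rewrite divr_gt0 // subr_gt0.
have : (cmod q ^+ n) @[n --> \oo] --> (0 : R).
  by apply: cvg_expr; rewrite ger0_norm ?cmod_ge0.
move=> /cvgrPdist_lt /(_ _ (divr_gt0 e0 B0)) [N _ NP].
exists N => n Nn.
have nN : (N <= 2 ^ n.+1)%N by rewrite (leq_trans Nn) // ltnW // (ltn_trans (ltnSn n)) // ltn_expl.
have := NP _ nN; rewrite /= sub0r normrN ger0_norm ?exprn_ge0 ?cmod_ge0 // => qe.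
rewrite -[X in _ - X](H n).
set M := cmean _ _ _.
have -> : M - (1 - q ^+ (2 ^ n.+1)) * M = q ^+ (2 ^ n.+1) * M by ring.
rewrite cmodM cmodX.
have MB : cmod M <= B.
  apply: cmean_le => [|w wr]; first exact: ltW.
  rewrite cmodM cmodV wr ler_wpM2l ?(ltW r0) // lef_pV2 ?posrE ?subr_gt0 //.
    exact: circle_subr_ge.
  by rewrite cmod_gt0 (circle_subr_neq0 zr).
apply: le_trans (ler_wpM2l _ MB) _; first by rewrite exprn_ge0 ?cmod_ge0.
by rewrite -ler_pdivlMr // ltW.
Qed.

End CircleMean.

Section Cauchy.
Context {R : realType}.
Local Notation C := (Cplx R).
Implicit Types (f g : C -> C) (z w : C) (r : R).

Definition circ_bounded r f := exists B : R, forall w, cmod w = r -> cmod (f w) <= B.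

(* This plays the role of the integral of f w dw / (2 pi i w) over |w| = r; the
   ultrafilter limit exists for every f bounded on the circle. *)
Definition circle_mean r f : C := ulim (fun n => cmean r n f).

Lemma cmean_bounded r f : 0 <= r -> circ_bounded r f -> cbounded (fun n => cmean r n f).
Proof. by move=> r0 [B fB]; exists B => n; exact: cmean_le. Qed.

Lemma circle_meanD r f g : 0 <= r -> circ_bounded r f -> circ_bounded r g ->
  circle_mean r (fun w => f w + g w) = circle_mean r f + circle_mean r g.
Proof.
move=> r0 bf bg; rewrite /circle_mean -ulimD; try exact: cmean_bounded.
by congr ulim; apply/funext => n; rewrite cmeanD.
Qed.

Lemma circle_meanZ r a f : 0 <= r -> circ_bounded r f ->
  circle_mean r (fun w => a * f w) = a * circle_mean r f.
Proof.
move=> r0 bf; rewrite /circle_mean -ulimZ; last exact: cmean_bounded.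
by congr ulim; apply/funext => n; rewrite cmeanZ.
Qed.

Lemma eq_circle_mean r f g : 0 <= r -> (forall w, cmod w = r -> f w = g w) ->
  circle_mean r f = circle_mean r g.
Proof.
by move=> r0 fg; congr ulim; apply/funext => n; exact: eq_cmean.
Qed.

Lemma circle_mean_le r f (B : R) : 0 <= r -> (forall w, cmod w = r -> cmod (f w) <= B) ->
  cmod (circle_mean r f) <= B.
Proof. by move=> r0 fB; apply: ulim_le => n; exact: cmean_le. Qed.

Lemma circ_boundedM r f g : circ_bounded r f -> circ_bounded r g ->
  circ_bounded r (fun w => f w * g w).
Proof.
move=> [B fB] [D gD]; exists (B * D) => w wr; rewrite cmodM.
by apply: ler_pM; rewrite ?cmod_ge0 ?fB ?gD.
Qed.

Lemma circ_boundedZ r a f : circ_bounded r f -> circ_bounded r (fun w => a * f w).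
Proof. by move=> bf; apply: (circ_boundedM _ bf); exists (cmod a) => w _. Qed.

Lemma circ_bounded_id r : circ_bounded r id.
Proof. by exists r => w ->. Qed.

Lemma circ_boundedX r f m : circ_bounded r f -> circ_bounded r (fun w => f w ^+ m).
Proof.
move=> [B fB]; exists (B ^+ m) => w wr; rewrite cmodX.
by rewrite lerXn2r ?nnegrE ?cmod_ge0 ?fB // (le_trans (cmod_ge0 (f w))) ?fB.
Qed.

Lemma circ_bounded_inv r z : cmod z < r -> circ_bounded r (fun w => (w - z)^-1).
Proof.
move=> zr; exists (r - cmod z)^-1 => w wr.
rewrite cmodV lef_pV2 ?posrE ?subr_gt0 ?cmod_gt0 ?(circle_subr_neq0 zr) //.
exact: circle_subr_ge.
Qed.

(** Filling in the derivative at [z] makes the quotient continuous on the disc and differentiable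
    off [z], as [circle_sum] requires. *)
Definition dquot f z : C -> C :=
  fun w => if w == z then derive1 f z else (f w - f z) / (w - z).

Lemma dquot_derivable f z a : a != z -> derivable f a 1 -> derivable (dquot f z) a 1.
Proof.
move=> az fa.
have fa' := derivable_cder fa; have za : a - z != 0 by rewrite subr_eq0.
have h1 := cderB fa' (cder_cst (f z) a).
have h2 := @cderV _ (fun w => w - z) _ _ za (cderB (cder_id a) (cder_cst z a)).
apply: cder_derivable (cder_near _ (cderM h1 h2)).
apply/nbhs_cmodP; exists (cmod (a - z)); first by rewrite cmod_gt0 subr_eq0.
move=> w wa; rewrite /dquot; case: eqP => [wz|//].
by move: wa; rewrite wz cmodB ltxx.
Qed.

Lemma dquot_cont_on r f z : (forall a, disc r a -> derivable f a 1) -> disc r z ->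
  cont_on (disc r) (dquot f z).
Proof.
move=> df zr a ar e e0; have [->|az] := eqVneq a z; last first.
  have [d d0 dP] := cder_cont (derivable_cder (dquot_derivable az (df _ ar))) e0.
  by exists d => // w _; exact: dP.
have [d d0 dP] := derivable_cder (df _ zr) (divr_gt0 e0 (ltr0n _ 2)).
exists d => // w _ wz; rewrite {2}/dquot eqxx /dquot.
case: eqP => [_|/eqP wz0]; first by rewrite subrr cmod0.
have w0 : w - z != 0 by rewrite subr_eq0.
have -> : (f w - f z) / (w - z) - derive1 f z
  = (f w - f z - derive1 f z * (w - z)) / (w - z) by field.
rewrite cmodM cmodV ltr_pdivrMr ?cmod_gt0 //; apply: le_lt_trans (dP _ wz) _.
by rewrite ltr_pM2r ?cmod_gt0 // ltr_pdivrMr // ltr_pMr // ltr1n.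
Qed.

(** Write f w as f z plus (w - z) times the difference quotient: [circle_sum] kills the second part
    and [cmean_kernel] evaluates the first. *)
Lemma cauchy_lim r f z : (forall a, disc r a -> derivable f a 1) -> cmod z < r ->
  cmean r n (fun w => f w * w / (w - z)) @[n --> \oo] --> f z.
Proof.
move=> df zr; have r0 : 0 < r by exact: le_lt_trans (cmod_ge0 z) zr.
have h1 := cmean_kernel zr.
have h2 := circle_sum r0 zr (dquot_cont_on df (ltW zr))
  (fun a ar az => dquot_derivable az (df a ar)).
have h3 := cvg_cadd _ h2 (cvg_cmul _ (@cvg_ccst _ _ _ _ (f z)) h1).
rewrite add0r mulr1 in h3.
suff E : (fun n => cmean r n (fun w => f w * w / (w - z))) =
    (fun n => cmean r n (fun w => dquot f z w * w)
      + f z * cmean r n (fun w => w / (w - z))) by rewrite E; exact: h3.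
apply/funext => n; rewrite -cmeanZ -cmeanD; apply: eq_cmean => [|w wr]; first exact: ltW.
have wz := circle_subr_neq0 zr wr.
by rewrite /dquot -subr_eq0 (negPf wz); field.
Qed.

Lemma cauchy_mean r f z : (forall a, disc r a -> derivable f a 1) -> cmod z < r ->
  f z = circle_mean r (fun w => f w * w / (w - z)).
Proof. by move=> df zr; rewrite /circle_mean (ulim_cvgn (cauchy_lim df zr)). Qed.

Lemma hol_circ_bounded r f : (forall a, disc r a -> derivable f a 1) -> circ_bounded r f.
Proof.
move=> df; have [B _ fB] := cont_on_bounded (@compact_disc R r) (cder_cont_on df).
by exists B => w wr; apply: fB => /=; rewrite wr.
Qed.

Lemma cder_quadratic f z l (h : C -> C) (s B : R) : 0 < s ->
  (forall y, cmod (y - z) <= s -> f y - f z - l * (y - z) = (y - z) ^+ 2 * h y) ->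
  (forall y, cmod (y - z) <= s -> cmod (h y) <= B) -> cder f z l.
Proof.
move=> s0 fh hB e e0.
have B0 : 0 <= B by apply: le_trans (hB z _); rewrite ?subrr ?cmod0 ?cmod_ge0 // ltW.
have B1 : 0 < B + 1 by rewrite ltr_wpDl.
exists (Num.min s (e / (B + 1))) => [|y]; first by rewrite lt_min s0 divr_gt0.
rewrite lt_min ltr_pdivlMr // => /andP[/ltW ys ye].
rewrite fh // cmodM cmodX expr2 -mulrA mulrC; apply: ler_wpM2r; first exact: cmod_ge0.
apply: le_trans (ltW ye); rewrite ler_wpM2l ?cmod_ge0 //.
by apply: le_trans (hB _ ys) _; rewrite lerDl.
Qed.

Lemma kernel1_bound r z y w : cmod z < r -> cmod (y - z) <= (r - cmod z) / 2 ->
  cmod w = r -> w - y != 0 /\ cmod (w - y)^-1 <= 2 / (r - cmod z).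
Proof.
move=> zr yz wr; have d0 : 0 < r - cmod z by rewrite subr_gt0.
have h : (r - cmod z) / 2 <= cmod (w - y).
  have := cmod_tri y w z; rewrite -lerBlDr; apply: le_trans.
  rewrite lerBrDr; apply: le_trans (circle_subr_ge z wr).
  by rewrite -lerBrDl; apply: le_trans yz _; lra.
have wy : 0 < cmod (w - y) by apply: lt_le_trans h; rewrite divr_gt0.
split; first by rewrite -cmod_gt0.
by rewrite cmodV -[2 / _]invf_div lef_pV2 ?posrE // divr_gt0.
Qed.

(** Differentiation under the mean without exchanging limits: an algebraic remainder (y - z)^2 h,
    with [h] uniformly bounded on the circle, passes to the mean by linearity. *)
Lemma cder_circle_mean r z (s B : R) (k h : C -> C -> C) (k' : C -> C) :
  0 <= r -> 0 < s -> (forall y, cmod (y - z) <= s -> circ_bounded r (k y)) ->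
  circ_bounded r k' ->
  (forall y w, cmod (y - z) <= s -> cmod w = r ->
     k y w - k z w - (y - z) * k' w = (y - z) ^+ 2 * h y w) ->
  (forall y w, cmod (y - z) <= s -> cmod w = r -> cmod (h y w) <= B) ->
  cder (fun y => circle_mean r (k y)) z (circle_mean r k').
Proof.
move=> r0 s0 bk bk' kh hB.
apply: (@cder_quadratic _ _ _ (fun y => circle_mean r (h y)) s B) => // y ys; last first.
  by apply: circle_mean_le => // w; exact: hB.
have bz : cmod (z - z) <= s by rewrite subrr cmod0 ltW.
have b12 : circ_bounded r (fun w => k y w + -1 * k z w).
  have [D1 D1P] := bk _ ys; have [D2 D2P] := circ_boundedZ (-1) (bk _ bz).
  by exists (D1 + D2) => w wr; apply: le_trans (cmodD _ _) _; rewrite lerD ?D1P ?D2P.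
transitivity (circle_mean r (fun w => (k y w + -1 * k z w) + (z - y) * k' w)).
  rewrite circle_meanD //; last exact: circ_boundedZ.
  rewrite circle_meanD //; [| exact: bk | by apply: circ_boundedZ; exact: bk].
  rewrite !circle_meanZ //; last exact: bk.
  ring.
rewrite -circle_meanZ //; last by exists B => w; exact: hB.
by apply: eq_circle_mean => // w wr; rewrite -kh //; ring.
Qed.

Lemma circ_bounded_div r f z m : circ_bounded r f -> cmod z < r ->
  circ_bounded r (fun w => f w / (w - z) ^+ m).
Proof.
move=> bf zr; have [D DP] := circ_boundedM bf (circ_boundedX m (circ_bounded_inv zr)).
by exists D => w wr; rewrite -exprVn DP.
Qed.

Lemma disc_radius_half r z y : cmod z < r -> cmod (y - z) <= (r - cmod z) / 2 -> cmod y < r.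
Proof.
move=> zr ys; have := cmodD (y - z) z; rewrite subrK => /le_lt_trans; apply.
by move: ys; lra.
Qed.

(** The remainder comes from 1/(w-y) - 1/(w-z) - (y-z)/(w-z)^2 = (y-z)^2 / ((w-z)^2 (w-y)). As [f]
    is only assumed bounded on the circle, it may carry negative powers of [w], as in
    [taylor_order]. *)
Lemma cder_kernel1 r f z : 0 < r -> circ_bounded r f -> cmod z < r ->
  cder (fun z => circle_mean r (fun w => f w / (w - z))) z
    (circle_mean r (fun w => f w / (w - z) ^+ 2)).
Proof.
move=> r0 bf zr; have [B fB] := bf; set s := (r - cmod z) / 2.
have s0 : 0 < s by rewrite divr_gt0 // subr_gt0.
have bz : cmod (z - z) <= s by rewrite subrr cmod0 ltW.
pose k := 2 / (r - cmod z).
apply: (@cder_circle_mean _ _ s (B * k ^+ 3) _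
  (fun y w => f w * ((w - z)^-1 ^+ 2 * (w - y)^-1))) => //.
- exact: ltW.
- by move=> y /(disc_radius_half zr) yr; apply: (circ_boundedM bf (circ_bounded_inv yr)).
- exact: circ_bounded_div.
- move=> y w ys wr; have [wz _] := kernel1_bound zr bz wr.
  by have [wy _] := kernel1_bound zr ys wr; field; rewrite wy wz.
- move=> y w ys wr; have [_ wz] := kernel1_bound zr bz wr.
  have [_ wy] := kernel1_bound zr ys wr.
  rewrite cmodM; apply: ler_pM; rewrite ?cmod_ge0 ?fB //.
  rewrite cmodM cmodX [k ^+ 3]exprSr; apply: ler_pM; rewrite ?exprn_ge0 ?cmod_ge0 //.
  by rewrite lerXn2r ?nnegrE ?cmod_ge0 // (le_trans _ wz) // cmod_ge0.
Qed.

(** Applied to Cauchy's formula for the derivative, this shows that derivatives of holomorphic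
    functions are again differentiable. *)
Lemma cder_kernel2 r f z : 0 < r -> circ_bounded r f -> cmod z < r ->
  cder (fun z => circle_mean r (fun w => f w / (w - z) ^+ 2)) z
    (circle_mean r (fun w => f w * (2 / (w - z) ^+ 3))).
Proof.
move=> r0 bf zr; have [B fB] := bf; set s := (r - cmod z) / 2.
have s0 : 0 < s by rewrite divr_gt0 // subr_gt0.
have bz : cmod (z - z) <= s by rewrite subrr cmod0 ltW.
pose k := 2 / (r - cmod z).
apply: (@cder_circle_mean _ _ s (B * (2 * k ^+ 4 + k ^+ 4)) _
  (fun y w => f w * (2 * ((w - z)^-1 ^+ 3 * (w - y)^-1)
     + (w - z)^-1 ^+ 2 * (w - y)^-1 ^+ 2))) => //.
- exact: ltW.
- by move=> y /(disc_radius_half zr) yr; exact: circ_bounded_div.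
- have [D DP] := circ_boundedZ 2 (circ_bounded_div 3 bf zr).
  by exists D => w wr; rewrite mulrCA DP.
- move=> y w ys wr; have [wz _] := kernel1_bound zr bz wr.
  by have [wy _] := kernel1_bound zr ys wr; field; rewrite wy wz.
- move=> y w ys wr; have [_ wz] := kernel1_bound zr bz wr.
  have [_ wy] := kernel1_bound zr ys wr.
  have k0 : 0 <= k by apply: le_trans wz; exact: cmod_ge0.
  rewrite cmodM; apply: ler_pM; rewrite ?cmod_ge0 ?fB //.
  apply: le_trans (cmodD _ _) _; apply: lerD.
    rewrite cmodM cmod_nat ler_wpM2l // cmodM cmodX [k ^+ 4]exprSr.
    by apply: ler_pM; rewrite ?exprn_ge0 ?cmod_ge0 // lerXn2r ?nnegrE ?cmod_ge0.
  rewrite cmodM !cmodX (exprD k 2 2).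
  by apply: ler_pM; rewrite ?exprn_ge0 ?cmod_ge0 // lerXn2r ?nnegrE ?cmod_ge0.
Qed.

Lemma cder_cauchy r f z : (forall a, disc r a -> derivable f a 1) -> cmod z < r ->
  cder f z (circle_mean r (fun w => f w * w / (w - z) ^+ 2)).
Proof.
move=> df zr; have r0 : 0 < r by exact: le_lt_trans (cmod_ge0 z) zr.
have bf := circ_boundedM (hol_circ_bounded df) (circ_bounded_id r).
apply: cder_near (cder_kernel1 r0 bf zr).
apply/nbhs_cmodP; exists (r - cmod z); first by rewrite subr_gt0.
move=> y yz; apply: cauchy_mean => //.
have := cmodD (y - z) z; rewrite subrK => /le_lt_trans; apply.
by rewrite -ltrBrDr.
Qed.

Lemma derive1_derivable r f z : (forall a, disc r a -> derivable f a 1) -> cmod z < r ->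
  derivable (derive1 f) z 1.
Proof.
move=> df zr; have r0 : 0 < r by exact: le_lt_trans (cmod_ge0 z) zr.
have bf := circ_boundedM (hol_circ_bounded df) (circ_bounded_id r).
apply: cder_derivable (cder_near _ (cder_kernel2 r0 bf zr)).
apply/nbhs_cmodP; exists (r - cmod z); first by rewrite subr_gt0.
move=> y yz; apply: cder_derive1; apply: cder_cauchy => //.
have := cmodD (y - z) z; rewrite subrK => /le_lt_trans; apply.
by rewrite -ltrBrDr.
Qed.

(** [phi m] is the m-th Taylor remainder divided by z^m, and [phi m 0] is the m-th coefficient. The
    first nonzero coefficient gives the factorisation; if all vanish, |f z| <= (|z|/r)^m D for every
    m. No power series is summed. *)
Lemma taylor_order r f : 0 < r -> (forall a, disc r a -> derivable f a 1) ->
  (forall z, cmod z < r -> f z = 0) \/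
  exists m g, [/\ forall z, cmod z < r -> derivable g z 1, g 0 != 0 &
     forall z, cmod z < r -> f z = z ^+ m * g z].
Proof.
move=> r0 df.
have [B fB] := hol_circ_bounded df.
pose F m w := f w * w * w^-1 ^+ m.
have r0' : cmod (0 : C) < r by rewrite cmod0.
have bF m : circ_bounded r (F m).
  apply: circ_boundedM; first by apply: circ_boundedM; [exists B | exact: circ_bounded_id].
  have [D DP] := circ_boundedX m (circ_bounded_inv r0').
  by exists D => w wr; rewrite -[w]subr0 DP.
pose phi m z := circle_mean r (fun w => F m w / (w - z)).
have phi0 z : cmod z < r -> f z = phi 0%N z.
  move=> zr; rewrite (cauchy_mean df zr) /phi; apply: eq_circle_mean => [|w _].
    exact: ltW.
  by rewrite /F expr0 mulr1.
have phiS m z : cmod z < r -> phi m z = phi m 0 + z * phi m.+1 z.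
  move=> zr; have b2 := circ_boundedM (bF m.+1) (circ_bounded_inv zr).
  rewrite /phi -circle_meanZ ?ltW // -circle_meanD ?ltW //; last exact: circ_boundedZ.
    apply: eq_circle_mean => [|w wr]; first exact: ltW.
    have wz := circle_subr_neq0 zr wr; have w0 := circle_subr_neq0 r0' wr.
    by rewrite subr0 in w0; rewrite subr0 /F exprS; field; rewrite w0 wz.
  exact: circ_boundedM (circ_bounded_inv r0').
have dphi m z : cmod z < r -> derivable (phi m) z 1.
  by move=> zr; apply: cder_derivable (cder_kernel1 r0 (bF m) zr).
have fphi m z : (forall i, (i < m)%N -> phi i 0 = 0) -> cmod z < r -> f z = z ^+ m * phi m z.
  elim: m => [|m IH] Hm zr; first by rewrite expr0 mul1r phi0.
  rewrite IH // => [|i im]; last by apply: Hm; exact: ltnW.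
  by rewrite phiS // Hm // add0r mulrA -exprSr.
have [[m mP]|nP] := pselect (exists m, phi m 0 != 0).
  have [|m0 m0P m0min] := @ex_minnP (fun m => phi m 0 != 0); first by exists m.
  right; exists m0, (phi m0); split=> // z; first exact: dphi.
  apply: fphi => i; apply: contraTeq => /m0min; by rewrite -leqNgt.
left=> z zr; apply/eqP; rewrite -cmod_eq0 eq_le cmod_ge0 andbT.
have B0 : 0 <= B.
  apply: le_trans (cmod_ge0 _) (fB (r%:C%C) _); by rewrite cmod_real gtr0_norm.
pose D := B * r / (r - cmod z).
have D0 : 0 <= D by rewrite divr_ge0 ?mulr_ge0 ?(ltW r0) // subr_ge0 ltW.
have H m : cmod (f z) <= (cmod z / r) ^+ m * D.
  rewrite (fphi m) // => [|i _]; last first.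
    by apply/eqP/negPn/negP => h; apply: nP; exists i.
  rewrite cmodM cmodX expr_div_n -mulrA ler_wpM2l ?exprn_ge0 ?cmod_ge0 //.
  apply: circle_mean_le => [|w wr]; first exact: ltW.
  have -> : cmod (F m w / (w - z)) = (r ^+ m)^-1 * (cmod (f w) * r / cmod (w - z)).
    by rewrite /F cmodM cmodM cmodM cmodX !cmodV wr exprVn; ring.
  rewrite ler_wpM2l ?invr_ge0 ?exprn_ge0 ?(ltW r0) // /D.
  apply: ler_pM; rewrite ?mulr_ge0 ?invr_ge0 ?cmod_ge0 ?(ltW r0) //.
    by rewrite ler_wpM2r ?(ltW r0) // fB.
  rewrite lef_pV2 ?posrE ?subr_gt0 ?cmod_gt0 ?(circle_subr_neq0 zr) //.
  exact: circle_subr_ge.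
have q1 : cmod z / r < 1 by rewrite ltr_pdivrMr // mul1r.
have q0 : 0 <= cmod z / r by rewrite divr_ge0 ?cmod_ge0 // ltW.
apply/ler_addgt0Pr => e e0; rewrite add0r.
have : ((cmod z / r) ^+ n) @[n --> \oo] --> (0 : R) by apply: cvg_expr; rewrite ger0_norm.
have D1 : 0 < D + 1 by rewrite ltr_wpDl.
move=> /cvgrPdist_lt /(_ _ (divr_gt0 e0 D1)) [N _ /(_ N (leqnn N))].
rewrite /= sub0r normrN ger0_norm ?exprn_ge0 // => h.
apply: le_trans (H N) _; apply: le_trans (ler_wpM2r D0 (ltW h)) _.
rewrite mulrAC ler_pdivrMr // ler_wpM2l ?(ltW e0) //; by rewrite lerDl.
Qed.

(* |f - 1|^2 <= 2 - 2 Re f on the circle, and the right-hand side has mean 0 because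
   f 0 = 1; so |f - 1| has mean 0, and Cauchy's formula applies to f - 1. *)
Lemma max_modulus_disc r f : 0 < r -> (forall a, disc r a -> derivable f a 1) ->
  f 0 = 1 -> (forall w, cmod w = r -> cmod (f w) <= 1) ->
  forall z, cmod z < r -> f z = 1.
Proof.
move=> r0 df f0 f1 z zr; apply/eqP; rewrite -subr_eq0 -cmod_eq0 eq_le cmod_ge0 andbT.
have r0' : cmod (0 : C) < r by rewrite cmod0.
(* An upper bound of |w / (w - z)| on the circle. *)
pose k := r / (r - cmod z).
have k0 : 0 < k by rewrite divr_gt0 // subr_gt0.
suff H d : 0 < d -> cmod (f z - 1) <= d * (1 + 2 * k).
  apply/ler_addgt0Pr => e e0; rewrite add0r.
  have h : 0 < 1 + 2 * k by rewrite ltr_wpDr // mulr_ge0 // ltW.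
  by apply: le_trans (H _ (divr_gt0 e0 h)) _; rewrite divfK // gt_eqF.
move=> d0.
have d20 : 0 < d ^+ 2 by rewrite exprn_gt0.
have /cvg_seq_cmodP /(_ _ d20) [N1 N1P] := cauchy_lim df r0'.
have df1 a : disc r a -> derivable (fun w => f w - 1) a 1.
  by move=> ar; apply: cder_derivable (cderB (derivable_cder (df a ar)) (cder_cst 1 a)).
have /cvg_seq_cmodP /(_ _ d0) [N2 N2P] := cauchy_lim df1 zr.
pose n := maxn N1 N2.
have := N1P n (leq_maxl _ _); have := N2P n (leq_maxr _ _); rewrite f0.
have -> : cmean r n (fun w => f w * w / (w - 0)) = cmean r n f.
  apply: eq_cmean => [|w wr]; first exact: ltW.
  have w0 := circle_subr_neq0 r0' wr; rewrite subr0 in w0 *; by field.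
set M := cmean _ _ _; move=> h2 h1.
have P2 : 0 < (2 ^+ n.+1 : R) by rewrite exprn_gt0.
suff hM : cmod M <= 2 * d * k.
  have -> : f z - 1 = M - (M - (f z - 1)) by ring.
  apply: le_trans (cmodD _ _) _; rewrite cmodN.
  by apply: le_trans (lerD hM h2) _; lra.
rewrite /M /cmean cmodM cmodV cmodX cmod_nat ler_pdivrMr //.
apply: le_trans (cmod_sum _ _ _) _.
pose w j := cpt r n j.
have wr j : cmod (w j) = r by rewrite cmod_cpt // ltW.
apply: le_trans (_ : \sum_(j < 2 ^ n.+1) cmod (f (w j) - 1) * k <= _).
  apply: ler_sum => j _; rewrite -/(w j) cmodM cmodM cmodV wr -mulrA ler_wpM2l ?cmod_ge0 //.
  rewrite ler_wpM2l ?(ltW r0) // lef_pV2 ?posrE ?subr_gt0 ?cmod_gt0 ?(circle_subr_neq0 zr) //.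
  exact: circle_subr_ge.
rewrite -mulr_suml mulrAC ler_wpM2r ?(ltW k0) //.
have P2n : (2 : R) ^+ n.+1 = \sum_(j < 2 ^ n.+1) 1 by rewrite sumr_const card_ord natrX.
(* By x <= (d + x^2 / d) / 2 with x = |f - 1|, only the mean of Re f has to be known. *)
apply: le_trans (_ : \sum_(j < 2 ^ n.+1) (d + (2 - 2 * complex.Re (f (w j))) / d) / 2 <= _).
  apply: ler_sum => j _; rewrite ler_pdivlMr // -(ler_pM2r d0) mulrDl divfK ?gt_eqF //.
  have := f1 _ (wr j); have := cmod_ge0 (f (w j) - 1); have := cmod_ge0 (f (w j)).
  have : cmod (f (w j) - 1) ^+ 2 = cmod (f (w j)) ^+ 2 - 2 * complex.Re (f (w j)) + 1.
    by rewrite !cmod2; case: (f (w j)) => x y /=; rewrite subr0; ring.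
  set x := cmod (f (w j) - 1); set y := cmod (f (w j)); set t := complex.Re _.
  have := sqr_ge0 (x - d); nra.
rewrite -mulr_suml big_split /= -mulr_suml sumrB -mulr_sumr.
(* Cauchy's formula at 0 puts the mean of Re f within d^2 of 1; the square compensates the division
   by [d]. *)
have hRe : \sum_(j < 2 ^ n.+1) complex.Re (f (w j)) >= (1 - d ^+ 2) * 2 ^+ n.+1.
  have := le_trans (Re_le_cmod _) h1; rewrite ler_norml => /andP[+ _].
  have -> : complex.Re (cmean r n f - 1) =
      (\sum_(j < 2 ^ n.+1) complex.Re (f (w j))) / 2 ^+ n.+1 - 1.
    have -> : cmean r n f - 1 = \sum_(j < 2 ^ n.+1) f (w j) * (2 ^- n.+1 : R)%:C%C - 1.
      by rewrite /cmean -mulr_suml fmorphV rmorphXn rmorph_nat.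
    have ReD (u v : C) : complex.Re (u + v) = complex.Re u + complex.Re v.
      by case: u => ? ?; case: v.
    rewrite ReD -mulr_suml (_ : complex.Re (- 1) = -1) //; congr (_ + _).
    have ReZ (u : C) (t : R) : complex.Re (u * t%:C%C) = complex.Re u * t.
      by case: u => x y /=; rewrite mulr0 subr0.
    by rewrite ReZ (big_morph _ ReD (erefl : complex.Re (0 : C) = 0)).
  rewrite lerBrDr ler_pdivlMr // => h; apply: le_trans h.
  by rewrite ler_pM2r // addrC.
rewrite !sumr_const card_ord -[d *+ _]mulr_natr -[2 *+ _]mulr_natr natrX.
set T := 2 ^+ n.+1 in P2 hRe *; set S := \sum_(j < _) _ in hRe *.
rewrite ler_pdivrMr //.
have : (2 * T - 2 * S) / d <= 2 * d * T.
  rewrite ler_pdivrMr //; move: hRe; nra.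
have := mulr_gt0 d0 P2; lra.
Qed.

End Cauchy.

(** * Holomorphic functions and orders *)

Section Holomorphic.
Context {R : realType}.
Local Notation C := (Cplx R).
Implicit Types (f g : C -> C) (a z w l : C) (r : R).

Lemma near_nbhs_near a (P : C -> Prop) :
  (\forall z \near a, P z) -> \forall z \near a, \forall w \near z, P w.
Proof.
move=> /nbhs_cmodP [r r0 rP]; apply/nbhs_cmodP; exists r => // z za.
apply/nbhs_cmodP; exists (r - cmod (z - a)); first by rewrite subr_gt0.
move=> w wz; apply: rP; apply: le_lt_trans (cmod_tri z _ _) _.
by rewrite -ltrBrDr.
Qed.

Lemma near_dnbhs_near a (P : C -> Prop) :
  (\forall z \near a^', P z) -> \forall z \near a^', \forall w \near z, P w.
Proof.
move=> /dnbhs_cmodP [r r0 rP]; apply/dnbhs_cmodP; exists r => // z za zr.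
apply/nbhs_cmodP; exists (Num.min (cmod (z - a)) (r - cmod (z - a))).
  by rewrite lt_min cmod_gt0 subr_eq0 za subr_gt0.
move=> w; rewrite lt_min => /andP[w1 w2]; apply: rP.
  by apply: contraTneq w1 => ->; rewrite cmodB ltxx.
by apply: le_lt_trans (cmod_tri z _ _) _; rewrite -ltrBrDr.
Qed.

Lemma nbhs_dnbhs a (P : C -> Prop) : (\forall z \near a, P z) -> \forall z \near a^', P z.
Proof. by move=> /nbhs_cmodP [r r0 rP]; apply/dnbhs_cmodP; exists r => // z _; exact: rP. Qed.

Lemma dnbhs_nbhs a (P : C -> Prop) : P a -> (\forall z \near a^', P z) -> \forall z \near a, P z.
Proof.
move=> Pa /dnbhs_cmodP [r r0 rP]; apply/nbhs_cmodP; exists r => // z zr.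
by have [->//|za] := eqVneq z a; exact: rP.
Qed.

Lemma dnbhs_to_dnbhs a (P : C -> Prop) :
  (\forall z \near a^', P z) -> \forall z \near a, \forall w \near z^', P w.
Proof.
move=> h; apply: dnbhs_nbhs => //; apply: filterS (near_dnbhs_near h) => z.
exact: nbhs_dnbhs.
Qed.

Lemma cder_shift f a z l : cder f (z + a) l <-> cder (fun w => f (w + a)) z l.
Proof.
split=> fl e e0; have [d d0 dP] := fl e e0; exists d => // w wz.
  by have := dP (w + a); rewrite (_ : w + a - (z + a) = w - z); [exact|ring].
have := dP (w - a); rewrite subrK (_ : w - a - z = w - (z + a)); [exact|ring].
Qed.

Lemma holomorphic_disc f a : holomorphic_at f a ->
  exists2 r : R, 0 < r & forall z, disc r z -> derivable (fun w => f (w + a)) z 1.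
Proof.
move=> /nbhs_cmodP [r r0 rP]; exists (r / 2) => [|z zr]; first by rewrite divr_gt0.
apply: (@cder_derivable _ _ _ (derive1 f (z + a))); apply/cder_shift.
apply: derivable_cder; apply: rP; rewrite addrK; apply: le_lt_trans zr _.
by rewrite ltr_pdivrMr // ltr_pMr // ltr1n.
Qed.

Lemma disc_holomorphic g a r : 0 < r -> (forall z, cmod z < r -> derivable g z 1) ->
  holomorphic_at (fun w => g (w - a)) a.
Proof.
move=> r0 dg; apply/nbhs_cmodP; exists r => // z zr.
apply: (@cder_derivable _ _ _ (derive1 g (z - a))).
by apply/(@cder_shift g (- a)); apply: derivable_cder; exact: dg.
Qed.

Lemma holomorphic_derivable f a : holomorphic_at f a -> derivable f a 1.
Proof. by move=> /nbhs_singleton. Qed.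

Lemma holomorphic_cder f a : holomorphic_at f a -> cder f a (derive1 f a).
Proof. by move=> /holomorphic_derivable; exact: derivable_cder. Qed.

Lemma holomorphic_continuous f a : holomorphic_at f a -> f @ a --> f a.
Proof. by move=> /holomorphic_cder; exact: cder_continuous. Qed.

Lemma near_holomorphic f g a : (\forall z \near a, f z = g z) ->
  holomorphic_at g a -> holomorphic_at f a.
Proof.
move=> /near_nbhs_near fg hg; apply: filterS2 fg hg => z fg dg.
exact: cder_derivable (cder_near fg (derivable_cder dg)).
Qed.

Lemma holomorphic_near f a : holomorphic_at f a -> \forall z \near a, holomorphic_at f z.
Proof. exact: near_nbhs_near. Qed.

Lemma holomorphic_derive1 f a : holomorphic_at f a -> holomorphic_at (derive1 f) a.
Proof.
move=> /holomorphic_disc [r r0 dg]; pose g w := f (w + a).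
have dg1 : holomorphic_at (fun w => derive1 g (w - a)) a.
  by apply: (@disc_holomorphic (derive1 g) a r r0) => z zr; exact: derive1_derivable dg zr.
apply: near_holomorphic dg1; apply/nbhs_cmodP; exists r; [exact: r0 | move=> z /ltW zr].
apply: cder_derive1.
have := (cder_shift _ _ _ _).2 (derivable_cder (dg _ zr)).
by rewrite subrK.
Qed.

Lemma holomorphic_order f a : holomorphic_at f a ->
  (\forall z \near a, f z = 0) \/ exists m g, [/\ holomorphic_at g a, g a != 0 &
    \forall z \near a, f z = (z - a) ^+ m * g z].
Proof.
move=> /holomorphic_disc [r r0 dg].
have [f0|[m [g [gh g0 fg]]]] := taylor_order r0 dg; [left|right].
  by apply/nbhs_cmodP; exists r => // z zr; rewrite -(subrK a z) f0.
exists m, (fun w => g (w - a)); split; first exact: disc_holomorphic r0 gh.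
  by rewrite subrr.
by apply/nbhs_cmodP; exists r => // z zr; rewrite -fg // subrK.
Qed.

Lemma max_modulus f a : holomorphic_at f a ->
  (\forall z \near a, cmod (f z) <= cmod (f a)) -> \forall z \near a, f z = f a.
Proof.
move=> /holomorphic_disc [r1 r10 dg] /nbhs_cmodP [r2 r20 fa].
have [f0|fa0] := eqVneq (f a) 0.
  apply/nbhs_cmodP; exists r2 => // z /fa; rewrite f0 cmod0 => f00.
  by apply/eqP; rewrite -cmod_eq0 eq_le f00 cmod_ge0.
pose r := Num.min r1 (r2 / 2).
have r0 : 0 < r by rewrite lt_min r10 divr_gt0.
have dg1 z : disc r z -> derivable (fun w => (f a)^-1 * f (w + a)) z 1.
  rewrite /disc /= le_min => /andP[zr _].
  exact: cder_derivable (cderZ _ (derivable_cder (dg _ zr))).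
have h := max_modulus_disc r0 dg1.
apply/nbhs_cmodP; exists r => // z zr.
have := h _ _ (z - a) zr; rewrite /= add0r mulVf // subrK.
move=> H; rewrite -[RHS]mulr1 -H ?mulVKf // => w wr.
rewrite cmodM cmodV mulrC ler_pdivrMr ?cmod_gt0 // mul1r fa // addrK wr.
have h2 : r2 / 2 < r2 by rewrite ltr_pdivrMr // ltr_pMr // ltr1n.
by rewrite /r gt_min h2 orbT.
Qed.

(** Weierstrass's theorem for pointwise ultrafilter limits: local boundedness and Cauchy's formula
    bound the quadratic remainder of [P n] at [z] uniformly in [n], and the bound survives the
    limit. *)
Lemma ulim_derivable (P : nat -> C -> C) :
  (forall n z, derivable (P n) z 1) ->
  (forall r, exists B, forall n z, cmod z <= r -> cmod (P n z) <= B) ->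
  forall z, derivable (fun z => ulim (fun n => P n z)) z 1.
Proof.
move=> dP bP z; pose r := cmod z + 1.
have zr : cmod z < r by rewrite ltrDl.
have r0 : 0 < r by exact: le_lt_trans (cmod_ge0 z) zr.
have [B BP] := bP r.
have B0 : 0 <= B by apply: le_trans (cmod_ge0 _) (BP 0%N z (ltW zr)).
have PB n w : cmod w = r -> cmod (P n w * w) <= B * r.
  by move=> wr; rewrite cmodM wr ler_wpM2r ?(ltW r0) // BP // wr.
have bPn n : circ_bounded r (fun w => P n w * w).
  by exists (B * r) => w; exact: PB.
pose s := (r - cmod z) / 2.
have s0 : 0 < s by rewrite divr_gt0 // subr_gt0.
have bz : cmod (z - z) <= s by rewrite subrr cmod0 ltW.
pose k := 2 / (r - cmod z).
pose D n := circle_mean r (fun w => P n w * w / (w - z) ^+ 2).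
pose h n y := circle_mean r (fun w => P n w * w * ((w - z)^-1 ^+ 2 * (w - y)^-1)).
have hb n y : cmod (y - z) <= s -> forall w, cmod w = r ->
    cmod (P n w * w * ((w - z)^-1 ^+ 2 * (w - y)^-1)) <= B * r * k ^+ 3.
  move=> ys w wr; have [_ wz] := kernel1_bound zr bz wr.
  have [_ wy] := kernel1_bound zr ys wr.
  rewrite cmodM; apply: ler_pM; rewrite ?cmod_ge0 ?PB //.
  rewrite cmodM cmodX [k ^+ 3]exprSr; apply: ler_pM; rewrite ?exprn_ge0 ?cmod_ge0 //.
  by rewrite lerXn2r ?nnegrE ?cmod_ge0 // (le_trans _ wz) // cmod_ge0.
have Ph n y : cmod (y - z) <= s -> P n y = (P n z + (y - z) * D n) + (y - z) ^+ 2 * h n y.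
  move=> ys; have yr := disc_radius_half zr ys.
  rewrite (cauchy_mean (fun a _ => dP n a) yr) (cauchy_mean (fun a _ => dP n a) zr).
  have r0' := ltW r0.
  have b1 : circ_bounded r (fun w => P n w * w * ((w - z)^-1 ^+ 2 * (w - y)^-1)).
    by exists (B * r * k ^+ 3) => w; exact: hb.
  have b2 := circ_bounded_div 2 (bPn n) zr.
  have b3 := circ_boundedM (bPn n) (circ_bounded_inv zr).
  rewrite /D /h -(circle_meanZ _ r0' b2) -(circle_meanZ _ r0' b1).
  rewrite -(circle_meanD r0' b3 (circ_boundedZ _ b2)) -circle_meanD //; last exact: circ_boundedZ.
    apply: eq_circle_mean => // w wr.
    have wz := circle_subr_neq0 zr wr; have wy := circle_subr_neq0 yr wr.
    by field; rewrite wy wz.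
  have [D1 D1P] := b3; have [D2 D2P] := circ_boundedZ (y - z) b2.
  by exists (D1 + D2) => w wr; apply: le_trans (cmodD _ _) _; rewrite lerD ?D1P ?D2P.
have cP y : cmod (y - z) <= s -> cbounded (fun n => P n y).
  by move=> ys; exists B => n; apply: BP; exact/ltW/(disc_radius_half zr).
have cD : cbounded D.
  exists (B * r * k ^+ 2) => n; apply: circle_mean_le => [|w wr]; first exact: ltW.
  have [_ wz] := kernel1_bound zr bz wr.
  rewrite cmodM -exprVn cmodX; apply: ler_pM; rewrite ?exprn_ge0 ?cmod_ge0 ?PB //.
  by rewrite lerXn2r ?nnegrE ?cmod_ge0 // (le_trans _ wz) // cmod_ge0.
have ch y : cmod (y - z) <= s -> forall n, cmod (h n y) <= B * r * k ^+ 3.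
  by move=> ys n; apply: circle_mean_le => [|w wr]; [exact: ltW | exact: hb].
apply: (@cder_derivable _ _ _ (ulim D)).
apply: (@cder_quadratic _ _ _ _ (fun y => ulim (fun n => h n y)) s (B * r * k ^+ 3)) => // y ys; last first.
  by apply: ulim_le => n; exact: ch.
have -> : ulim (fun n => P n y) = ulim (fun n => (P n z + (y - z) * D n) + (y - z) ^+ 2 * h n y).
  by congr ulim; apply/funext => n; exact: Ph.
have chb : cbounded (fun n => h n y) by exists (B * r * k ^+ 3); exact: ch.
rewrite ulimD ?ulimD ?ulimZ //; try exact: cboundedZ; try exact: cP; first ring.
by apply: cboundedD; [exact: cP | exact: cboundedZ].
Qed.

End Holomorphic.

Section Orders.
Context {R : realType}.
Local Notation C := (Cplx R).
Implicit Types (f g h : C -> C) (a z w l c : C) (r : R) (m n : int).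

Lemma near_all a (P : C -> Prop) : (forall z, P z) -> \forall z \near a, P z.
Proof. by move=> H; apply/nbhs_cmodP; exists 1 => // z _; exact: H. Qed.

Lemma dnear_all a (P : C -> Prop) : (forall z, P z) -> \forall z \near a^', P z.
Proof. by move=> H; apply/dnbhs_cmodP; exists 1 => // z _ _; exact: H. Qed.

Lemma holomorphic_cst c a : holomorphic_at (fun => c) a.
Proof. by apply: near_all => z; exact: cder_derivable (cder_cst c z). Qed.

Lemma holomorphic_id a : holomorphic_at id a.
Proof. by apply: near_all => z; exact: cder_derivable (cder_id z). Qed.

Lemma holomorphicD f g a : holomorphic_at f a -> holomorphic_at g a ->
  holomorphic_at (fun z => f z + g z) a.
Proof.
apply: filterS2 => z df dg.
exact: cder_derivable (cderD (derivable_cder df) (derivable_cder dg)).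
Qed.

Lemma holomorphicM f g a : holomorphic_at f a -> holomorphic_at g a ->
  holomorphic_at (fun z => f z * g z) a.
Proof.
apply: filterS2 => z df dg.
exact: cder_derivable (cderM (derivable_cder df) (derivable_cder dg)).
Qed.

Lemma holomorphicZ c f a : holomorphic_at f a -> holomorphic_at (fun z => c * f z) a.
Proof. by move=> hf; exact: holomorphicM (holomorphic_cst c a) hf. Qed.

Lemma holomorphicB f g a : holomorphic_at f a -> holomorphic_at g a ->
  holomorphic_at (fun z => f z - g z) a.
Proof.
apply: filterS2 => z df dg.
exact: cder_derivable (cderB (derivable_cder df) (derivable_cder dg)).
Qed.

Lemma holomorphic_sub c a : holomorphic_at (fun z => z - c) a.
Proof. exact: holomorphicB (holomorphic_id a) (holomorphic_cst c a). Qed.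

Lemma holomorphicX f a k : holomorphic_at f a -> holomorphic_at (fun z => f z ^+ k) a.
Proof.
apply: filterS => z df; exact: cder_derivable (cderX k (derivable_cder df)).
Qed.

Lemma continuous_neq0 f a : f @ a --> f a -> f a != 0 -> \forall z \near a, f z != 0.
Proof.
move=> /continuous_cmodP cf; rewrite -cmod_gt0 => fa0.
have [d d0 dP] := cf _ fa0.
apply/nbhs_cmodP; exists d => // z /dP; apply: contraTneq => ->.
by rewrite sub0r cmodN ltxx.
Qed.

Lemma holomorphic_neq0 f a : holomorphic_at f a -> f a != 0 -> \forall z \near a, f z != 0.
Proof. by move=> /holomorphic_continuous; exact: continuous_neq0. Qed.

Lemma holomorphicV f a : holomorphic_at f a -> f a != 0 ->
  holomorphic_at (fun z => (f z)^-1) a.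
Proof.
move=> hf fa0; apply: filterS2 (hf) (holomorphic_neq0 hf fa0) => z df fz0.
exact: cder_derivable (cderV fz0 (derivable_cder df)).
Qed.

Lemma holomorphic_exprz f a m : holomorphic_at f a -> f a != 0 ->
  holomorphic_at (fun z => f z ^ m) a.
Proof.
move=> hf fa0; case: m => k; first exact: holomorphicX.
by apply: holomorphicV; [exact: holomorphicX | rewrite expf_neq0].
Qed.

Lemma dnbhs_lim_eq f g a : f @ a --> f a -> g @ a --> g a ->
  (\forall z \near a^', f z = g z) -> f a = g a.
Proof.
move=> cf cg /dnbhs_cmodP [r r0 rP].
apply/eqP; rewrite -subr_eq0 -cmod_eq0 eq_le cmod_ge0 andbT.
apply/ler_addgt0Pr => e e0; rewrite add0r.
have e2 : 0 < e / 2 by rewrite divr_gt0.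
have [d1 d10 d1P] := (continuous_cmodP f a).1 cf _ e2.
have [d2 d20 d2P] := (continuous_cmodP g a).1 cg _ e2.
pose t := Num.min r (Num.min d1 d2) / 2.
have t0 : 0 < t by rewrite divr_gt0 // !lt_min r0 d10 d20.
pose z := a + t%:C%C.
have zt : cmod (z - a) = t by rewrite addrC addKr cmod_real gtr0_norm.
have tm : t < Num.min r (Num.min d1 d2).
  by rewrite /t ltr_pdivrMr // ltr_pMr ?ltr1n // !lt_min r0 d10 d20.
move: tm; rewrite !lt_min => /and3P[tr td1 td2].
have za : z != a by rewrite -subr_eq0 -cmod_gt0 zt.
have fg := rP z za; rewrite zt in fg.
apply: le_trans (cmod_tri (f z) _ _) _; rewrite [e]splitr; apply: lerD; apply: ltW.
  by rewrite cmodB d1P // zt.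
by rewrite (fg tr) d2P // zt.
Qed.

Lemma near_sub_neq0 a : \forall z \near a^', z - a != 0.
Proof. by apply/dnbhs_cmodP; exists 1 => // z za _; rewrite subr_eq0. Qed.

Lemma order_at_near f g a m : (\forall z \near a^', f z = g z) -> order_at g a m -> order_at f a m.
Proof.
move=> fg [h [hh h0 gh]]; exists h; split=> //.
by apply: filterS2 fg gh => z ->.
Qed.

Lemma order_at_hol f a : holomorphic_at f a -> f a != 0 -> order_at f a 0.
Proof. by move=> hf f0; exists f; split=> //; apply: dnear_all => z; rewrite expr0z mul1r. Qed.

Lemma order_at_neq0 f a m : order_at f a m -> \forall z \near a^', f z != 0.
Proof.
move=> [g [hg g0 fg]].
by apply: filterS (filterI fg (filterI (near_sub_neq0 a) (nbhs_dnbhs (holomorphic_neq0 hg g0)))) => z [-> [za gz]]; rewrite mulf_neq0 // expfz_neq0.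
Qed.

Lemma order_atM f g a m n : order_at f a m -> order_at g a n ->
  order_at (fun z => f z * g z) a (m + n).
Proof.
move=> [u [hu u0 fu]] [v [hv v0 gv]]; exists (fun z => u z * v z).
split; [exact: holomorphicM | by rewrite mulf_neq0 |].
by apply: filterS (filterI (near_sub_neq0 a) (filterI fu gv)) => z [za [-> ->]]; rewrite expfzDr // mulrACA.
Qed.

Lemma order_at_exprz f a m n : order_at f a m -> order_at (fun z => f z ^ n) a (m * n).
Proof.
move=> [u [hu u0 fu]]; exists (fun z => u z ^ n).
split; [exact: holomorphic_exprz | by rewrite expfz_neq0 |].
by apply: filterS fu => z ->; rewrite expfzMl exprz_exp.
Qed.

Lemma order_atX f a m k : order_at f a m -> order_at (fun z => f z ^+ k) a (m * k%:Z).
Proof. by move=> /(order_at_exprz k%:Z). Qed.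

Lemma order_at_prod (I : Type) (s : seq I) (F : I -> C -> C) (m : I -> int) a :
  (forall i, order_at (F i) a (m i)) ->
  order_at (fun z => \prod_(i <- s) F i z) a (\sum_(i <- s) m i).
Proof.
move=> H; elim: s => [|i s IH].
  rewrite big_nil; apply: (@order_at_near _ (fun=> 1)); last first.
    by apply: order_at_hol; [exact: holomorphic_cst | exact: oner_neq0].
  by apply: dnear_all => z; rewrite big_nil.
rewrite big_cons; apply: order_at_near (order_atM (H i) IH).
by apply: dnear_all => z; rewrite big_cons.
Qed.

Lemma order_at_le f a m n : order_at f a m -> order_at f a n -> m <= n -> m = n.
Proof.
move=> [u [hu u0 fu]] [v [hv v0 fv]] mn.
have [k kE] : exists k : nat, n = m + k%:Z.
  by exists `|n - m|%N; lia.
case: k kE => [|k] kE; first by rewrite kE addr0.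
have uv : \forall z \near a^', u z = (z - a) ^+ k.+1 * v z.
    apply: filterS (filterI (near_sub_neq0 a) (filterI fu fv)) => z [za [-> E]].
  apply: (mulfI (expfz_neq0 m za)); rewrite E kE expfzDr // mulrA.
  by rewrite -exprnP.
have hw : holomorphic_at (fun z => (z - a) ^+ k.+1 * v z) a.
  exact: holomorphicM (holomorphicX _ (holomorphic_sub a a)) hv.
have := dnbhs_lim_eq (holomorphic_continuous hu) (holomorphic_continuous hw) uv.
by rewrite subrr expr0n mul0r => /eqP; rewrite (negPf u0).
Qed.

Lemma order_at_uniq f a m n : order_at f a m -> order_at f a n -> m = n.
Proof.
by move=> fm fn; case: (leP m n) => [/(order_at_le fm fn)|/ltW/(order_at_le fn fm)].
Qed.

Lemma meromorphic_order f a : meromorphic_at f a ->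
  (\forall z \near a^', f z = 0) \/ exists m, order_at f a m.
Proof.
move=> [m [g [hg fg]]]; have [g0|[k [h [hh h0 gh]]]] := holomorphic_order hg.
  by left; apply: filterS2 fg (nbhs_dnbhs g0) => z -> ->; rewrite mulr0.
right; exists (m + k%:Z), h; split=> //.
by apply: filterS (filterI (near_sub_neq0 a) (filterI fg (nbhs_dnbhs gh))) => z [za [-> ->]]; rewrite expfzDr // mulrA -exprnP.
Qed.

Lemma order_meromorphic f a m : order_at f a m -> meromorphic_at f a.
Proof. by move=> [g [hg _ fg]]; exists m, g. Qed.

Lemma holomorphic_meromorphic f a : holomorphic_at f a -> meromorphic_at f a.
Proof. by move=> hf; exists 0, f; split=> //; apply: dnear_all => z; rewrite expr0z mul1r. Qed.

Lemma meromorphic_near f g a : (\forall z \near a^', f z = g z) ->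
  meromorphic_at g a -> meromorphic_at f a.
Proof. by move=> fg [m [h [hh gh]]]; exists m, h; split=> //; apply: filterS2 fg gh => z ->. Qed.

Lemma meromorphicM f g a : meromorphic_at f a -> meromorphic_at g a ->
  meromorphic_at (fun z => f z * g z) a.
Proof.
move=> [m [u [hu fu]]] [n [v [hv gv]]]; exists (m + n), (fun z => u z * v z).
split; first exact: holomorphicM.
by apply: filterS (filterI (near_sub_neq0 a) (filterI fu gv)) => z [za [-> ->]]; rewrite expfzDr // mulrACA.
Qed.

Lemma meromorphicX f a k : meromorphic_at f a -> meromorphic_at (fun z => f z ^+ k) a.
Proof.
move=> [m [u [hu fu]]]; exists (m * k%:Z), (fun z => u z ^+ k).
split; first exact: holomorphicX.
by apply: filterS fu => z ->; rewrite exprMn exprnP exprz_exp.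
Qed.

Lemma meromorphicV f a : meromorphic_at f a -> meromorphic_at (fun z => (f z)^-1) a.
Proof.
move=> /meromorphic_order[f0|[m fm]]; last first.
  apply: order_meromorphic (order_at_near _ (order_at_exprz (-1) fm)).
  by apply: dnear_all => z.
apply: meromorphic_near (holomorphic_meromorphic (holomorphic_cst 0 a)).
by apply: filterS f0 => z ->; rewrite invr0.
Qed.

Lemma holomorphic_div f a : holomorphic_at f a -> f a = 0 ->
  exists g, holomorphic_at g a /\ \forall z \near a, f z = (z - a) * g z.
Proof.
move=> hf fa0; have [f0|[m [g [hg g0 fg]]]] := holomorphic_order hf.
  exists (fun=> 0); split; first exact: holomorphic_cst.
  by apply: filterS f0 => z ->; rewrite mulr0.
case: m fg => [|m] fg.
  by move/nbhs_singleton: fg; rewrite fa0 expr0 mul1r => /eqP; rewrite eq_sym (negPf g0).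
exists (fun z => (z - a) ^+ m * g z); split.
  exact: holomorphicM (holomorphicX _ (holomorphic_sub a a)) hg.
by apply: filterS fg => z ->; rewrite exprS mulrA.
Qed.

End Orders.

(** * Meromorphic sections *)

Lemma near_mono (R : realType) (a : Cplx R) (P Q : Cplx R -> Prop) :
  (forall z, P z -> Q z) -> (\forall z \near a, P z) -> \forall z \near a, Q z.
Proof. by move=> PQ; apply: filterS. Qed.

Lemma dnear_mono (R : realType) (a : Cplx R) (P Q : Cplx R -> Prop) :
  (forall z, P z -> Q z) -> (\forall z \near a^', P z) -> \forall z \near a^', Q z.
Proof. by move=> PQ; apply: filterS. Qed.

Lemma near_and (T : topologicalType) (x : T) (P Q : T -> Prop) :
  (\forall y \near x, P y) -> (\forall y \near x, Q y) -> \forall y \near x, P y /\ Q y.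
Proof. exact: filterI. Qed.

Lemma dnear_and (R : realType) (a : Cplx R) (P Q : Cplx R -> Prop) :
  (\forall z \near a^', P z) -> (\forall z \near a^', Q z) ->
  \forall z \near a^', P z /\ Q z.
Proof. exact: filterI. Qed.

Section Charts.
Context {R : realType} {X : riemann_surface R}.
Local Notation C := (Cplx R).
Implicit Types (phi psi : chart R X) (x y : X) (z w : C).

Lemma chart_near_dom phi x : chart_dom phi x -> \forall y \near x, chart_dom phi y.
Proof. by move=> dx; exact: open_nbhs_nbhs (conj (chart_dom_open phi) dx). Qed.

Lemma chart_near phi x (P : C -> Prop) : chart_dom phi x ->
  (\forall z \near phi x, P z) -> \forall y \near x, P (phi y).
Proof.
move=> dx nP; have := @chart_fun_continuous _ _ phi.
rewrite continuous_open_subspace; last exact: chart_dom_open.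
by move=> /(_ x (mem_set dx)) /(_ _ nP).
Qed.

Lemma chart_near_cod phi x : chart_dom phi x ->
  \forall z \near phi x, chart_dom phi (chart_inv phi z) /\ phi (chart_inv phi z) = z.
Proof.
move=> dx; have : \forall z \near phi x, chart_cod phi z.
  by apply: open_nbhs_nbhs; split; [exact: chart_cod_open | exists x].
by apply: filterS => _ [y dy <-]; rewrite chart_funK.
Qed.

Lemma chart_inv_near phi x (P : X -> Prop) : chart_dom phi x ->
  (\forall y \near x, P y) -> \forall z \near phi x, P (chart_inv phi z).
Proof.
move=> dx nP; have := @chart_inv_continuous _ _ phi.
rewrite continuous_open_subspace; last exact: chart_cod_open.
have px : phi x \in phi @` chart_dom phi by rewrite inE; exists x.
by move=> /(_ _ px); apply; rewrite chart_funK.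
Qed.

Lemma transitionE phi psi x : chart_dom phi x -> transition phi psi (phi x) = psi x.
Proof. by move=> dx; rewrite /transition /= chart_funK. Qed.

Lemma transition_dnbhs phi psi x (P : C -> Prop) : chart_dom phi x -> chart_dom psi x ->
  (\forall w \near (psi x)^', P w) ->
  \forall z \near (phi x)^', P (transition phi psi z).
Proof.
move=> dx ex nP.
have h1 : \forall y \near x, psi y != psi x -> P (psi y) by exact: chart_near ex nP.
have h2 := chart_inv_near dx h1.
have h3 := chart_inv_near dx (chart_near_dom ex).
have h4 := chart_near_cod dx.
have : \forall z \near phi x, z != phi x -> P (transition phi psi z).
  apply: filterS (near_and h2 (near_and h3 h4)) => z [Pz [ez [dz zK]]] zx.
  apply: Pz; apply: contra zx => /eqP E; apply/eqP.
  by rewrite -zK -(chart_funK ez) E chart_funK.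
by [].
Qed.

Lemma transition_derivable phi psi x : atlas X phi -> atlas X psi ->
  chart_dom phi x -> chart_dom psi x ->
  \forall z \near phi x, derivable (transition phi psi) z 1.
Proof.
move=> aphi apsi dx ex.
have h := near_and (chart_inv_near dx (near_and (chart_near_dom dx) (chart_near_dom ex)))
  (chart_near_cod dx).
apply: near_mono h => z [[dz ez] [_ zK]].
by rewrite -{1}zK; exact: atlas_holomorphic.
Qed.

Definition vanishes_at (q : local_coefs X) x := exists phi,
  [/\ atlas X phi, chart_dom phi x & \forall z \near (phi x)^', q phi z = 0].

Lemma vanishes_atP k q x : meromorphic_section k q -> vanishes_at q x ->
  forall phi, atlas X phi -> chart_dom phi x -> \forall z \near (phi x)^', q phi z = 0.
Proof.
move=> [_ tq] [psi [apsi ex q0]] phi aphi dx.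
by apply: dnear_mono (dnear_and (tq _ _ aphi apsi x dx ex) (transition_dnbhs dx ex q0)) => z [-> ->]; rewrite mul0r.
Qed.

Lemma dnbhs_ex (a : C) (P : C -> Prop) : (\forall z \near a^', P z) -> exists z, P z.
Proof.
move=> /dnbhs_cmodP [r r0 rP]; exists (a + (r / 2)%:C%C).
have r1 : cmod (a + (r / 2)%:C%C - a) = r / 2.
  by rewrite addrC addKr cmod_real ger0_norm // ltW // divr_gt0.
apply: rP; first by rewrite -subr_eq0 -cmod_gt0 r1 divr_gt0.
by rewrite r1 ltr_pdivrMr // ltr_pMr // ltr1n.
Qed.

Lemma order_at_not_vanish (f : C -> C) a m : order_at f a m ->
  ~ \forall z \near a^', f z = 0.
Proof.
move=> /order_at_neq0 f1 f0; have [z [->]] := dnbhs_ex (dnear_and f0 f1).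
by rewrite eqxx.
Qed.

Lemma connected_all (P : X -> Prop) x : P x ->
  (forall y, P y -> \forall y' \near y, P y') ->
  (forall y, (forall U, nbhs y U -> exists y', P y' /\ U y') -> P y) ->
  forall y, P y.
Proof.
move=> Px oP cP y; have E : [set y | P y] = [set: X].
  apply: (@rs_connected _ X); first by exists x.
    by exists [set y | P y]; rewrite ?setTI //; rewrite openE.
  by exists [set y | P y]; rewrite ?setTI // => z cz; apply: cP => U /cz.
by have : [set: X] y by []; rewrite -E.
Qed.

(** The set where [q] vanishes locally is open. It is closed because a point at which [q] has an
    order has a punctured neighbourhood free of zeros. *)
Lemma identity_section k q x : meromorphic_section k q -> vanishes_at q x ->
  forall y, vanishes_at q y.
Proof.
move=> mq qx; apply: (connected_all qx) => [y [phi [aphi dy q0]]|z cz].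
  have h := near_and (chart_near dy (dnbhs_to_dnbhs q0)) (chart_near_dom dy).
  by apply: filterS h => w [w0 dw]; exists phi.
have [phi aphi dz] := atlas_cover z.
have /meromorphic_order[q0|[m qm]] : meromorphic_at (q phi) (phi z).
- by apply: (mq.1 phi aphi); exists z.
- by exists phi.
have h : \forall w \near phi z, w != phi z -> \forall u \near w, q phi u != 0.
  exact: near_dnbhs_near (order_at_neq0 qm).
have [w [qw [w1 dw]]] := cz _ (near_and (chart_near dz h) (chart_near_dom dz)).
have [ws|wz] := eqVneq (phi w) (phi z).
  by rewrite -(chart_funK dz) -ws chart_funK.
have qw0 := vanishes_atP mq qw aphi dw.
have [u [u0 /eqP u1]] := dnbhs_ex (dnear_and qw0 (nbhs_dnbhs (w1 wz))).
by case: (u1 u0).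
Qed.

Lemma vanishes_eq0 k q x : meromorphic_section k q -> vanishes_at q x ->
  eq_section q (@zero_section R X).
Proof.
move=> mq qx phi aphi _ [y dy <-].
exact: vanishes_atP mq (identity_section mq qx y) phi aphi dy.
Qed.

(** A coefficient is meaningful only on punctured neighbourhoods, so a value at [x] is read off from
    a holomorphic extension in some chart. *)
Definition local_value (s : local_coefs X) x v := exists phi g,
  [/\ atlas X phi, chart_dom phi x, holomorphic_at g (phi x),
      \forall z \near (phi x)^', s phi z = g z & g (phi x) = v].

Lemma local_value_uniq s x v v' : meromorphic_section 0 s ->
  local_value s x v -> local_value s x v' -> v = v'.
Proof.
move=> [_ ts] [phi [g [aphi dx hg sg <-]]] [psi [g' [apsi ex hg' sg' <-]]].
pose T := transition phi psi.
have dT : derivable T (phi x) 1 by exact: atlas_holomorphic.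
have cT := cder_continuous (derivable_cder dT).
have Tx : T (phi x) = psi x by exact: transitionE.
have -> : g' (psi x) = (g' \o T) (phi x) by rewrite /= Tx.
apply: dnbhs_lim_eq (holomorphic_continuous hg) _ _.
  have cg := holomorphic_continuous hg'; rewrite -Tx in cg.
  by move=> A /cg /cT.
have h := dnear_and (transition_dnbhs dx ex sg') (dnear_and sg (ts _ _ aphi apsi x dx ex)).
by apply: dnear_mono h => z /= [E1 [<- ->]]; rewrite expr0 mulr1.
Qed.

Definition locally_holomorphic (s : local_coefs X) := forall phi, atlas X phi ->
  forall a, chart_cod phi a ->
  exists g, holomorphic_at g a /\ \forall z \near a^', s phi z = g z.

(** [S] collects the values of the local extensions into a genuine continuous function. Its modulus
    attains a maximum by compactness; the maximum principle makes the set where [S] takes that value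
    open, and connectedness does the rest. *)
Lemma liouville s : compact [set: X] -> meromorphic_section 0 s ->
  locally_holomorphic s -> exists c : C, eq_section s (fun _ _ => c).
Proof.
move=> cX ms hs.
have [[x0 _]|nX] := pselect (exists x : X, True); last first.
  by exists 0 => phi _ a [y _ _]; case: nX; exists y.
have /choice [S SP] x : exists v, local_value s x v.
  have [phi aphi dx] := atlas_cover x.
  have [|g [hg sg]] := hs phi aphi (phi x); first by exists x.
  by exists (g (phi x)), phi, g.
have Snear phi x : atlas X phi -> chart_dom phi x -> exists g,
    [/\ holomorphic_at g (phi x), \forall z \near (phi x)^', s phi z = g z &
        \forall y \near x, S y = g (phi y)].
  move=> aphi dx; have [|g [hg sg]] := hs phi aphi (phi x); first by exists x.
  exists g; split=> //.
  have h1 := chart_near dx (dnbhs_to_dnbhs sg).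
  have h2 := chart_near dx (holomorphic_near hg).
  apply: filterS (near_and h1 (near_and h2 (chart_near_dom dx))) => y [y1 [y2 y3]].
  by apply: local_value_uniq ms (SP y) _; exists phi, g.
have cS0 x (A : set R) : nbhs (cmod (S x)) A -> \forall y \near x, A (cmod (S y)).
  move=> nA; have [phi aphi dx] := atlas_cover x.
  have [g [hg _ Sg]] := Snear _ _ aphi dx.
  have cg : \forall z \near phi x, A (cmod (g z)).
    have nA' : nbhs (cmod (g (phi x))) A by rewrite -(nbhs_singleton Sg).
    exact: (holomorphic_continuous hg) _ (cmod_continuous nA').
  apply: filterS (near_and Sg (chart_near dx cg)) => y [/= ->].
  exact.
have cS : continuous (cmod \o S) by move=> x A; exact: cS0.
have [|x1 _ x1max] := compact_EVT_max _ cX (continuous_subspaceT cS); first by exists x0.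
have Sx1 : forall y, S y = S x1.
  apply: (connected_all (erefl (S x1))) => [y Sy|y cy].
    have [phi aphi dy] := atlas_cover y.
    have [g [hg _ Sg]] := Snear _ _ aphi dy.
    have gy : g (phi y) = S x1 by rewrite -(nbhs_singleton Sg).
    have gmax : \forall z \near phi y, cmod (g z) <= cmod (g (phi y)).
      have h := near_and (chart_inv_near dy Sg) (chart_near_cod dy).
      apply: near_mono h => z [Sz [_ zK]]; rewrite zK in Sz.
      by rewrite -Sz gy; apply: x1max; rewrite inE.
    have gc := chart_near dy (max_modulus hg gmax).
    by apply: filterS (near_and Sg gc) => w [-> ->].
  have [phi aphi dy] := atlas_cover y.
  have [g [hg _ Sg]] := Snear _ _ aphi dy.
  apply/eqP; rewrite -subr_eq0 -cmod_eq0 eq_le cmod_ge0 andbT.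
  apply/ler_addgt0Pr => e e0; rewrite add0r.
  have [d d0 dP] := (continuous_cmodP g (phi y)).1 (holomorphic_continuous hg) _ e0.
  have gn : \forall z \near phi y, cmod (g z - g (phi y)) < e.
    by apply/nbhs_cmodP; exists d.
  have [w [Sw [Sw' gw]]] := cy _ (near_and Sg (chart_near dy gn)).
  by rewrite (nbhs_singleton Sg) -Sw Sw' cmodB ltW.
exists (S x1) => phi aphi _ [x dx <-].
have [g [hg sg Sg]] := Snear _ _ aphi dx.
have h := near_and (chart_inv_near dx Sg) (chart_near_cod dx).
by apply: dnear_mono (dnear_and sg (nbhs_dnbhs h)) => z [-> [+ [_ zK]]]; rewrite zK Sx1.
Qed.

End Charts.

(** * Sums and derivatives of meromorphic functions *)

Section MeromorphicDerivative.
Context {R : realType}.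
Local Notation C := (Cplx R).
Implicit Types (f g : C -> C) (a z w : C).

Lemma dnear_derive1 f g a : (\forall z \near a^', f z = g z) ->
  \forall z \near a^', derive1 f z = derive1 g z.
Proof.
move=> fg; apply: dnear_mono (near_dnbhs_near fg) => z fgz.
rewrite !derive1E; exact: near_eq_derive.
Qed.

(** Prescribing the pole order lets two functions be added over a common denominator. *)
Lemma meromorphic_shift f a (m : int) g (N : nat) : holomorphic_at g a ->
  (\forall z \near a^', f z = (z - a) ^ m * g z) -> (absz m <= N)%N ->
  exists u, holomorphic_at u a /\ \forall z \near a^', f z = (z - a) ^ (- N%:Z) * u z.
Proof.
move=> hg fg mN; exists (fun z => (z - a) ^+ absz (m + N%:Z) * g z).
split; first exact: holomorphicM (holomorphicX _ (holomorphic_sub a a)) hg.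
apply: dnear_mono (dnear_and (near_sub_neq0 a) fg) => z [za ->].
rewrite mulrA [in RHS]exprnP -expfzDr //; congr (_ ^ _ * _); lia.
Qed.

Lemma meromorphicD f g a : meromorphic_at f a -> meromorphic_at g a ->
  meromorphic_at (fun z => f z + g z) a.
Proof.
move=> [m [u [hu fu]]] [n [v [hv gv]]]; pose N := maxn (absz m) (absz n).
have [u' [hu' fu']] := meromorphic_shift hu fu (leq_maxl _ _ : (_ <= N)%N).
have [v' [hv' gv']] := meromorphic_shift hv gv (leq_maxr _ _ : (_ <= N)%N).
exists (- N%:Z), (fun z => u' z + v' z); split; first exact: holomorphicD.
by apply: dnear_mono (dnear_and fu' gv') => z [-> ->]; rewrite mulrDr.
Qed.

Lemma meromorphic_cst c a : meromorphic_at (fun => c) a.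
Proof. exact: holomorphic_meromorphic (holomorphic_cst c a). Qed.

Lemma cder_div_pow g a z k : z != a -> derivable g z 1 ->
  cder (fun w => g w / (w - a) ^+ k) z
   (derive1 g z / (z - a) ^+ k - k%:R * (g z / (z - a) ^+ k.+1)).
Proof.
rewrite -subr_eq0 => za dg.
have d1 : cder (fun w => w - a) z 1.
  by have := cderB (cder_id z) (cder_cst a z); rewrite subr0.
have d2 := @cderV _ (fun w => (w - a) ^+ k) z _ (expf_neq0 k za) (cderX k d1).
have := cderM (derivable_cder dg) d2.
rewrite (_ : _ + _ = derive1 g z / (z - a) ^+ k - k%:R * (g z / (z - a) ^+ k.+1)) //.
congr (_ + _); case: k {d2} => [|k]; first by rewrite !mul0r oppr0 !mulr0.
rewrite -pred_Sn !exprS expr0; field.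
by rewrite za expf_neq0.
Qed.

Lemma meromorphic_derive1 f a : meromorphic_at f a -> meromorphic_at (derive1 f) a.
Proof.
move=> [m [g [hg fg]]].
have [u [hu fu]] := meromorphic_shift hg fg (leqnn _).
set k := absz m in fu.
have fu' : \forall z \near a^', f z = u z / (z - a) ^+ k.
  by apply: dnear_mono fu => z ->; rewrite mulrC -exprnN.
have h := dnear_and (near_sub_neq0 a) (dnear_and (dnear_derive1 fu') (nbhs_dnbhs hu)).
have mu := holomorphic_meromorphic hu.
have mk j := meromorphicV (holomorphic_meromorphic (holomorphicX j (holomorphic_sub a a))).
apply: (@meromorphic_near _ _ (fun z => derive1 u z * ((z - a) ^+ k)^-1
  + - k%:R * (u z * ((z - a) ^+ k.+1)^-1))).
  apply: dnear_mono h => z [za [-> du]]; rewrite subr_eq0 in za.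
  by rewrite (cder_derive1 (cder_div_pow k za du)) mulNr.
apply: meromorphicD.
  exact: meromorphicM (holomorphic_meromorphic (holomorphic_derive1 hu)) (mk k).
exact: meromorphicM (meromorphic_cst _ _) (meromorphicM mu (mk k.+1)).
Qed.

Lemma meromorphic_near_derivable f a : meromorphic_at f a ->
  \forall z \near a^', derivable f z 1.
Proof.
move=> [m [g [hg fg]]].
have [u [hu fu]] := meromorphic_shift hg fg (leqnn _).
set k := absz m in fu.
have fu' : \forall z \near a^', f z = u z / (z - a) ^+ k.
  by apply: dnear_mono fu => z ->; rewrite mulrC -exprnN.
have h := dnear_and (near_sub_neq0 a) (dnear_and (near_dnbhs_near fu') (nbhs_dnbhs hu)).
apply: dnear_mono h => z [za [fz du]]; rewrite subr_eq0 in za.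
exact: cder_derivable (cder_near fz (cder_div_pow k za du)).
Qed.

End MeromorphicDerivative.

(** * Arithmetic of meromorphic sections *)

Section SectionAlgebra.
Context {R : realType} {X : riemann_surface R}.
Local Notation C := (Cplx R).
Implicit Types (phi psi : chart R X) (x y : X) (z w : C) (p q s : local_coefs X).

(** Chain rule for two mutually inverse transitions. *)
Lemma transition_derive1_neq0_at phi psi x : atlas X phi -> atlas X psi ->
  chart_dom phi x -> chart_dom psi x -> derive1 (transition phi psi) (phi x) != 0.
Proof.
move=> aphi apsi dx ex; pose T := transition phi psi; pose S := transition psi phi.
have dT : cder T (phi x) (derive1 T (phi x)).
  exact: derivable_cder (atlas_holomorphic aphi apsi dx ex).
have dS : cder S (T (phi x)) (derive1 S (psi x)).
  have -> : T (phi x) = psi x by exact: transitionE.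
  exact: derivable_cder (atlas_holomorphic apsi aphi ex dx).
have h := near_and (chart_inv_near dx (chart_near_dom ex)) (chart_near_cod dx).
have ST : \forall z \near phi x, id z = S (T z).
  apply: near_mono h => z [ez [dz zK]].
  by rewrite /S /T /transition /= chart_funK.
have := cder_unique (cder_id (phi x)) (cder_near ST (cder_comp dT dS)).
by move=> E; apply/eqP => T0; move: E; rewrite T0 mulr0 => /eqP; rewrite oner_eq0.
Qed.

Lemma transition_derive1_neq0 phi psi x : atlas X phi -> atlas X psi ->
  chart_dom phi x -> chart_dom psi x ->
  \forall z \near phi x, derive1 (transition phi psi) z != 0.
Proof.
move=> aphi apsi dx ex.
have h := near_and (chart_inv_near dx (near_and (chart_near_dom dx) (chart_near_dom ex)))
  (chart_near_cod dx).
apply: near_mono h => z [[dz ez] [_ zK]].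
by rewrite -{1}zK; exact: transition_derive1_neq0_at.
Qed.

Lemma section_mul k l p q : meromorphic_section k p -> meromorphic_section l q ->
  meromorphic_section (k + l) (fun phi z => p phi z * q phi z).
Proof.
move=> [mp tp] [mq tq]; split=> [phi aphi a ca|phi psi aphi apsi x dx ex].
  exact: meromorphicM (mp _ aphi _ ca) (mq _ aphi _ ca).
apply: dnear_mono (dnear_and (tp _ _ aphi apsi x dx ex) (tq _ _ aphi apsi x dx ex)).
by move=> z [-> ->]; rewrite exprD mulrACA.
Qed.

Lemma section_exp k p m : meromorphic_section k p ->
  meromorphic_section (k * m) (fun phi z => p phi z ^+ m).
Proof.
move=> [mp tp]; split=> [phi aphi a ca|phi psi aphi apsi x dx ex].
  exact: meromorphicX (mp _ aphi _ ca).
by apply: dnear_mono (tp _ _ aphi apsi x dx ex) => z ->; rewrite exprMn exprM.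
Qed.

Lemma section_add k p q : meromorphic_section k p -> meromorphic_section k q ->
  meromorphic_section k (fun phi z => p phi z + q phi z).
Proof.
move=> [mp tp] [mq tq]; split=> [phi aphi a ca|phi psi aphi apsi x dx ex].
  exact: meromorphicD (mp _ aphi _ ca) (mq _ aphi _ ca).
apply: dnear_mono (dnear_and (tp _ _ aphi apsi x dx ex) (tq _ _ aphi apsi x dx ex)).
by move=> z [-> ->]; rewrite mulrDl.
Qed.

Lemma section_cst c : meromorphic_section 0 (fun (_ : chart R X) (_ : C) => c).
Proof.
split=> [phi aphi a ca|phi psi aphi apsi x dx ex]; first exact: meromorphic_cst.
by apply: dnear_all => z; rewrite expr0 mulr1.
Qed.

Lemma section_scale k c p : meromorphic_section k p ->
  meromorphic_section k (fun phi z => c * p phi z).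
Proof. by move=> mp; have := section_mul (section_cst c) mp; rewrite add0n. Qed.

Lemma section_div k l p q : meromorphic_section (k + l) p -> meromorphic_section l q ->
  meromorphic_section k (fun phi z => p phi z / q phi z).
Proof.
move=> [mp tp] [mq tq]; split=> [phi aphi a ca|phi psi aphi apsi x dx ex].
  exact: meromorphicM (mp _ aphi _ ca) (meromorphicV (mq _ aphi _ ca)).
have T0 := nbhs_dnbhs (transition_derive1_neq0 aphi apsi dx ex).
apply: dnear_mono (dnear_and T0 (dnear_and (tp _ _ aphi apsi x dx ex) (tq _ _ aphi apsi x dx ex))).
move=> z [T0z [-> ->]]; rewrite exprD invfM.
move: (derive1 _ _) T0z (q psi _)^-1 (p psi _) => t t0 Q P.
by field; exact: expf_neq0.
Qed.

(** In weight 0 the chain rule produces the factor of a 1-form and no further term. *)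
Lemma section_derive1 p : meromorphic_section 0 p ->
  meromorphic_section 1 (fun phi => derive1 (p phi)).
Proof.
move=> [mp tp]; split=> [phi aphi a ca|phi psi aphi apsi x dx ex].
  exact: meromorphic_derive1 (mp _ aphi _ ca).
have cx : chart_cod psi (psi x) by exists x.
have h1 := transition_dnbhs dx ex (meromorphic_near_derivable (mp _ apsi _ cx)).
have h2 := nbhs_dnbhs (transition_derivable aphi apsi dx ex).
have h3 := near_dnbhs_near (tp _ _ aphi apsi x dx ex).
apply: dnear_mono (dnear_and h1 (dnear_and h2 h3)) => z [d1 [d2 pE]].
rewrite expr1; apply: cder_derive1.
have pE' : \forall w \near z, p phi w = p psi (transition phi psi w).
  by apply: near_mono pE => w ->; rewrite expr0 mulr1.
exact: cder_near pE' (cder_comp (derivable_cder d2) (derivable_cder d1)).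
Qed.

End SectionAlgebra.

(** * Necessity *)

Section Forward.
Context {R : realType} {X : riemann_surface R}.
Local Notation C := (Cplx R).
Implicit Types (phi psi : chart R X) (x y : X) (z w : C) (p q s : local_coefs X).

Lemma holomorphic_section_at k om phi x : holomorphic_section k om ->
  atlas X phi -> chart_dom phi x -> holomorphic_at (om phi) (phi x).
Proof.
move=> [_ hom] aphi dx; apply: near_mono (chart_near_cod dx) => z [dz zK].
by apply: hom aphi _ _; exists (chart_inv phi z).
Qed.

(** If the single basis form vanished, every scalar would be a coordinate of the zero form, against
    uniqueness. *)
Lemma genus1_form : has_genus X 1 -> exists om : local_coefs X,
  holomorphic_section 1 om /\ ~ eq_section om (@zero_section R X).
Proof.
move=> [w [hw uw]]; exists (w ord0); split=> [|w0]; first exact: hw.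
have w00 phi a : atlas X phi -> chart_cod phi a -> w ord0 phi a = 0.
  move=> aphi ca; have [x dx xa] := ca.
  have hx := holomorphic_continuous (holomorphic_section_at (hw ord0) aphi dx).
  rewrite -xa; apply: (@dnbhs_lim_eq _ (w ord0 phi) (fun=> 0) (phi x) hx).
    exact: (@cvg_ccst _ _ _ (nbhs_filter (phi x)) 0).
  by rewrite xa; exact: (w0 phi aphi a ca).
have h0 : holomorphic_section 1 (@zero_section R X).
  split; last by move=> *; exact: cder_derivable (cder_cst 0 _).
  split=> [phi _ a _|phi psi _ _ x _ _]; first exact: meromorphic_cst.
  by apply: dnear_all => z; rewrite /zero_section mul0r.
have [l [_ lu]] := uw _ h0.
have E (m : 'rV[C]_1) : l = m.
  apply: lu => phi aphi a ca; rewrite big1 // => i _.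
  by rewrite ord1 w00 ?mulr0.
have := E (const_mx 1); rewrite (E 0) => /matrixP /(_ 0 0); rewrite !mxE.
by move/eqP; rewrite eq_sym oner_eq0.
Qed.

Lemma nonzero_order k om phi x : meromorphic_section k om ->
  ~ eq_section om (@zero_section R X) -> atlas X phi -> chart_dom phi x ->
  exists m, order_at (om phi) (phi x) m.
Proof.
move=> mom om0 aphi dx.
have /meromorphic_order [h|//] : meromorphic_at (om phi) (phi x).
  by apply: (mom.1 phi aphi); exists x.
by case: om0; apply: (vanishes_eq0 (x := x) mom); exists phi.
Qed.

Lemma order0P (f : C -> C) (a : C) : order_at f a 0 -> exists g,
  [/\ holomorphic_at g a, g a != 0 & \forall z \near a^', f z = g z].
Proof.
by move=> [g [hg g0 fg]]; exists g; split=> //; apply: dnear_mono fg => z ->; rewrite expr0z mul1r.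
Qed.

Lemma complex_root (c : C) k : (0 < k)%N -> exists l : C, l ^+ k = c.
Proof.
move=> k0; have [l lE] := complex_acf_axiom (fun i => if i == 0%N then c else 0) k0.
exists l; rewrite [LHS]lE; case: (k) k0 => // j _.
by rewrite big_ord_recl /= expr0 mulr1 big1 ?addr0 // => i _; rewrite mul0r.
Qed.

Lemma power_of_form k om q : compact [set: X] -> holomorphic_section 1 om ->
  ~ eq_section om (@zero_section R X) -> meromorphic_section k q -> (0 < k)%N ->
  (forall phi, atlas X phi -> forall x, chart_dom phi x -> order_at (q phi) (phi x) 0) ->
  exists2 p, kdifferential 1 p & eq_section q (power_section p k).
Proof.
move=> cX hom om0 mq k0 q0; have mom := hom.1.
pose s : local_coefs X := fun phi z => om phi z ^+ k / q phi z.
have ms : meromorphic_section 0 s.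
  by apply: section_div mq; have := section_exp k mom; rewrite mul1n.
have hs : locally_holomorphic s.
  move=> phi aphi _ [x dx <-]; have [g [hg g0 qg]] := order0P (q0 _ aphi _ dx).
  exists (fun z => om phi z ^+ k * (g z)^-1); split.
    apply: holomorphicM (holomorphicX _ (holomorphic_section_at hom aphi dx)) _.
    exact: holomorphicV.
  by apply: dnear_mono qg => z qz; rewrite /s qz.
have [c sc] := liouville cX ms hs.
have [c0|c0] := eqVneq c 0.
  case: om0 => phi aphi _ [x dx <-].
  have cx : chart_cod phi (phi x) by exists x.
  apply: dnear_mono (dnear_and (sc _ aphi _ cx) (order_at_neq0 (q0 _ aphi _ dx))).
  move=> z [sz qz]; apply/eqP; move/eqP: sz; rewrite /s c0 mulf_eq0 invr_eq0 (negPf qz) orbF.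
  by rewrite expf_eq0 => /andP[].
have [l lk] := complex_root c^-1 k0.
have l0 : l != 0.
  apply/eqP => l0; move: lk; rewrite l0 expr0n eqn0Ngt k0 => /eqP.
  by rewrite eq_sym invr_eq0 (negPf c0).
exists (fun phi z => l * om phi z).
  split; first exact: section_scale.
  move=> H; apply: om0 => phi aphi a ca; apply: dnear_mono (H _ aphi _ ca) => z.
  by move/eqP; rewrite mulf_eq0 (negPf l0) => /eqP.
move=> phi aphi _ [x dx <-].
have cx : chart_cod phi (phi x) by exists x.
apply: dnear_mono (dnear_and (sc _ aphi _ cx) (order_at_neq0 (q0 _ aphi _ dx))).
move=> z [sz qz]; rewrite /power_section exprMn lk -[om phi z ^+ k](divfK qz).
by rewrite -/(s phi z) sz mulKf.
Qed.

(** One step of an expansion in powers of [r] instead of z - a: the coefficient matches the values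
    at [a], so the difference is divisible by z - a. *)
Lemma pole_step (a : C) (r h : C -> C) n : holomorphic_at r a -> holomorphic_at h a ->
  r a != 0 -> exists h1, holomorphic_at h1 a /\
    \forall z \near a, h z = (h a / r a ^+ n) * r z ^+ n + (z - a) * h1 z.
Proof.
move=> hr hh r0; set c := h a / r a ^+ n.
have hd : holomorphic_at (fun z => h z - c * r z ^+ n) a.
  exact: holomorphicB hh (holomorphicZ c (holomorphicX n hr)).
have [|h1 [hh1 hE]] := holomorphic_div hd.
  by rewrite /c divfK ?subrr // expf_neq0.
exists h1; split; first exact: hh1.
by apply: near_mono hE => z E; rewrite -E addrC subrK.
Qed.

(** As f = r / (z - a), expanding [h] with the successive terms r^3, r^2, r turns the pole part of h
    / (z - a)^3 into a combination of f^3, f^2, f, with a holomorphic rest. *)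
Lemma pole_cubic (a : C) (f s r h : C -> C) : holomorphic_at r a -> holomorphic_at h a ->
  r a != 0 -> h a != 0 ->
  (\forall z \near a^', f z = (z - a)^-1 * r z) ->
  (\forall z \near a^', s z = (z - a)^-1 ^+ 3 * h z) ->
  exists (al be ga : C) g, [/\ al != 0, holomorphic_at g a &
    \forall z \near a^', s z - (al * f z ^+ 3 + be * f z ^+ 2 + ga * f z) = g z].
Proof.
move=> hr hh r0 h0 fr sh.
have [h1 [hh1 E1]] := pole_step 3 hr hh r0.
have [h2 [hh2 E2]] := pole_step 2 hr hh1 r0.
have [h3 [hh3 E3]] := pole_step 1 hr hh2 r0.
exists (h a / r a ^+ 3), (h1 a / r a ^+ 2), (h2 a / r a ^+ 1), h3.
split; [by rewrite mulf_neq0 // invr_eq0 expf_neq0| exact: hh3|].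
have E := dnear_and (near_sub_neq0 a) (dnear_and fr (dnear_and sh
  (nbhs_dnbhs (near_and E1 (near_and E2 E3))))).
apply: dnear_mono E => z [za [-> [-> [e1 [e2 e3]]]]].
rewrite e1 e2 e3; move: (h a / _) (h1 a / _) (h2 a / _) => A B D.
by field.
Qed.

Lemma near_continuous (T : C -> C) (a : C) (P : C -> Prop) : T @ a --> T a ->
  (\forall w \near T a, P w) -> \forall z \near a, P (T z).
Proof. by move=> cT; exact: cT. Qed.

Lemma extension_chart s phi psi x (g : C -> C) : meromorphic_section 0 s ->
  atlas X phi -> atlas X psi -> chart_dom phi x -> chart_dom psi x ->
  holomorphic_at g (phi x) -> (\forall z \near (phi x)^', s phi z = g z) ->
  exists g', holomorphic_at g' (psi x) /\ \forall z \near (psi x)^', s psi z = g' z.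
Proof.
move=> [_ ts] aphi apsi dx ex hg sg; pose T := transition psi phi.
exists (fun z => g (T z)); split.
  have dT := transition_derivable apsi aphi ex dx.
  have hg' : holomorphic_at g (T (psi x)) by rewrite /T transitionE.
  have cT := cder_continuous (derivable_cder (nbhs_singleton dT)).
  have dg := near_continuous cT hg'.
  apply: near_mono (near_and dT dg) => z [d1 d2].
  exact: cder_derivable (cder_comp (derivable_cder d1) (derivable_cder d2)).
have h := dnear_and (transition_dnbhs ex dx sg) (ts _ _ apsi aphi x ex dx).
by apply: dnear_mono h => z [<- ->]; rewrite expr0 mulr1.
Qed.

Lemma locally_holomorphicP s : meromorphic_section 0 s ->
  (forall x, exists phi g, [/\ atlas X phi, chart_dom phi x, holomorphic_at g (phi x) &
     \forall z \near (phi x)^', s phi z = g z]) -> locally_holomorphic s.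
Proof.
move=> ms H psi apsi _ [x ex <-]; have [phi [g [aphi dx hg sg]]] := H x.
exact: extension_chart ms aphi apsi dx ex hg sg.
Qed.

Lemma quadratic_split (al be ga : C) : al != 0 -> exists t u, forall x : C,
  al * x ^+ 2 + be * x + ga = al * (x - t) * (x - u).
Proof.
move=> al0; have [d dE] := @complex_root (be ^+ 2 - 4 * al * ga) 2 isT.
exists ((- be + d) / (2 * al)), ((- be - d) / (2 * al)) => x.
have -> : ga = (be ^+ 2 - d ^+ 2) / (4 * al) by rewrite dE; field.
by field.
Qed.

(* f = om^k / q has a simple pole at x1 only, and a zero at x2. The function
   s = om^(k-1) f' / q has a triple pole at x1 only, hence equals a cubic polynomial
   in f, without constant term since s vanishes at x2. As s = f f' / om, this
   is an autonomous equation f' = om T(f) with T quadratic. *)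
Lemma no_simple_pole k om q x1 x2 : compact [set: X] -> holomorphic_section 1 om ->
  ~ eq_section om (@zero_section R X) -> meromorphic_section k q -> (0 < k)%N ->
  (forall phi, atlas X phi -> chart_dom phi x1 -> order_at (q phi) (phi x1) 1) ->
  (forall phi, atlas X phi -> chart_dom phi x2 -> order_at (q phi) (phi x2) (- 1)) ->
  (forall phi x, atlas X phi -> chart_dom phi x -> x <> x1 -> x <> x2 ->
     order_at (q phi) (phi x) 0) -> False.
Proof.
move=> cX hom om0 mq k0 q1 q2 q0; have mom := hom.1.
have hol_om phi x := @holomorphic_section_at 1 om phi x hom.
pose f : local_coefs X := fun phi z => om phi z ^+ k / q phi z.
have mf : meromorphic_section 0 f.
  by apply: section_div mq; have := section_exp k mom; rewrite mul1n.
(* This is f f' / om written without dividing by [om], so that zeros of [om], which are not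
   excluded, create no poles. *)
pose s : local_coefs X := fun phi z =>
  om phi z ^+ k.-1 * derive1 (f phi) z / q phi z.
have ms : meromorphic_section 0 s.
  apply: section_div mq.
  have := section_mul (section_exp k.-1 mom) (section_derive1 mf).
  by rewrite mul1n addn1 prednK.
have order_q phi x : atlas X phi -> chart_dom phi x -> exists m, order_at (q phi) (phi x) m.
  move=> aphi dx; have [xE|n1] := pselect (x = x1); first by exists 1; subst x; exact: q1.
  have [xE|n2] := pselect (x = x2); first by exists (-1); subst x; exact: q2.
  by exists 0; exact: q0.
have q_neq0 phi x : atlas X phi -> chart_dom phi x -> \forall z \near (phi x)^', q phi z != 0.
  by move=> aphi dx; have [m /order_at_neq0] := order_q _ _ aphi dx.
have x12 : x1 <> x2.
  move=> E; have [phi aphi dx] := atlas_cover x1.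
  have := order_at_uniq (q1 _ aphi dx); rewrite E in dx * => /(_ _ (q2 _ aphi dx)).
  by [].
(* Away from x1 the inverse of [q] extends holomorphically, with a zero at x2; [f] and [s] inherit
   both properties. *)
have reg phi x : atlas X phi -> chart_dom phi x -> x <> x1 -> exists F S : C -> C,
    [/\ holomorphic_at F (phi x), holomorphic_at S (phi x),
       \forall z \near (phi x)^', f phi z = F z,
       \forall z \near (phi x)^', s phi z = S z &
       x = x2 -> F (phi x) = 0 /\ S (phi x) = 0].
  move=> aphi dx n1; set a := phi x.
  have [b [g [hb hg g0 qg b2]]] : exists (b g : C -> C),
      [/\ holomorphic_at b a, holomorphic_at g a, g a != 0,
         \forall z \near a^', (q phi z)^-1 = b z / g z & x = x2 -> b a = 0].
    have [xE|n2] := pselect (x = x2).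
      have [g [hg g0 qg]] : order_at (q phi) a (-1) by subst x; exact: q2.
      exists (fun z => z - a), g; split; [exact: holomorphic_sub|exact: hg|exact: g0| |].
        by apply: dnear_mono qg => z ->; rewrite invfM exprN1 invrK.
      by rewrite subrr.
    have [g [hg g0 qg]] := order0P (q0 _ _ aphi dx n1 n2).
    exists (fun=> 1), g; split; [exact: holomorphic_cst|exact: hg|exact: g0| |].
      by apply: dnear_mono qg => z ->; rewrite mul1r.
    by move=> /n2.
  have hgV := holomorphicV hg g0.
  have hF := holomorphicM (holomorphicX k (hol_om _ _ aphi dx)) (holomorphicM hb hgV).
  have hS := holomorphicM (holomorphicM (holomorphicX k.-1 (hol_om _ _ aphi dx))
    (holomorphic_derive1 hF)) (holomorphicM hb hgV).
  have fF : \forall z \near a^', f phi z = om phi z ^+ k * (b z * (g z)^-1).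
    by apply: dnear_mono qg => z E; rewrite /f E.
  exists (fun z => om phi z ^+ k * (b z * (g z)^-1)), (fun z => om phi z ^+ k.-1 *
    derive1 (fun z => om phi z ^+ k * (b z * (g z)^-1)) z * (b z * (g z)^-1)); split.
  - exact: hF.
  - exact: hS.
  - exact: fF.
  - apply: dnear_mono (dnear_and qg (dnear_derive1 fF)) => z [E1 E2].
    by rewrite /s E1 E2.
  - by move=> /b2 ->; rewrite !mul0r !mulr0.
have [phi1 aphi1 d1] := atlas_cover x1.
have [phi2 aphi2 d2] := atlas_cover x2.
set a := phi1 x1.
have [g [hg g0 qg]] := q1 _ aphi1 d1.
have hgV := holomorphicV hg g0; have hom1 := hol_om _ _ aphi1 d1.
pose r z := om phi1 z ^+ k * (g z)^-1.
have hr : holomorphic_at r a := holomorphicM (holomorphicX k hom1) hgV.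
have fr : \forall z \near a^', f phi1 z = (z - a)^-1 * r z.
  by apply: dnear_mono qg => z E; rewrite /f E expr1z invfM mulrCA.
have lhP u : meromorphic_section 0 u -> (exists g', holomorphic_at g' a /\
      \forall z \near a^', u phi1 z = g' z) ->
    (forall phi x, atlas X phi -> chart_dom phi x -> x <> x1 ->
      exists g', holomorphic_at g' (phi x) /\ \forall z \near (phi x)^', u phi z = g' z) ->
    exists c : C, eq_section u (fun _ _ => c).
  move=> mu [g' [hg' ug']] H; apply: (liouville cX mu).
  apply: (locally_holomorphicP mu) => x; have [->|n1] := pselect (x = x1).
    by exists phi1, g'.
  have [phi aphi dx] := atlas_cover x.
  by have [g'' [h1 h2]] := H _ _ aphi dx n1; exists phi, g''.
have cd1 : chart_cod phi1 (phi1 x1) by exists x1.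
have cd2 : chart_cod phi2 (phi2 x2) by exists x2.
have [F2 [S2 [hF2 hS2 fF2 sS2 /(_ erefl) [F20 S20]]]] := reg _ _ aphi2 d2 (nesym x12).
(* Otherwise f would be constant, hence 0 as it vanishes at x2. *)
have r0 : r a != 0.
  apply/eqP => r0; have [r1 [hr1 rE]] := holomorphic_div hr r0.
  have [||c fc] := lhP f mf.
  - exists r1; split=> [|]; first exact: hr1.
    apply: dnear_mono (dnear_and (near_sub_neq0 a) (dnear_and fr (nbhs_dnbhs rE))).
    by move=> z [za [-> ->]]; rewrite mulKf.
  - move=> phi x aphi dx n1; have [F [S [hF _ fF _ _]]] := reg _ _ aphi dx n1.
    by exists F; split; [exact: hF | exact: fF].
  have c0 : F2 (phi2 x2) = c.
    apply: (@dnbhs_lim_eq _ F2 (fun=> c) (phi2 x2) (holomorphic_continuous hF2)).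
      exact: (@cvg_ccst _ _ _ (nbhs_filter (phi2 x2)) c).
    by apply: dnear_mono (dnear_and fF2 (fc _ aphi2 _ cd2)) => z [<- <-].
  apply: om0; apply: (vanishes_eq0 (x := x1) mom); exists phi1; split=> [//|//|].
  apply: dnear_mono (dnear_and (fc _ aphi1 _ cd1) (q_neq0 _ _ aphi1 d1)) => z [fz qz].
  apply/eqP; move/eqP: fz; rewrite -c0 F20 /f mulf_eq0 invr_eq0 (negPf qz) orbF.
  by rewrite expf_eq0 => /andP[].
have oma0 : om phi1 a != 0.
  by apply: contraNneq r0 => E; rewrite /r E expr0n eqn0Ngt k0 mul0r.
(* f' = ((z - a) r' - r) / (z - a)^2, and 1/q adds the third factor 1 / (z - a). At [a] only the
   term - r survives. *)
pose h z := om phi1 z ^+ k.-1 * ((z - a) * derive1 r z - r z) * (g z)^-1.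
have hh : holomorphic_at h a.
  apply: holomorphicM hgV; apply: holomorphicM (holomorphicX _ hom1) _.
  exact: holomorphicB (holomorphicM (holomorphic_sub a a) (holomorphic_derive1 hr)) hr.
have h0 : h a != 0.
  by rewrite /h subrr mul0r sub0r mulf_neq0 ?invr_eq0 // mulf_neq0 ?oppr_eq0 // expf_neq0.
have sh : \forall z \near a^', s phi1 z = (z - a)^-1 ^+ 3 * h z.
  have fr' : \forall z \near a^', f phi1 z = r z / (z - a) ^+ 1.
    by apply: dnear_mono fr => z ->; rewrite expr1 mulrC.
  apply: dnear_mono (dnear_and (near_sub_neq0 a) (dnear_and qg (dnear_and
    (dnear_derive1 fr') (nbhs_dnbhs (near_and hr (holomorphic_neq0 hg g0)))))).
  move=> z [za [E1 [E2 [dr gz]]]].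
  have za' : z != a by rewrite -subr_eq0.
  rewrite /s E1 E2 (cder_derive1 (cder_div_pow 1 za' dr)) /h expr1z -/a.
  move: (om _ z ^+ _) (derive1 r z) (r z) (g z) gz => A D E B gz.
  by field; rewrite gz za.
have [al [be [ga [G [al0 hG uG]]]]] := pole_cubic hr hh r0 h0 fr sh.
pose u : local_coefs X := fun phi z =>
  s phi z + -1 * (al * f phi z ^+ 3 + be * f phi z ^+ 2 + ga * f phi z).
have mu : meromorphic_section 0 u.
  have mfX n : meromorphic_section 0 (fun phi z => f phi z ^+ n).
    by have := section_exp n mf; rewrite mul0n.
  apply: section_add ms (section_scale _ _); apply: section_add (section_scale _ mf).
  exact: section_add (section_scale _ (mfX 3)) (section_scale _ (mfX 2)).
have cubic_hol (F : C -> C) b : holomorphic_at F b ->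
    holomorphic_at (fun z => al * F z ^+ 3 + be * F z ^+ 2 + ga * F z) b.
  move=> hF; apply: holomorphicD (holomorphicZ ga hF).
  exact: holomorphicD (holomorphicZ al (holomorphicX 3 hF)) (holomorphicZ be (holomorphicX 2 hF)).
have [||c uc] := lhP u mu.
- by exists G; split; [exact: hG | apply: dnear_mono uG => z <-; rewrite /u mulN1r].
- move=> phi x aphi dx n1; have [F [S [hF hS fF sS _]]] := reg _ _ aphi dx n1.
  exists (fun z => S z - (al * F z ^+ 3 + be * F z ^+ 2 + ga * F z)).
  split; first exact: holomorphicB hS (cubic_hol _ _ hF).
  by apply: dnear_mono (dnear_and fF sS) => z [E1 E2]; rewrite /u E1 E2 mulN1r.
have c0 : c = 0.
  have hW := holomorphicB hS2 (cubic_hol _ _ hF2).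
  have := @dnbhs_lim_eq _ _ (fun=> c) (phi2 x2) (holomorphic_continuous hW)
    (@cvg_ccst _ _ _ (nbhs_filter (phi2 x2)) c).
  rewrite F20 S20 !expr0n !mulr0 !addr0 subrr => <- //.
  apply: dnear_mono (dnear_and (uc _ aphi2 _ cd2) (dnear_and fF2 sS2)) => z [<- [<- <-]].
  by rewrite /u mulN1r.
have [t [t' ttE]] := quadratic_split be ga al0.
(* Off the zeros of [om] and [q] the function [f] is nonzero, so it cancels from f f' = om (al f^3 +
   be f^2 + ga f). *)
have ode phi x : atlas X phi -> chart_dom phi x -> \forall z \near (phi x)^',
    derive1 (f phi) z = om phi z * (al * (f phi z - t) * (f phi z - t')).
  move=> aphi dx; have cx : chart_cod phi (phi x) by exists x.
  have [m omm] := nonzero_order mom om0 aphi dx.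
  apply: dnear_mono (dnear_and (uc _ aphi _ cx) (dnear_and (q_neq0 _ _ aphi dx)
    (order_at_neq0 omm))) => z [uz [qz oz]].
  rewrite -ttE; move: uz; rewrite /u c0 /s.
  have fz : f phi z * q phi z = om phi z ^+ k by rewrite /f divfK.
  have ok : om phi z ^+ k = om phi z * om phi z ^+ k.-1 by rewrite -exprS prednK.
  have ok0 : om phi z ^+ k.-1 != 0 by rewrite expf_neq0.
  move: fz; rewrite ok; move: (om phi z) oz (om phi z ^+ k.-1) ok0 => o o0 W W0.
  move: (q phi z) qz (f phi z) (derive1 _ z) => Q Q0 y y' fz.
  have yE : y = o * W / Q by rewrite -fz mulfK.
  move=> uz; apply: (mulfI W0); apply/eqP; rewrite -subr_eq0; apply/eqP.
  rewrite -[RHS](mulr0 Q) -uz.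
  have -> : al * y ^+ 3 + be * y ^+ 2 + ga * y = (o * W / Q) * (al * y ^+ 2 + be * y + ga).
    by rewrite -yE; ring.
  by field.
(* If f - t vanished to order m+1 at x, so would f' = om T(f), which has order m. *)
have noval phi x (F : C -> C) : atlas X phi -> chart_dom phi x -> x <> x1 ->
    holomorphic_at F (phi x) -> (\forall z \near (phi x)^', f phi z = F z) -> F (phi x) != t.
  move=> aphi dx n1 hF fF; apply/eqP => Ft; set b := phi x.
  have hFt := holomorphicB hF (holomorphic_cst t b).
  have [F0|[m [v [hv v0 FE]]]] := holomorphic_order hFt.
    (* If [f] equals t near [x], it does so everywhere by the identity theorem; near x1 this reads r
       = t (z - a), against r a != 0. *)
    pose ft : local_coefs X := fun phi z => f phi z + -1 * t.
    have mft : meromorphic_section 0 ft.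
      exact: section_add mf (section_scale _ (section_cst t)).
    have vft : vanishes_at ft x.
      exists phi; split=> [//|//|].
      by apply: dnear_mono (dnear_and fF (nbhs_dnbhs F0)) => z [E1 E2]; rewrite /ft E1 mulN1r.
    have ftr := vanishes_atP mft (identity_section mft vft x1) aphi1 d1.
    have := @dnbhs_lim_eq _ r (fun z => t * (z - a)) a (holomorphic_continuous hr)
      (holomorphic_continuous (holomorphicZ t (holomorphic_sub a a))).
    rewrite subrr mulr0 => E; move: r0; rewrite E ?eqxx //.
    apply: dnear_mono (dnear_and (near_sub_neq0 a) (dnear_and fr ftr)) => z [za [E1]].
    rewrite /ft E1 mulN1r => /eqP; rewrite subr_eq0 => /eqP <-.
    by rewrite mulrAC mulVf ?mul1r.
  case: m FE => [|m] FE.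
    move/nbhs_singleton: FE; rewrite Ft subrr expr0 mul1r => /eqP.
    by rewrite eq_sym (negPf v0).
  have hom' := hol_om _ _ aphi dx.
  (* With f = t + (z - b)^(m+1) v, the equation f' = om T(f) divided by (z - b)^m reads L = K; but
     [K] vanishes at [b] and [L] does not. *)
  pose L z := m.+1%:R * v z + (z - b) * derive1 v z.
  pose K z := (z - b) * (om phi z * (al * v z * (F z - t'))).
  have hL : holomorphic_at L b.
    apply: holomorphicD (holomorphicZ _ hv) _.
    exact: holomorphicM (holomorphic_sub b b) (holomorphic_derive1 hv).
  have hK : holomorphic_at K b.
    apply: holomorphicM (holomorphic_sub b b) (holomorphicM hom' _).
    exact: holomorphicM (holomorphicZ al hv) (holomorphicB hF (holomorphic_cst t' b)).
  have := dnbhs_lim_eq (holomorphic_continuous hL) (holomorphic_continuous hK).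
  rewrite /L /K subrr !mul0r addr0 => E.
  have : m.+1%:R * v b != 0 by rewrite mulf_neq0 // pnatr_eq0.
  rewrite E ?eqxx //.
  have FE' : \forall z \near b^', F z = t + (z - b) ^+ m.+1 * v z.
    by apply: dnear_mono (nbhs_dnbhs FE) => z <-; rewrite addrC subrK.
  have dF := dnear_derive1 FE'.
  have df := dnear_derive1 fF.
  apply: dnear_mono (dnear_and (near_sub_neq0 b) (dnear_and (ode _ _ aphi dx)
    (dnear_and fF (dnear_and FE' (dnear_and dF (dnear_and df (nbhs_dnbhs hv))))))).
  move=> z [zb [odez [fz [Fz [dFz [dfz dv]]]]]].
  have zb' : z != b by rewrite -subr_eq0.
  have dd : cder (fun w => t + (w - b) ^+ m.+1 * v w) z
      (0 + (m.+1%:R * (z - b) ^+ m * (1 - 0) * v z + (z - b) ^+ m.+1 * derive1 v z)).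
    apply: cderD (cder_cst t z) (cderM _ (derivable_cder dv)).
    exact: (@cderX _ (fun w => w - b) z _ m.+1 (cderB (cder_id z) (cder_cst b z))).
  rewrite dfz dFz (cder_derive1 dd) fz in odez.
  apply: (mulfI (expf_neq0 m zb)).
  have -> : F z - t' = t + (z - b) ^+ m.+1 * v z - t' by rewrite Fz.
  move: odez; rewrite Fz exprS.
  move: ((z - b) ^+ m) (om phi z) (v z) (derive1 v z) => P o V V' odez.
  transitivity (0 + (m.+1%:R * P * (1 - 0) * V + (z - b) * P * V')); first by ring.
  by rewrite odez; ring.
pose v : local_coefs X := fun phi z => 1 / (f phi z + -1 * t).
have mv : meromorphic_section 0 v.
  have mft := section_add mf (section_scale (-1) (section_cst t)).
  exact: (@section_div _ _ 0 0 _ _ (section_cst 1) mft).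
(* Near x1, 1 / (f - t) = (z - a) / D, which has a zero at [a]. *)
pose D z := r z - t * (z - a).
have hD : holomorphic_at D a := holomorphicB hr (holomorphicZ t (holomorphic_sub a a)).
have D0 : D a != 0 by rewrite /D subrr mulr0 subr0.
have vD : \forall z \near a^', v phi1 z = (z - a) * (D z)^-1.
  apply: dnear_mono (dnear_and (near_sub_neq0 a) fr) => z [za E1].
  rewrite /v E1 /D -[z - a in RHS]invrK -invfM mul1r; congr (_^-1).
  by field.
have hvD := holomorphicM (holomorphic_sub a a) (holomorphicV hD D0).
have [||e ve] := lhP v mv.
- by exists (fun z => (z - a) * (D z)^-1).
- move=> phi x aphi dx n1; have [F [S [hF _ fF _ _]]] := reg _ _ aphi dx n1.
  have nF := noval _ _ _ aphi dx n1 hF fF.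
  exists (fun z => (F z - t)^-1); split.
    by apply: holomorphicV; [exact: holomorphicB hF (holomorphic_cst t _) | rewrite subr_eq0].
  by apply: dnear_mono fF => z E; rewrite /v E mulN1r mul1r.
have e0 : e = 0.
  have := @dnbhs_lim_eq _ _ (fun=> e) a (holomorphic_continuous hvD)
    (@cvg_ccst _ _ _ (nbhs_filter a) e).
  rewrite subrr mul0r => <- //.
  by apply: dnear_mono (dnear_and vD (ve _ aphi1 _ cd1)) => z [<- <-].
(* 1 / (f - t) is holomorphic, and vanishes at x1. *)
have [z [za [vz [vDz Dz]]]] := dnbhs_ex (dnear_and (near_sub_neq0 a)
  (dnear_and (ve _ aphi1 _ cd1) (dnear_and vD (nbhs_dnbhs (holomorphic_neq0 hD D0))))).
move: vz; rewrite vDz e0 => /eqP; rewrite mulf_eq0 (negPf za) invr_eq0.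
by rewrite (negPf Dz).
Qed.

End Forward.

(** * Connectedness of the punctured plane *)

Section PuncturedPlane.
Context {R : realType}.
Local Notation C := (Cplx R).
Implicit Types (z w a : C).

(** Connectedness of [0, 1] as an induction principle for locally constant properties. *)
Lemma unit_segment_ind (P : R -> Prop) :
  (forall t, 0 <= t <= 1 -> P t -> \forall s \near t, P s) ->
  (forall t, 0 <= t <= 1 -> ~ P t -> \forall s \near t, ~ P s) ->
  P 0 -> P 1.
Proof.
move=> oP oN P0.
have E : `[0, 1] `&` [set t | P t] = `[0, 1]%classic :> set R.
  apply: (@segment_connected R 0 1).
  - by exists 0; split=> //=; rewrite in_itv /= lexx ler01.
  - exists [set t | P t]°; first exact: open_interior.
    apply/seteqP; split=> t [t01] Pt; split=> //; last exact: interior_subset Pt.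
    by apply: (oP t) => //; move: t01; rewrite /= in_itv.
  - exists (~` [set t | ~ P t]°); first by apply: open_closedC; exact: open_interior.
    apply/seteqP; split=> t [t01] h; split=> //; first by move=> /interior_subset.
    apply: contrapT => nP; apply: h; apply: (oN t) nP.
    by move: t01; rewrite /= in_itv.
have : `[0, 1]%classic (1 : R) by rewrite /= in_itv /= ler01 lexx.
by rewrite -E => -[].
Qed.

Lemma segment_ind (P : C -> Prop) z w :
  (forall t : R, 0 <= t <= 1 -> z + t%:C%C * (w - z) != 0) ->
  (forall a, a != 0 -> P a -> \forall b \near a, P b) ->
  (forall a, a != 0 -> ~ P a -> \forall b \near a, ~ P b) ->
  P z -> P w.
Proof.
move=> seg oP oN Pz; pose g (t : R) : C := z + t%:C%C * (w - z).
have cg t (Q : C -> Prop) : (\forall b \near g t, Q b) -> \forall s \near t, Q (g s).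
  move=> /nbhs_cmodP [r r0 rQ]; apply/nbhs_normP.
  exists (r / (cmod (w - z) + 1)) => /=; first by rewrite divr_gt0 // ltr_wpDl ?cmod_ge0.
  move=> s /=; rewrite ltr_pdivlMr ?ltr_wpDl ?cmod_ge0 // => st; apply: rQ.
  have -> : g s - g t = (s - t)%:C%C * (w - z) by rewrite /g rmorphB; ring.
  rewrite cmodM cmod_real distrC; apply: le_lt_trans st.
  by rewrite ler_wpM2l // lerDl.
have -> : w = g 1 by rewrite /g mul1r addrC subrK.
apply: (@unit_segment_ind (fun t => P (g t))).
- by move=> t t01 Pt; apply: cg; apply: oP => //; exact: seg.
- by move=> t t01 Pt; apply: (cg _ (fun b => ~ P b)); apply: oN => //; exact: seg.
- by rewrite /g mul0r addr0.
Qed.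

Lemma punctured_plane_ind (P : C -> Prop) :
  (forall a, a != 0 -> P a -> \forall b \near a, P b) ->
  (forall a, a != 0 -> ~ P a -> \forall b \near a, ~ P b) ->
  forall z w, z != 0 -> w != 0 -> P z -> P w.
Proof.
move=> oP oN.
(* The segment from z to c z is z times the segment from 1 to c, so only the latter has to avoid
   0. *)
have step z (c : C) : (forall t : R, 0 <= t <= 1 -> 1 + t%:C%C * (c - 1) != 0) ->
    z != 0 -> P z -> P (c * z).
  move=> hc z0; apply: segment_ind => // t t01.
  rewrite (_ : _ + _ = (1 + t%:C%C * (c - 1)) * z); last by ring.
  by rewrite mulf_neq0 // hc.
have i0 : ('i%C : C) != 0 by rewrite eq_complex /= oner_eq0 andbF.
move=> z w z0 w0 Pz.
(* If the segment from z to w contains 0, pass through i z. *)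
have Piz : P ('i%C * z).
  apply: step Pz => // t /andP[t0 t1].
  have -> : 1 + t%:C%C * ('i%C - 1) = ((1 - t) +i* t)%C :> C by simpc.
  rewrite eq_complex /= subr_eq0; apply/negP => /andP[/eqP <-].
  by rewrite oner_eq0.
have [seg|nseg] := pselect (forall t : R, 0 <= t <= 1 -> z + t%:C%C * (w - z) != 0).
  exact: segment_ind seg oP oN Pz.
have [t [/andP[t0 t1] tE]] : exists t : R, 0 <= t <= 1 /\ z + t%:C%C * (w - z) = 0.
  apply: contrapT => h; apply: nseg => t t01; apply/eqP => E; by apply: h; exists t.
have tn0 : t != 0 by apply: contra_neq z0 => t00; move: tE; rewrite t00 mul0r addr0.
have tC : (t%:C%C : C) != 0 by rewrite -cmod_gt0 cmod_real normr_gt0.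
(* A zero on the segment means w = - s z with s > 0; the segments from z to i z and from i z to - s
   z both avoid 0. *)
pose s := (1 - t) / t.
have wE : w = (- s)%:C%C * z.
  have E : t%:C%C * w = (t - 1)%:C%C * z.
    apply/eqP; rewrite -subr_eq0; apply/eqP; rewrite -tE rmorphB rmorph1; ring.
  apply: (mulfI tC); rewrite E mulrA -rmorphM; congr (_%:C%C * _).
  by rewrite /s; field.
have s0 : 0 <= s by rewrite divr_ge0 // subr_ge0.
have sn0 : s != 0.
  by apply: contra_neq w0 => s00; rewrite wE s00 oppr0 mul0r.
have -> : w = ((- s)%:C%C / 'i%C) * ('i%C * z) by rewrite wE mulrA divfK.
apply: step Piz => [u /andP[u0 u1]|]; last by rewrite mulf_neq0.
have -> : 1 + u%:C%C * ((- s)%:C%C / 'i%C - 1) = ((1 - u) +i* (u * s))%C :> C.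
  have -> : ('i%C : C)^-1 = - 'i%C.
    by apply: (mulfI i0); rewrite mulfV // mulrN -expr2 sqr_i opprK.
  by simpc; apply/eqP; rewrite eq_complex /=; apply/andP; split; apply/eqP; ring.
rewrite eq_complex /= subr_eq0; apply/negP => /andP[/eqP <-].
by rewrite mul1r (negPf sn0).
Qed.

End PuncturedPlane.

(** * The Tate curve *)

Section TateSpace.
Context {R : realType}.
Local Notation C := (Cplx R).
Implicit Types (z w a : C) (q : R).

(* The value at 0 is junk: 0 is sent to the orbit of 1. *)
Definition tate_orbit q z : set C :=
  [set w | exists m : int, w = q%:C%C ^ m * (if z == 0 then 1 else z)].

(** The quotient of C^* by q^Z, with the orbits themselves as points. *)
Definition tate q : Type := {A : set C | exists z, A = tate_orbit q z}.

Definition tate_proj q z : tate q := exist _ (tate_orbit q z) (ex_intro _ z erefl).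

HB.instance Definition _ q := gen_eqMixin (tate q).
HB.instance Definition _ q := gen_choiceMixin (tate q).

(** The quotient topology of C^*; [z = 0] is left out because its orbit is a default value. *)
Definition tate_open q (U : set (tate q)) := forall z, z != 0 ->
  U (tate_proj q z) -> \forall w \near z, U (tate_proj q w).

Lemma tate_openT q : tate_open [set: tate q].
Proof. by move=> z _ _; apply: near_all. Qed.

Lemma tate_openI q (U V : set (tate q)) :
  tate_open U -> tate_open V -> tate_open (U `&` V).
Proof. by move=> oU oV z z0 [Uz Vz]; exact: near_and (oU z z0 Uz) (oV z z0 Vz). Qed.

Lemma tate_open_bigU q (I : Type) (F : I -> set (tate q)) :
  (forall i, tate_open (F i)) -> tate_open (\bigcup_i F i).
Proof.
move=> oF z z0 [i _ Fz]; apply: near_mono (oF i z z0 Fz) => w Fw.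
by exists i.
Qed.

HB.instance Definition _ q :=
  isOpenTopological.Build (tate q) (@tate_openT q) (@tate_openI q) (@tate_open_bigU q).

End TateSpace.

Section TateCharts.
Context {R : realType} (q : R) (q0 : 0 < q) (q3 : 3 * q <= 1).
Local Notation C := (Cplx R).
Local Notation qC := (q%:C%C : C).
Local Notation pr := (tate_proj q).
Implicit Types (z w a b : C) (x : tate q).

Lemma qC_neq0 : qC != 0.
Proof. by rewrite -cmod_gt0 cmod_real normr_gt0 gt_eqF. Qed.

Lemma q_lt1 : q < 1.
Proof. by have := q0; have := q3; lra. Qed.

Lemma cmod_qX (m : int) : cmod (qC ^ m) = q ^ m.
Proof.
by case: m => n; rewrite ?NegzE ?exprnN ?cmodV cmodX cmod_real gtr0_norm.
Qed.

Lemma qX_neq0 (m : int) : qC ^ m != 0.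
Proof. by rewrite expfz_neq0 // qC_neq0. Qed.

Lemma q_expz_gt0 (m : int) : 0 < q ^ m.
Proof. exact: exprz_gt0. Qed.

Lemma q_expz_le (m n : int) : m <= n -> q ^ n <= q ^ m.
Proof.
move=> mn; have [k ->] : exists k : nat, n = m + k%:Z by exists `|n - m|%N; lia.
rewrite expfzDr ?gt_eqF // ger_pMr ?q_expz_gt0 //.
by apply: exprn_ile1; [exact: ltW | exact: ltW q_lt1].
Qed.

Lemma tate_projP z w : z != 0 -> w != 0 ->
  pr z = pr w <-> exists m : int, w = qC ^ m * z.
Proof.
move=> z0 w0; split=> [E|[m wE]].
  have : tate_orbit q w w.
    by exists 0; rewrite (negPf w0) expr0z mul1r.
  by move: E => /(congr1 sval) /= <- [m]; rewrite (negPf z0) => ->; exists m.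
apply: eq_exist => /=; apply/seteqP; rewrite /tate_orbit (negPf z0) (negPf w0) wE.
split=> v [n ->]; first by exists (n - m); rewrite mulrA -expfzDr ?qC_neq0 // subrK.
by exists (n + m); rewrite expfzDr ?qC_neq0 // mulrA.
Qed.

Lemma tate_proj_surj x : exists2 z, z != 0 & x = pr z.
Proof.
case: x => A [z E]; exists (if z == 0 then 1 else z).
  by case: ifP => [_|->//]; exact: oner_neq0.
apply: eq_exist => /=; rewrite E /tate_orbit.
by case: (eqVneq z 0) => [_|z0]; rewrite ?oner_eq0 ?(negPf z0).
Qed.

Lemma tate_proj_near z (U : set (tate q)) : z != 0 -> nbhs (pr z) U ->
  \forall w \near z, U (pr w).
Proof.
move=> z0; rewrite nbhsE => -[V [oV Vz] VU].
by apply: near_mono (oV z z0 Vz) => w; exact: VU.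
Qed.

(** The projection is an open map: the saturation of an open set is the union of its translates by
    powers of q. *)
Lemma tate_nbhs z (V : set C) : z != 0 -> (\forall w \near z, V w) ->
  nbhs (pr z) (pr @` (V `\ 0)).
Proof.
move=> z0 Vz; rewrite nbhsE.
exists [set pr w | w in [set w | w != 0 /\ \forall v \near w, V v]]; last first.
  move=> _ [w [w0 nw] <-]; exists w => //; split; first exact: nbhs_singleton nw.
  exact/eqP.
split; last by exists z.
move=> w w0 [v [v0 nv] /(tate_projP v0 w0) [m wE]].
have nw : \forall b \near w, \forall u \near (qC ^ (- m) * b), V u.
  move/near_nbhs_near: nv; rewrite (_ : v = qC ^ (- m) * w); last first.
    by rewrite wE mulrA -expfzDr ?qC_neq0 // addNr expr0z mul1r.
  apply: near_continuous; apply: cder_continuous; exact: cderZ (cder_id w).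
have nw0 : \forall b \near w, b != 0.
  by apply: continuous_neq0 (cder_continuous (cder_id w)) w0.
apply: near_mono (near_and nw nw0) => b [b1 b0].
exists (qC ^ (- m) * b); first by split=> //; rewrite mulf_neq0 ?qX_neq0.
apply/tate_projP => //; first by rewrite mulf_neq0 ?qX_neq0.
by exists m; rewrite mulrA -expfzDr ?qC_neq0 // subrr expr0z mul1r.
Qed.

(* Moduli in a ball have ratio < 3, so it meets each q^Z-orbit at most once. *)
Definition tate_ball a : set C := [set z | cmod (z - a) < cmod a / 2].

Lemma tate_ball_bound a z : tate_ball a z -> cmod a < 2 * cmod z /\ 2 * cmod z < 3 * cmod a.
Proof.
rewrite /tate_ball /= => za; have := cmodBr a z; have := cmodBr z a; rewrite (cmodB a).
by move: za; lra.
Qed.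

Lemma tate_ball_neq0 a z : tate_ball a z -> z != 0.
Proof.
move=> /tate_ball_bound [h _]; rewrite -cmod_gt0.
by have := cmod_ge0 a; lra.
Qed.

Lemma tate_ball_center a : a != 0 -> tate_ball a a.
Proof. by move=> a0; rewrite /tate_ball /= subrr cmod0 divr_gt0 // cmod_gt0. Qed.

Lemma tate_ball_near a z : tate_ball a z -> \forall w \near z, tate_ball a w.
Proof.
move=> az; apply/nbhs_cmodP; exists (cmod a / 2 - cmod (z - a)); first by rewrite subr_gt0.
move=> w wz; rewrite /tate_ball /=; apply: le_lt_trans (cmod_tri z _ _) _.
by rewrite -ltrBrDr.
Qed.

Lemma tate_ball_inj a z w : tate_ball a z -> tate_ball a w -> pr z = pr w -> z = w.
Proof.
move=> az aw; have z0 := tate_ball_neq0 az; have w0 := tate_ball_neq0 aw.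
move=> /(tate_projP z0 w0) [m wE].
have [h1 h2] := tate_ball_bound az; have [h3 h4] := tate_ball_bound aw.
have cw : cmod w = q ^ m * cmod z by rewrite wE cmodM cmod_qX.
have [m0|m1] := eqVneq m 0; first by rewrite wE m0 expr0z mul1r.
exfalso; have [mp|mn] : (1 <= m) \/ (m <= -1) by lia.
  have := q_expz_le mp; rewrite expr1z => qm.
  have : cmod w <= q * cmod z by rewrite cw ler_wpM2r ?cmod_ge0.
  have := cmod_ge0 z; move: q3 h1 h2 h3 h4; nra.
have := q_expz_le mn; rewrite exprN1 => qm.
have : q * cmod w >= cmod z.
  rewrite cw mulrA -[leLHS]mul1r ler_wpM2r ?cmod_ge0 //.
  by rewrite -ler_pdivrMl // mulr1.
have := cmod_ge0 w; move: q3 h1 h2 h3 h4; nra.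
Qed.

Definition tate_lift a x : C := xget 0 [set z | tate_ball a z /\ pr z = x].

Lemma tate_lift_pr a z : tate_ball a z -> tate_lift a (pr z) = z.
Proof.
move=> az; rewrite /tate_lift; case: xgetP => [w -> [aw E]|/(_ z)].
  exact: tate_ball_inj aw az E.
by case.
Qed.

Lemma tate_dom_open a : open (pr @` tate_ball a).
Proof.
rewrite openE => _ [z az <-]; have z0 := tate_ball_neq0 az.
apply: filterS (tate_nbhs z0 (tate_ball_near az)) => _ [w [aw _] <-].
by exists w.
Qed.

Lemma tate_codE a : tate_lift a @` (pr @` tate_ball a) = tate_ball a.
Proof.
apply/seteqP; split=> [_ [_ [z az <-] <-]|z az]; first by rewrite tate_lift_pr.
by exists (pr z); [exists z | rewrite tate_lift_pr].
Qed.

Lemma tate_ball_open a : open (tate_ball a).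
Proof. by rewrite openE => z /tate_ball_near. Qed.

Lemma tate_cod_open a : open (tate_lift a @` (pr @` tate_ball a)).
Proof. by rewrite tate_codE; exact: tate_ball_open. Qed.

Lemma tate_liftK a x : (pr @` tate_ball a) x -> pr (tate_lift a x) = x.
Proof. by case=> z az <-; rewrite tate_lift_pr. Qed.

Lemma tate_lift_continuous a : {within pr @` tate_ball a, continuous (tate_lift a)}.
Proof.
rewrite continuous_open_subspace; last exact: tate_dom_open.
move=> x; rewrite inE => -[z az <-] A; rewrite /= tate_lift_pr // => nA.
have z0 := tate_ball_neq0 az.
have h : \forall y \near pr z, A (tate_lift a y).
  have h0 := tate_nbhs z0 (@near_and _ z A _ nA (tate_ball_near az)).
  apply: filterS h0 => _ [w [[Aw aw] _] <-].
  by rewrite tate_lift_pr.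
exact: h.
Qed.

Lemma tate_pr_continuous a :
  {within tate_lift a @` (pr @` tate_ball a), continuous pr}.
Proof.
rewrite tate_codE continuous_open_subspace; last exact: tate_ball_open.
move=> z; rewrite inE => az A nA; exact: tate_proj_near (tate_ball_neq0 az) nA.
Qed.

Definition tate_chart a : chart R (tate q) :=
  Chart (@tate_dom_open a) (@tate_cod_open a) (@tate_liftK a)
    (@tate_lift_continuous a) (@tate_pr_continuous a).

Definition tate_atlas : set (chart R (tate q)) :=
  [set phi | exists2 a, a != 0 & phi = tate_chart a].

End TateCharts.

Lemma int_cases (m : int) : m = 0 \/ (m = 1 \/ (m = -1 \/ (2 <= m \/ 2 <= - m))).
Proof. lia. Qed.

Section TateSurface.
Context {R : realType} (q : R) (q0 : 0 < q) (q3 : 3 * q <= 1).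
Local Notation C := (Cplx R).
Local Notation qC := (q%:C%C : C).
Local Notation pr := (tate_proj q).
Local Notation chrt := (tate_chart q0 q3).
Implicit Types (z w a b : C) (x : tate q).

Lemma tate_chart_dom a x : chart_dom (chrt a) x ->
  exists z, [/\ tate_ball a z, z != 0, x = pr z & chrt a x = z].
Proof.
move=> [z az <-]; exists z; split=> //; first exact: tate_ball_neq0 az.
exact: tate_lift_pr.
Qed.

Lemma tate_transition a b x : chart_dom (chrt a) x -> chart_dom (chrt b) x ->
  exists m : int, chrt b x = qC ^ m * chrt a x /\
    \forall z \near chrt a x, transition (chrt a) (chrt b) z = qC ^ m * z.
Proof.
move=> /tate_chart_dom [z [az z0 -> ->]] /tate_chart_dom [w [bw w0 E ->]].
have /(tate_projP q0 z0 w0) [m wE] := E.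
exists m; split; first exact: wE.
rewrite wE in bw.
have cT := cder_continuous (cderZ (qC ^ m) (cder_id z)).
have h := near_continuous cT (tate_ball_near bw).
have hz : \forall y \near z, y != 0 by apply: continuous_neq0 (cder_continuous (cder_id z)) z0.
apply: near_mono (near_and hz h) => y [y0 by0].
rewrite /transition /=.
have -> : pr y = pr (qC ^ m * y).
  by apply/(tate_projP q0) => //; [rewrite mulf_neq0 // qX_neq0 | exists m].
exact: tate_lift_pr.
Qed.

Lemma tate_fundamental (t : R) : 0 < t -> exists m : int, q <= q ^ m * t <= 1.
Proof.
have q1 := q_lt1 q0 q3.
have H (s : R) : 0 < s -> s <= 1 -> exists m : int, q <= q ^ m * s <= 1.
  move=> s0 s1.
  have [N NP] : exists n : nat, q ^+ n.+1 <= s.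
    have : (q ^+ n) @[n --> \oo] --> (0 : R) by apply: cvg_expr; rewrite ger0_norm // ltW.
    move=> /cvgrPdist_lt /(_ _ s0) [N _ /(_ N.+1 (leqnSn N))].
    rewrite /= sub0r normrN ger0_norm ?exprn_ge0 ?(ltW q0) // => h.
    by exists N; exact: ltW.
  have [|n nP nmin] := @ex_minnP (fun n => q ^+ n.+1 <= s); first by exists N.
  exists (- n%:Z); rewrite -exprnN ler_pdivlMl ?exprn_gt0 // ler_pdivrMl ?exprn_gt0 //.
  rewrite mulr1 -exprSr nP /=.
  case: n nP nmin => [|n] nP nmin; first by rewrite expr0.
  rewrite ltW // ltNge; apply/negP => /nmin; by rewrite ltnn.
move=> t0; have [t1|t1] := leP t 1; first exact: H.
have [m /andP[m1 m2]] := H t^-1 (eqbRL (invr_gt0 t) t0) (ltW (eqbRL (invf_lt1 t0) t1)).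
(* From q <= x <= 1 with x = q^m / t follows q <= q / x <= 1, and q / x = q^(1-m) t. *)
exists (1 - m); rewrite expfzDr ?gt_eqF // expr1z -mulrA ler_pMr //.
have E : q ^ (- m) * t = (q ^ m * t^-1)^-1 by rewrite invfM invrK invr_expz.
have p0 : 0 < q ^ m * t^-1 by rewrite mulr_gt0 ?invr_gt0 // exprz_gt0.
rewrite E invf_ge1 // m2 /=.
by rewrite ler_pdivrMr // mul1r.
Qed.

Lemma tate_rep x : exists z, [/\ q <= cmod z, cmod z <= 1 & x = pr z].
Proof.
have [z z0 ->] := tate_proj_surj x.
have [|m /andP[m1 m2]] := @tate_fundamental (cmod z); first by rewrite cmod_gt0.
exists (qC ^ m * z); rewrite cmodM cmod_qX //; split=> //.
by apply/tate_projP => //; [rewrite mulf_neq0 // qX_neq0 | exists m].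
Qed.

(** The closed annulus q <= |z| <= 1 maps onto the surface. *)
Lemma tate_compact : compact [set: tate q].
Proof.
pose K : set C := disc 1 `&` [set z | q <= cmod z].
have cK : compact K.
  apply: compact_closedI; first exact: compact_disc.
  apply: (@closed_comp _ _ cmod [set t | q <= t]); last exact: closed_ge.
  by move=> z _; exact: cmod_continuous.
have cpr : {within K, continuous pr}.
  apply: continuous_in_subspaceT => z; rewrite inE => -[_ /= qz] A nA.
  apply: tate_proj_near nA; by rewrite -cmod_gt0 (lt_le_trans q0).
have := continuous_compact cpr cK.
rewrite (_ : pr @` K = [set: tate q]) //.
by apply/seteqP; split=> // x _; have [z [z1 z2 ->]] := tate_rep x; exists z.
Qed.

Lemma tate_connected : connected [set: tate q].
Proof.
move=> B [x Bx] [U oU BU] [V cV BV].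
rewrite setTI in BU; rewrite setTI in BV.
apply/seteqP; split=> // y _.
have [z z0 E] := tate_proj_surj x; have [w w0 ->] := tate_proj_surj y.
rewrite E in Bx.
apply: (@punctured_plane_ind _ (fun z => B (pr z)) _ _ z w z0 w0 Bx).
- move=> a a0; rewrite BU; exact: oU.
- move=> a a0; have : open (~` V) by exact: closed_openC.
  by rewrite BV => oV; exact: oV.
Qed.

(** Near the annulus only the multipliers q^m with |m| <= 1 can identify two points, and they are
    excluded by the three positive distances [d m]; for |m| >= 2 the moduli are too far apart. *)
Lemma tate_separate z w : q <= cmod z -> cmod z <= 1 -> q <= cmod w -> cmod w <= 1 ->
  pr z <> pr w -> exists2 e : R, 0 < e & forall z' w', cmod (z' - z) < e ->
    cmod (w' - w) < e -> z' != 0 -> w' != 0 -> pr z' <> pr w'.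
Proof.
move=> z1 z2 w1 w2 nzw.
have z0 : z != 0 by rewrite -cmod_gt0 (lt_le_trans q0).
have w0 : w != 0 by rewrite -cmod_gt0 (lt_le_trans q0).
pose d (m : int) := cmod (w - qC ^ m * z).
have dpos m : 0 < d m.
  rewrite cmod_gt0 subr_eq0; apply/eqP => E; apply: nzw.
  by apply/tate_projP => //; exists m.
(* q/3 keeps the ratio of the moduli of z' and w' below q^-2; the factor q/2 absorbs the stretching
   by q^m <= q^-1 in w - q^m z. *)
pose e := Num.min (q / 3) (Num.min (d 0) (Num.min (d 1) (d (-1))) * (q / 2)).
have e0 : 0 < e by rewrite lt_min divr_gt0 //= mulr_gt0 ?divr_gt0 // !lt_min !dpos.
exists e => // z' w' zz' ww' z'0 w'0 /(tate_projP q0 z'0 w'0) [m mE].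
have eq3 : e <= q / 3 by rewrite ge_min lexx.
have eD : e <= Num.min (d 0) (Num.min (d 1) (d (-1))) * (q / 2) by rewrite ge_min lexx orbT.
have cw : cmod w' = q ^ m * cmod z' by rewrite mE cmodM cmod_qX.
have q1 := q_lt1 q0 q3.
have bz1 : cmod z' < 1 + e by have := cmodBr z' z; move: zz' z2; lra.
have bw1 : cmod w' < 1 + e by have := cmodBr w' w; move: ww' w2; lra.
have bz2 : q - e < cmod z' by have := cmodBr z z'; rewrite cmodB; move: zz' z1; lra.
have bw2 : q - e < cmod w' by have := cmodBr w w'; rewrite cmodB; move: ww' w1; lra.
have small n : q ^ n <= q^-1 -> e <= d n * (q / 2) -> m = n -> False.
  move=> qn en mn; subst n.
  have : d m <= cmod (w - w') + q ^ m * cmod (z' - z).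
    rewrite /d -(cmod_qX q0) -cmodM.
    apply: le_trans (cmod_tri w' _ _) _; rewrite lerD2l mE -mulrBr //.
  rewrite (cmodB w) => h.
  have h2 : q ^ m * cmod (z' - z) <= q^-1 * cmod (z' - z) by rewrite ler_wpM2r ?cmod_ge0.
  have h3 : q * (q^-1 * cmod (z' - z)) = cmod (z' - z) by rewrite mulVKf // gt_eqF.
  have := cmod_ge0 (w' - w); have := cmod_ge0 (z' - z); have := dpos m.
  move: h2 h3; set X := q^-1 * _; nra.
have qV1 : 1 <= q^-1 by rewrite invf_ge1 // ltW.
have far u v (n : int) : 2 <= n -> cmod v = q ^ n * cmod u -> cmod u < 1 + e ->
    q - e < cmod v -> False.
  move=> n2 -> u1 v1; have := q_expz_le q0 q3 n2; rewrite exprSz expr1z => qn.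
  have h : q ^ n * cmod u <= q * q * (1 + e).
    by apply: ler_pM => //; [exact/ltW/exprz_gt0 | exact: cmod_ge0 | exact: ltW].
  have h1 : q * q * (1 + e) <= q * (1 / 3) * (1 + 1 / 9).
    apply: ler_pM; [by rewrite mulr_ge0 ?ltW | by rewrite addr_ge0 ?ltW | |].
      by rewrite ler_pM2l //; move: q3; lra.
    by move: eq3 q3; lra.
  by move: eq3 q0; lra.
have [m0|[m1|[m1|[m2|m2]]]] := int_cases m.
- apply: (small 0) => //; apply: le_trans eD _.
  by rewrite ler_wpM2r ?divr_ge0 ?(ltW q0) // ge_min lexx.
- apply: (small 1) => //; first by rewrite expr1z (le_trans (ltW q1)).
  apply: le_trans eD _.
  by rewrite ler_wpM2r ?divr_ge0 ?(ltW q0) // !ge_min lexx orbT.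
- apply: (small (-1)); [by rewrite exprN1| |exact: m1].
  apply: le_trans eD _.
  by rewrite ler_wpM2r ?divr_ge0 ?(ltW q0) // !ge_min lexx !orbT.
- exact: far m2 cw bz1 bw2.
- apply: (far w' z' (- m) m2) => //.
  by rewrite cw mulrA -expfzDr ?gt_eqF // addNr expr0z mul1r.
Qed.

Lemma tate_hausdorff : hausdorff_space (tate q).
Proof.
rewrite open_hausdorff => x y /eqP.
have [z [z1 z2 ->]] := tate_rep x; have [w [w1 w2 ->]] := tate_rep y => nzw.
have z0 : z != 0 by rewrite -cmod_gt0 (lt_le_trans q0).
have w0 : w != 0 by rewrite -cmod_gt0 (lt_le_trans q0).
have [e e0 eP] := tate_separate z1 z2 w1 w2 nzw.
have nb a : \forall b \near a, cmod (b - a) < e by apply/nbhs_cmodP; exists e.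
have := tate_nbhs q0 z0 (nb z); rewrite nbhsE => -[U [oU Uz] UP].
have := tate_nbhs q0 w0 (nb w); rewrite nbhsE => -[V [oV Vw] VP].
exists (U, V); first by split; rewrite inE.
split=> //=; apply/eqP/seteqP; split=> // v [/UP [z' [h1 h2] <-] /VP [w' [h3 h4]]].
by move/esym; apply: (eP _ _ h1 h3); apply/eqP.
Qed.

Lemma tate_atlas_cover x : exists2 phi, tate_atlas q0 q3 phi & chart_dom phi x.
Proof.
have [z z0 ->] := tate_proj_surj x.
exists (chrt z); first by exists z.
by exists z => //; exact: tate_ball_center.
Qed.

Lemma tate_atlas_holomorphic phi psi : tate_atlas q0 q3 phi -> tate_atlas q0 q3 psi ->
  forall x, chart_dom phi x -> chart_dom psi x ->
  derivable (transition phi psi) (phi x) 1.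
Proof.
move=> [a a0 ->] [b b0 ->] x dx ex; have [m [_ h]] := tate_transition dx ex.
exact: cder_derivable (cder_near h (cderZ (qC ^ m) (cder_id (chrt a x)))).
Qed.

Definition tate_surface : riemann_surface R :=
  RiemannSurface tate_hausdorff tate_connected tate_atlas_cover tate_atlas_holomorphic.

Lemma tate_transition_derive1 a b x : chart_dom (chrt a) x -> chart_dom (chrt b) x ->
  exists m : int, \forall z \near chrt a x,
    transition (chrt a) (chrt b) z = qC ^ m * z /\
    derive1 (transition (chrt a) (chrt b)) z = qC ^ m.
Proof.
move=> dx ex; have [m [_ h]] := tate_transition dx ex; exists m.
apply: near_mono (near_and h (near_nbhs_near h)) => z [h1 h2]; split; first exact: h1.
apply: cder_derive1; rewrite -[qC ^ m]mulr1.
exact: cder_near h2 (cderZ (qC ^ m) (cder_id z)).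
Qed.

Lemma tate_cod_neq0 a b : chart_cod (chrt a) b -> tate_ball a b /\ b != 0.
Proof.
by move=> [x dx <-]; have [z [az z0 _ ->]] := tate_chart_dom dx.
Qed.

(** The form dz/z is invariant, and for any holomorphic form h dz the product h z is a holomorphic
    function, hence constant. *)
Lemma tate_genus1 : has_genus tate_surface 1.
Proof.
exists (fun _ _ z => z^-1); split=> [j|h hh].
  split; last first.
    move=> phi [a a0 ->] b /tate_cod_neq0 [_ b0].
    exact: cder_derivable (cder_inv b0).
  split=> [phi [a a0 ->] b /tate_cod_neq0 [_ b0]|phi psi [a a0 ->] [b b0 ->] x dx ex].
    apply: holomorphic_meromorphic; exact: holomorphicV (holomorphic_id b) b0.
  have [m hm] := tate_transition_derive1 dx ex.
  apply: nbhs_dnbhs; apply: near_mono hm => z [-> ->].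
  by rewrite expr1 invfM mulrAC mulVf ?mul1r // qX_neq0.
pose s : local_coefs tate_surface := fun phi z => h phi z * z.
have ms : meromorphic_section 0 s.
  split=> [phi aphi a ca|phi psi aphi apsi x dx ex].
    exact: meromorphicM (hh.1.1 phi aphi a ca) (holomorphic_meromorphic (holomorphic_id a)).
  have th := hh.1.2 phi psi aphi apsi x dx ex.
  case: aphi dx th => a a0 -> dx; case: apsi ex => b b0 -> ex th.
  have [m hm] := tate_transition_derive1 dx ex.
  apply: dnear_mono (dnear_and th (nbhs_dnbhs hm)) => z [hz [E1 E2]].
  by rewrite /s hz E2 E1 expr1 expr0 mulr1 mulrA.
have hs : locally_holomorphic s.
  move=> phi aphi _ [x dx <-]; exists (s phi); split; last by apply: dnear_all.
  exact: holomorphicM (holomorphic_section_at hh aphi dx) (holomorphic_id _).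
have [c sc] := @liouville _ tate_surface _ tate_compact ms hs.
have hE phi b : atlas tate_surface phi -> chart_cod phi b -> h phi b = c * b^-1.
  move=> aphi cb; have b0 : b != 0.
    by case: aphi cb => a a0 -> /tate_cod_neq0 [].
  have scb := sc _ aphi _ cb.
  have : h phi b * b = c.
    case: cb scb => x dx <- scb.
    apply: (@dnbhs_lim_eq _ (s phi) (fun=> c) (phi x) _ _ scb); last exact: (@cvg_ccst _ _ _ (nbhs_filter (phi x)) c).
    apply: holomorphic_continuous.
    exact: holomorphicM (holomorphic_section_at hh aphi dx) (holomorphic_id _).
  by move=> <-; rewrite mulfK.
exists (const_mx c); split=> [phi aphi a ca|l lE].
  by rewrite big_ord_recl big_ord0 addr0 mxE hE.
have n1 : (1 : C) != 0 by exact: oner_neq0.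
have c1 : chart_cod (chrt 1) 1.
  exists (pr 1); first by exists 1 => //; exact: tate_ball_center.
  exact: tate_lift_pr (tate_ball_center n1).
have a1 : atlas tate_surface (chrt 1) by exists 1.
have := lE _ a1 _ c1; rewrite big_ord_recl big_ord0 addr0 hE // invr1 !mulr1 => cE.
by apply/matrixP => i j; rewrite mxE !ord1.
Qed.

End TateSurface.

(** * Theta quotients *)

Section Theta.
Context {R : realType} (q : R) (q0 : 0 < q) (q3 : 3 * q <= 1).
Local Notation C := (Cplx R).
Local Notation qC := (q%:C%C : C).
Implicit Types (z w a : C).

(** Partial products of the q-Pochhammer symbol (z; q)_infinity. *)
Definition qpoch_fin n z : C := \prod_(j < n) (1 - qC ^+ j * z).

(* The limit of the partial products exists; an ultrafilter limit avoids
   having to prove it. *)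
Definition qpoch z : C := ulim (fun n => qpoch_fin n z).

Lemma qpoch_finS n z : qpoch_fin n.+1 z = (1 - z) * qpoch_fin n (qC * z).
Proof.
rewrite /qpoch_fin big_ord_recl /= expr0 mul1r; congr (_ * _).
by apply: eq_bigr => i _; rewrite /= /bump leq0n add1n exprSr mulrA.
Qed.

Lemma qpoch_fin_derivable n z : derivable (qpoch_fin n) z 1.
Proof.
suff [l lP] : exists l, cder (qpoch_fin n) z l by exact: cder_derivable lP.
elim: n => [|n [l lP]].
  exists 0; have -> : qpoch_fin 0 = (fun=> 1) by apply/funext => w; rewrite /qpoch_fin big_ord0.
  exact: cder_cst.
have -> : qpoch_fin n.+1 = (fun w => qpoch_fin n w * (1 - qC ^+ n * w)).
  by apply/funext => w; rewrite /qpoch_fin big_ord_recr.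
eexists; exact: cderM lP (cderB (cder_cst 1 z) (cderZ _ (cder_id z))).
Qed.

(** Each factor has modulus at most exp(q^j r), and the exponents form a geometric series. *)
Lemma qpoch_fin_le n z (r : R) : cmod z <= r -> cmod (qpoch_fin n z) <= expR (r * (1 - q)^-1).
Proof.
move=> zr; have r0 : 0 <= r by exact: le_trans (cmod_ge0 z) zr.
have q1 := q_lt1 q0 q3.
have H : cmod (qpoch_fin n z) <= expR (r * \sum_(j < n) q ^+ j).
  elim: n => [|n IH]; first by rewrite /qpoch_fin !big_ord0 cmod1 mulr0 expR0.
  rewrite /qpoch_fin big_ord_recr /= -/(qpoch_fin n z) big_ord_recr /= [r * (_ + _)]mulrDr expRD cmodM.
  apply: ler_pM; rewrite ?cmod_ge0 //.
  apply: le_trans (cmodD _ _) _; rewrite cmod1 cmodN cmodM cmodX cmod_real gtr0_norm //.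
  apply: le_trans (expR_ge1Dx _); rewrite lerD2l mulrC.
  by rewrite ler_wpM2r ?exprn_ge0 ?(ltW q0).
apply: le_trans H _; rewrite ler_expR ler_wpM2l //.
rewrite -[leRHS]mul1r ler_pdivlMr ?subr_gt0 //.
have := subrX1 q n; set S := \sum_(_ < _) _ => E.
have -> : S * (1 - q) = 1 - q ^+ n by rewrite -[RHS]opprB E; ring.
by rewrite gerBl exprn_ge0 ?(ltW q0).
Qed.

Lemma qpoch_bounded z : cbounded (fun n => qpoch_fin n z).
Proof. by exists (expR (cmod z * (1 - q)^-1)) => n; exact: qpoch_fin_le. Qed.

Lemma qpoch_derivable z : derivable qpoch z 1.
Proof.
apply: ulim_derivable; first exact: qpoch_fin_derivable.
by move=> r; exists (expR (r * (1 - q)^-1)) => n w; exact: qpoch_fin_le.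
Qed.

Lemma qpoch_holomorphic z : holomorphic_at qpoch z.
Proof. by apply: near_all => w; exact: qpoch_derivable. Qed.

(** Ultrafilter limits are not shift invariant in general. Here successive partial products differ
    by q^n times a bounded factor, so the shifted sequence has the same limit. *)
Lemma qpoch_rec z : qpoch z = (1 - z) * qpoch (qC * z).
Proof.
have q1 := q_lt1 q0 q3.
have h1 : ulim (fun n => qpoch_fin n.+1 z) = (1 - z) * qpoch (qC * z).
  rewrite -ulimZ; last exact: qpoch_bounded.
  by congr ulim; apply/funext => n; rewrite qpoch_finS.
rewrite -h1; apply/eqP; rewrite -subr_eq0 -mulN1r -ulimZ; last first.
  by have [B BP] := qpoch_bounded z; exists B.
rewrite /qpoch -ulimD; last 2 first.
- exact: qpoch_bounded.
- by apply: cboundedZ; have [B BP] := qpoch_bounded z; exists B.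
apply/eqP; apply: ulim_cvgn; apply/cvg_seq_cmodP => e e0.
pose B := expR (cmod z * (1 - q)^-1) * cmod z.
have B1 : 0 < B + 1 by rewrite ltr_wpDl // mulr_ge0 ?cmod_ge0 // ltW // expR_gt0.
have : (q ^+ n) @[n --> \oo] --> (0 : R) by apply: cvg_expr; rewrite ger0_norm // ltW.
move=> /cvgrPdist_lt /(_ _ (divr_gt0 e0 B1)) [N _ NP]; exists N => n Nn.
have := NP n Nn; rewrite /= sub0r normrN ger0_norm ?exprn_ge0 ?(ltW q0) // => h.
have -> : qpoch_fin n z + -1 * qpoch_fin n.+1 z - 0 = qC ^+ n * (qpoch_fin n z * z).
  by rewrite /qpoch_fin big_ord_recr /=; ring.
rewrite cmodM cmodX cmod_real gtr0_norm // cmodM.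
apply: le_trans (_ : e / (B + 1) * B <= _).
  apply: ler_pM; rewrite ?exprn_ge0 ?mulr_ge0 ?cmod_ge0 ?(ltW q0) ?(ltW h) //.
  by rewrite ler_wpM2r ?cmod_ge0 // qpoch_fin_le.
by rewrite mulrAC ler_pdivrMr // ler_wpM2l ?(ltW e0) // lerDl.
Qed.

Lemma qpoch0 : qpoch 0 = 1.
Proof.
apply: ulim_cvgn; apply/cvg_seq_cmodP => e e0; exists 0%N => n _.
have -> : qpoch_fin n 0 = 1 by rewrite /qpoch_fin big1 // => i _; rewrite mulr0 subr0.
by rewrite subrr cmod0 ltW.
Qed.

Lemma qpoch_split n z : qpoch z = qpoch_fin n z * qpoch (qC ^+ n * z).
Proof.
elim: n z => [|n IH] z; first by rewrite /qpoch_fin big_ord0 expr0 !mul1r.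
by rewrite qpoch_rec qpoch_finS [in LHS]IH exprSr !mulrA.
Qed.

(** [qpoch] is nonzero near 0, where q^n z lies for large n; so a zero comes from one of the first n
    factors. *)
Lemma qpoch_eq0 z : qpoch z = 0 -> exists j : nat, qC ^+ j * z = 1.
Proof.
move=> Pz; have q1 := q_lt1 q0 q3.
have [d d0 dP] : exists2 d : R, 0 < d & forall w, cmod w < d -> qpoch w != 0.
  have P0 : qpoch 0 != 0 by rewrite qpoch0 oner_neq0.
  have /nbhs_cmodP [d d0 dP] := holomorphic_neq0 (qpoch_holomorphic 0) P0.
  by exists d => // w wd; apply: dP; rewrite subr0.
have [n nd] : exists n, cmod (qC ^+ n * z) < d.
  have z1 : 0 < cmod z + 1 by rewrite ltr_wpDl ?cmod_ge0.
  have : (q ^+ n) @[n --> \oo] --> (0 : R) by apply: cvg_expr; rewrite ger0_norm // ltW.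
  move=> /cvgrPdist_lt /(_ _ (divr_gt0 d0 z1)) [N _ /(_ N (leqnn N))].
  rewrite /= sub0r normrN ger0_norm ?exprn_ge0 ?(ltW q0) // => h; exists N.
  rewrite cmodM cmodX cmod_real gtr0_norm //; move: h; rewrite ltr_pdivlMr //.
  by apply: le_lt_trans; rewrite ler_wpM2l ?exprn_ge0 ?(ltW q0) // lerDl.
move/eqP: Pz; rewrite (qpoch_split n) mulf_eq0 (negPf (dP _ nd)) orbF prodf_seq_eq0.
by move=> /hasP [j _]; rewrite subr_eq0 => /eqP E; exists j; rewrite -E.
Qed.

(** Jacobi's theta function in product form, up to the constant factor (q; q)_infinity. *)
Definition theta z : C := qpoch z * qpoch (qC / z).

Lemma theta_holomorphic z : z != 0 -> holomorphic_at theta z.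
Proof.
move=> z0; apply: holomorphicM (qpoch_holomorphic z) _.
have nz := holomorphic_neq0 (holomorphic_id z) z0.
apply: near_mono nz => w w0.
have dw := cderM (cder_cst qC w) (cder_inv w0).
exact: cder_derivable (@cder_comp _ qpoch (fun z => qC / z) _ _ _ dw (derivable_cder (@qpoch_derivable (qC / w)))).
Qed.

Lemma thetaM z : z != 0 -> theta (qC * z) = - z^-1 * theta z.
Proof.
move=> z0; have qn := qC_neq0 q0; rewrite /theta.
have -> : qC / (qC * z) = z^-1 by field; rewrite z0 qn.
rewrite (qpoch_rec z) (qpoch_rec z^-1); by field.
Qed.

Lemma theta_neq0 z : z != 0 -> (forall m : int, z != qC ^ m) -> theta z != 0.
Proof.
move=> z0 zm; have qn := qC_neq0 q0; rewrite /theta mulf_neq0 //; apply/eqP => /qpoch_eq0 [j].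
  move=> jE; have := zm (- j%:Z); rewrite -exprnN => /eqP; apply.
  by apply: (mulfI (expf_neq0 j qn)); rewrite jE mulfV // expf_neq0.
move=> jE; have := zm j.+1%:Z; rewrite -exprnP exprSr => /eqP; apply.
by rewrite -[z]mul1r -jE mulrA divfK.
Qed.

Lemma order_at_scale (f : C -> C) c a (m : int) : c != 0 -> order_at f (c * a) m ->
  order_at (fun z => f (c * z)) a m.
Proof.
move=> c0 [g [hg g0 fg]]; have dc := cderZ c (cder_id a).
exists (fun z => c ^ m * g (c * z)); split.
- apply: holomorphicZ; apply: near_mono (near_continuous (cder_continuous dc) hg) => z dg.
  have dz := cderZ c (cder_id z).
  exact: cder_derivable (cder_comp dz (derivable_cder dg)).
- by rewrite mulf_neq0 // expfz_neq0.
- have h : \forall z \near c * a, z != c * a -> f z = (z - c * a) ^ m * g z by [].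
  apply: dnear_mono (dnear_and (near_sub_neq0 a)
    (nbhs_dnbhs (near_continuous (cder_continuous dc) h))) => z [za fz].
  rewrite fz; last by rewrite -subr_eq0 -mulrBr mulf_neq0.
  by rewrite -mulrBr expfzMl mulrCA mulrA.
Qed.

Lemma theta_order1 : order_at theta 1 1.
Proof.
have qn := qC_neq0 q0; have q1 := q_lt1 q0 q3.
have Pq : qpoch qC != 0.
  apply/eqP => /qpoch_eq0 [j] /(congr1 cmod).
  rewrite -exprSr cmodX cmod_real gtr0_norm // cmod1 => /eqP.
  by rewrite lt_eqF // exprn_ilt1 // ltW.
exists (fun z => - (qpoch (qC * z) * qpoch (qC / z))); split.
- have n1 : (1 : C) != 0 by exact: oner_neq0.
  apply: near_mono (holomorphic_neq0 (holomorphic_id 1) n1) => z z0.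
  have d1 := cder_comp (cderZ qC (cder_id z)) (derivable_cder (@qpoch_derivable (qC * z))).
  have d2 := cder_comp (cderM (cder_cst qC z) (cder_inv z0))
    (derivable_cder (@qpoch_derivable (qC / z))).
  exact: cder_derivable (cderN (cderM d1 d2)).
- by rewrite oppr_eq0 invr1 mulr1 mulf_neq0.
- by apply: dnear_all => z; rewrite expr1z /theta qpoch_rec; ring.
Qed.

Lemma order_at_hol_mul (f g : C -> C) a (m : int) : holomorphic_at g a -> g a != 0 ->
  order_at f a m -> order_at (fun z => g z * f z) a m.
Proof. by move=> hg g0 fm; rewrite -[m]add0r; exact: order_atM (order_at_hol hg g0) fm. Qed.

Lemma near_neq0 a : a != 0 -> \forall z \near a^', z != 0.
Proof. by move=> a0; exact: nbhs_dnbhs (holomorphic_neq0 (holomorphic_id a) a0). Qed.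

Lemma theta_order_up a : a != 0 -> order_at theta a 1 -> order_at theta (qC * a) 1.
Proof.
move=> a0 h; have qn := qC_neq0 q0.
have qa0 : qC * a != 0 by rewrite mulf_neq0.
have h1 : order_at (fun z => theta (qC^-1 * z)) (qC * a) 1.
  by apply: order_at_scale; [rewrite invr_eq0 | rewrite mulKf].
have hV := holomorphicV (holomorphic_id (qC * a)) qa0.
have nV : - qC * (qC * a)^-1 != 0 by rewrite mulf_neq0 ?oppr_eq0 ?invr_eq0.
apply: order_at_near (order_at_hol_mul (holomorphicZ (- qC) hV) nV h1).
apply: dnear_mono (near_neq0 qa0) => z z0.
have w0 : qC^-1 * z != 0 by rewrite mulf_neq0 ?invr_eq0.
rewrite -[in LHS](mulVKf qn z) thetaM //.
by congr (_ * _); field; rewrite z0 qn.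
Qed.

Lemma theta_order_down a : a != 0 -> order_at theta (qC * a) 1 -> order_at theta a 1.
Proof.
move=> a0 h; have qn := qC_neq0 q0.
have h1 := order_at_scale qn h.
have nV : -1 * a != 0 by rewrite mulN1r oppr_eq0.
apply: order_at_near (order_at_hol_mul (holomorphicZ (-1) (holomorphic_id a)) nV h1).
apply: dnear_mono (near_neq0 a0) => z z0.
by rewrite thetaM // mulrA mulN1r mulrNN mulfV // mul1r.
Qed.

Lemma theta_order_qX (m : int) : order_at theta (qC ^ m) 1.
Proof.
have qn := qC_neq0 q0; case: m => n.
  elim: n => [|n IH]; first by rewrite expr0z; exact: theta_order1.
  rewrite -exprnP exprS; apply: theta_order_up; first exact: expf_neq0.
  exact: IH.
elim: n => [|n IH].
  apply: theta_order_down; first by rewrite expfz_neq0.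
  by rewrite NegzE exprN1 mulfV //; exact: theta_order1.
apply: theta_order_down; first by rewrite expfz_neq0.
rewrite (_ : qC * _ = qC ^ (Negz n)) //.
by rewrite -{1}[qC]expr1z -expfzDr //; congr (_ ^ _); lia.
Qed.

End Theta.

Section ThetaQuotient.
Context {R : realType} (q : R) (q0 : 0 < q) (q3 : 3 * q <= 1).
Context (n : nat) (c : 'I_n -> Cplx R) (c0 : forall i, c i != 0).
Local Notation C := (Cplx R).
Local Notation qC := (q%:C%C : C).
Local Notation pr := (tate_proj q).
Implicit Types (z w a : C) (nu : 'I_n -> int).

Definition theta_quot nu z : C := \prod_(i < n) theta q ((c i)^-1 * z) ^ nu i.

(** The i-th factor contributes (- c i / z)^(nu i), and the powers of - 1 / z cancel since the
    exponents sum to 0. *)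
Lemma theta_quotM nu z : z != 0 -> \sum_(i < n) nu i = 0 ->
  theta_quot nu (qC * z) = (\prod_(i < n) c i ^ nu i) * theta_quot nu z.
Proof.
move=> z0 snu; rewrite /theta_quot.
have H i : theta q ((c i)^-1 * (qC * z)) ^ nu i =
    (- z^-1) ^ nu i * (c i ^ nu i * theta q ((c i)^-1 * z) ^ nu i).
  rewrite mulrCA thetaM ?mulf_neq0 ?invr_eq0 //.
  by rewrite -!expfzMl invfM invrK; congr (_ ^ _); ring.
under eq_bigr do rewrite H.
rewrite !big_split /= (_ : \prod_(i < n) (- z^-1) ^ nu i = 1) ?mul1r //.
have zV : - z^-1 != 0 by rewrite oppr_eq0 invr_eq0.
have hm : {morph (fun m : int => (- z^-1) ^ m) : a b / a + b >-> a * b}.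
  by move=> a b; rewrite expfzDr.
by rewrite -(big_morph _ hm (expr0z _)) snu.
Qed.

Lemma theta_shift_order i a : a != 0 ->
  order_at (fun z => theta q ((c i)^-1 * z)) a (if pr (c i) == pr a then 1 else 0).
Proof.
move=> a0; have ci := c0 i; case: ifPn => [/eqP|/eqP] E.
  have /(tate_projP q0 ci a0) [m aE] := E.
  apply: order_at_scale; first by rewrite invr_eq0.
  by rewrite aE mulrCA mulVf // mulr1; exact: theta_order_qX.
have ca0 : (c i)^-1 * a != 0 by rewrite mulf_neq0 ?invr_eq0.
apply: order_at_scale; first by rewrite invr_eq0.
apply: order_at_hol; first exact: theta_holomorphic.
apply: theta_neq0 => // m; apply/eqP => mE; apply: E.
by apply/(tate_projP q0 ci a0); exists m; rewrite -mE mulrC mulVKf.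
Qed.

Lemma theta_quot_order nu a : a != 0 ->
  order_at (theta_quot nu) a (\sum_(i < n | pr (c i) == pr a) nu i).
Proof.
move=> a0; rewrite big_mkcond /=.
apply: order_at_prod => i.
have := order_at_exprz (nu i) (theta_shift_order i a0).
by case: ifP => _; rewrite ?mul1r ?mul0r.
Qed.

End ThetaQuotient.

(** * Invariant sections on the Tate curve and their square roots *)

Section TateSections.
Context {R : realType} (q : R) (q0 : 0 < q) (q3 : 3 * q <= 1).
Local Notation C := (Cplx R).
Local Notation qC := (q%:C%C : C).
Local Notation pr := (tate_proj q).
Local Notation chrt := (tate_chart q0 q3).
Local Notation X := (tate_surface q0 q3).
Implicit Types (z w a : C) (F : C -> C).

Lemma periodic_expz F : (forall z, z != 0 -> F (qC * z) = F z) ->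
  forall (m : int) z, z != 0 -> F (qC ^ m * z) = F z.
Proof.
move=> Fq; have qn := qC_neq0 q0.
have H (j : nat) z : z != 0 -> F (qC ^+ j * z) = F z.
  elim: j => [|j IH] z0; first by rewrite expr0 mul1r.
  by rewrite exprS -mulrA Fq ?IH // mulf_neq0 // expf_neq0.
case=> j z z0; first exact: H.
rewrite NegzE -exprnN; have w0 : qC ^- j.+1 * z != 0.
  by rewrite mulf_neq0 // invr_eq0 expf_neq0.
by rewrite -(H j.+1 _ w0) mulVKf // expf_neq0.
Qed.

(* The chart coordinates are all restrictions of the coordinate of C^*, so the
   invariant section F (dz/z)^k has the same coefficient in each chart. *)
Definition tate_coefs k F : local_coefs X := fun _ z => F z / z ^+ k.

Lemma tate_coefs_order k F a (m : int) : a != 0 -> order_at F a m ->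
  order_at (fun z => F z / z ^+ k) a m.
Proof.
move=> a0 Fm; rewrite -[m]addr0; apply: order_atM Fm _.
apply: order_at_hol; last by rewrite invr_eq0 expf_neq0.
by apply: holomorphicV; [exact: holomorphicX (holomorphic_id a) | exact: expf_neq0].
Qed.

Lemma tate_coefs_section k F : (forall a, a != 0 -> exists m, order_at F a m) ->
  (forall z, z != 0 -> F (qC * z) = F z) -> meromorphic_section k (tate_coefs k F).
Proof.
move=> Fm Fq; split=> [phi [a a0 ->] b /tate_cod_neq0 [_ b0]|phi psi [a a0 ->] [b b0 ->] x dx ex].
  by have [m bm] := Fm b b0; exact: order_meromorphic (tate_coefs_order k b0 bm).
have [m hm] := tate_transition_derive1 dx ex.
have [z [_ z0 _ zE]] := tate_chart_dom dx; rewrite zE in hm *.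
apply: dnear_mono (dnear_and (near_neq0 z0) (nbhs_dnbhs hm)) => w [w0 [-> ->]].
have qm0 := qX_neq0 q0 m.
rewrite /tate_coefs (periodic_expz Fq) // exprMn.
by field; rewrite !expf_neq0 //.
Qed.

Lemma tate_chart_center a : a != 0 -> chart_dom (chrt a) (pr a) /\ chrt a (pr a) = a.
Proof.
move=> a0; have h := tate_ball_center a0; split; first by exists a.
exact: tate_lift_pr.
Qed.

Lemma tate_transition_at a b c : chart_dom (chrt a) (pr c) -> chart_dom (chrt b) (pr c) ->
  chrt a (pr c) != 0 -> forall m : int, chrt b (pr c) = qC ^ m * chrt a (pr c) ->
  \forall z \near chrt a (pr c), transition (chrt a) (chrt b) z = qC ^ m * z /\
    derive1 (transition (chrt a) (chrt b)) z = qC ^ m.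
Proof.
move=> dx ex n0 m mE; have [m' [m'E h]] := tate_transition dx ex.
have mm : qC ^ m = qC ^ m' by apply: (mulIf n0); rewrite -mE -m'E.
rewrite -mm in h; apply: near_mono (near_and h (near_nbhs_near h)) => z [h1 h2].
split; first exact: h1.
apply: cder_derive1; rewrite -[qC ^ m]mulr1.
exact: cder_near h2 (cderZ (qC ^ m) (cder_id z)).
Qed.

(* A square root p of H^2 (dz/z)^2j would give a sign p z^j / H which is
   locally constant on C^*, although the multiplier -1 of H forces it to
   change under z -> q z. *)
Lemma tate_antiperiodic_square j (H : C -> C) (p : local_coefs X) :
  (forall a, a != 0 -> exists m, order_at H a m) ->
  (forall z, z != 0 -> H (qC * z) = - H z) -> meromorphic_section j p ->
  eq_section (tate_coefs (j * 2) (fun z => H z ^+ 2)) (power_section p 2) -> False.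
Proof.
move=> Hm Hq mp pE; have qn := qC_neq0 q0.
(* The sign, read in the chart centred at [a]; its square is 1 because p^2 = H^2 / z^(2j). *)
pose s a z := p (chrt a) z * z ^+ j / H z.
pose val a v := exists g, [/\ holomorphic_at g a, \forall z \near a^', s a z = g z & g a = v].
have val_uniq a v v' : val a v -> val a v' -> v = v'.
  move=> [g [hg sg <-]] [g' [hg' sg' <-]].
  apply: dnbhs_lim_eq (holomorphic_continuous hg) (holomorphic_continuous hg') _.
  by apply: dnear_mono (dnear_and sg sg') => z [<- <-].
have aE a : a != 0 -> atlas X (chrt a) by move=> a0; exists a.
have s2 a b : a != 0 -> b != 0 -> tate_ball a b -> \forall z \near b^', s a z ^+ 2 = 1.
  move=> a0 b0 ab; have cb : chart_cod (chrt a) b.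
    exists (pr b); first by exists b.
    exact: tate_lift_pr.
  have [m bm] := Hm b b0.
  apply: dnear_mono (dnear_and (near_neq0 b0) (dnear_and (order_at_neq0 bm)
    (pE _ (aE _ a0) _ cb))) => z [z0 [Hz]].
  rewrite /tate_coefs /power_section exprM => E.
  rewrite /s !exprMn -E exprVn; field.
  by rewrite Hz !expf_neq0.
have val_ex a : a != 0 -> exists g, [/\ holomorphic_at g a,
    \forall z \near a^', s a z = g z & \forall z \near a, g z ^+ 2 = 1].
  move=> a0; have [da ca] := tate_chart_center a0.
  have ms : meromorphic_at (s a) a.
    apply: meromorphicM; last first.
      by have [m am] := Hm a a0; exact: meromorphicV (order_meromorphic am).
    apply: meromorphicM; last exact: holomorphic_meromorphic (holomorphicX j (holomorphic_id a)).
    by apply: (mp.1 _ (aE _ a0)); exists (pr a).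
  have s2a := s2 a a a0 a0 (tate_ball_center a0).
  have [s0|[m sm]] := meromorphic_order ms.
    have [z [z1]] := dnbhs_ex (dnear_and s0 s2a).
    by rewrite z1 expr0n => /eqP; rewrite eq_sym oner_eq0.
  (* The square of [s a] is 1, so twice the order is 0; hence the sign extends across [a]. *)
  have m0 : m = 0.
    have h1 : order_at (fun=> 1) a (m * 2%:Z).
      by apply: order_at_near (order_atX 2 sm); apply: dnear_mono s2a => z.
    have n1 : (1 : C) != 0 by exact: oner_neq0.
    have h2 := order_at_uniq h1 (order_at_hol (holomorphic_cst 1 a) n1).
    by lia.
  rewrite m0 in sm; have [g [hg g0 sg]] := order0P sm.
  exists g; split; [exact: hg|exact: sg|].
  have g2 : \forall z \near a^', g z ^+ 2 = 1.
    by apply: dnear_mono (dnear_and s2a sg) => z [h <-].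
  apply: dnbhs_nbhs g2.
  have hg2 := holomorphicX 2 hg.
  apply: (@dnbhs_lim_eq _ (fun z => g z ^+ 2) (fun=> 1) a (holomorphic_continuous hg2) _ _).
    exact: (@cvg_ccst _ _ _ (nbhs_filter a) 1).
  by apply: dnear_mono (dnear_and s2a sg) => z [h <-].
(* Both charts give [pr b] the coordinate [b], so their transition is the identity near [b] and the
   sign does not depend on the chart. *)
have chart_eq a b : a != 0 -> tate_ball a b -> b != 0 -> \forall z \near b^', s b z = s a z.
  move=> a0 ab b0.
  have [db cb] := tate_chart_center b0.
  have da : chart_dom (chrt a) (pr b) by exists b.
  have ca : chrt a (pr b) = b by exact: tate_lift_pr.
  have h : chrt a (pr b) = qC ^ 0 * chrt b (pr b) by rewrite expr0z mul1r ca cb.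
  have nb : chrt b (pr b) != 0 by rewrite cb.
  have := tate_transition_at db da nb h; rewrite cb => hT.
  have := mp.2 _ _ (aE _ b0) (aE _ a0) (pr b) db da; rewrite cb => hp.
  apply: dnear_mono (dnear_and hp (nbhs_dnbhs hT)) => z [pz [E1 E2]].
  by rewrite /s pz E2 E1 expr0z expr1n mul1r mulr1.
have val_loc a v : a != 0 -> val a v -> \forall b \near a, val b v.
  move=> a0 av; have [g [hg sg g2]] := val_ex a a0.
  have gv : g a = v by apply: val_uniq av; exists g.
  have v2 : v ^+ 2 = 1 by rewrite -gv; exact: nbhs_singleton g2.
  (* g^2 = 1 leaves only the values v and - v; continuity excludes the second. *)
  have gc : \forall b \near a, g b != - v.
    have hd := holomorphicD hg (holomorphic_cst v a).
    have nd : g a + v != 0.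
      rewrite gv -mulr2n -mulr_natr mulf_neq0 ?pnatr_eq0 //.
      by apply: contra_eq_neq v2 => ->; rewrite expr0n eq_sym oner_eq0.
    by apply: near_mono (holomorphic_neq0 hd nd) => b; apply: contra_neq => ->; rewrite addNr.
  have na := holomorphic_neq0 (holomorphic_id a) a0.
  apply: near_mono (near_and gc (near_and g2 (near_and (holomorphic_near hg)
    (near_and (dnbhs_to_dnbhs sg) (near_and (tate_ball_near (tate_ball_center a0)) na))))).
  move=> b [gb [gb2 [hgb [sgb [ab b0]]]]]; exists g; split; first exact: hgb.
    by apply: dnear_mono (dnear_and (chart_eq a b a0 ab b0) sgb) => z [-> ->].
  apply/eqP; rewrite -subr_eq0.
  have : (g b - v) * (g b + v) == 0 by rewrite -subr_sqr gb2 v2 subrr.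
  rewrite mulf_eq0 => /orP[//|h]; case/negP: gb; by rewrite -addr_eq0.
(* p z^j is unchanged when z is replaced by q z and the chart at [a] by the one at q a, whereas [H]
   changes sign. *)
have val_q a v : a != 0 -> val a v -> val (qC * a) (- v).
  move=> a0 [g [hg sg gv]]; have qa0 : qC * a != 0 by rewrite mulf_neq0.
  have [da ca] := tate_chart_center a0; have [dq cq] := tate_chart_center qa0.
  have prE : pr (qC * a) = pr a.
    by apply/esym/(tate_projP q0 a0 qa0); exists 1; rewrite expr1z.
  rewrite prE in dq cq.
  have h : chrt (qC * a) (pr a) = qC ^ 1 * chrt a (pr a) by rewrite cq ca expr1z.
  have na : chrt a (pr a) != 0 by rewrite ca.
  have := tate_transition_at da dq na h; rewrite ca => hT.
  have := mp.2 _ _ (aE _ a0) (aE _ qa0) (pr a) da dq; rewrite ca => hp.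
  have sE : \forall z \near a^', s (qC * a) (qC * z) = - g z.
    apply: dnear_mono (dnear_and (near_neq0 a0) (dnear_and sg (dnear_and hp (nbhs_dnbhs hT)))).
    move=> z [z0 [<- [pz [E1 E2]]]].
    by rewrite /s pz E2 E1 expr1z Hq // invrN mulrN; congr (- _); rewrite exprMn; ring.
  have qVa : qC^-1 * (qC * a) = a by rewrite mulKf.
  have dV := cder_continuous (cderZ qC^-1 (cder_id (qC * a))).
  exists (fun w => - g (qC^-1 * w)); split; last by rewrite qVa gv.
    have hg' : holomorphic_at g (qC^-1 * (qC * a)) by rewrite qVa.
    apply: near_mono (near_continuous dV hg') => w dg.
    exact: cder_derivable (cderN (cder_comp (cderZ qC^-1 (cder_id w)) (derivable_cder dg))).
  have sE' : \forall z \near qC^-1 * (qC * a), z != a -> s (qC * a) (qC * z) = - g z.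
    by rewrite qVa; exact: sE.
  have h2 := near_continuous dV sE'.
  have h3 : \forall w \near (qC * a)^', w != qC * a.
    by apply/dnbhs_cmodP; exists 1.
  apply: dnear_mono (dnear_and h3 (nbhs_dnbhs h2)) => w [wa].
  rewrite mulVKf //; apply; apply: contra_neq wa => <-; by rewrite mulVKf.
have opP a : a != 0 -> val a 1 -> \forall b \near a, val b 1 by exact: val_loc.
have dich a : a != 0 -> val a 1 \/ val a (-1).
  move=> a0; have [g [hg sg /nbhs_singleton /eqP g2]] := val_ex a a0.
  by move: g2; rewrite sqrf_eq1 => /orP[] /eqP ga; [left|right]; exists g.
have excl a : ~ (val a 1 /\ val a (-1)).
  move=> [h1 h2]; have /eqP := val_uniq _ _ _ h1 h2.
  by rewrite -subr_eq0 opprK -(natrD _ 1 1) pnatr_eq0.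
have opN a : a != 0 -> ~ val a 1 -> \forall b \near a, ~ val b 1.
  move=> a0 n1; have [//|am] := dich a a0.
  by apply: near_mono (val_loc a _ a0 am) => b bm b1; apply: (excl b).
have n1 : (1 : C) != 0 by exact: oner_neq0.
have n2 : qC * 1 != 0 by rewrite mulr1.
(* The sign is locally constant on C^*, so it agrees at 1 and q, against [val_q]. *)
have ind := punctured_plane_ind opP opN.
have [h|h] := dich 1 n1.
  by apply: (excl (qC * 1)); split; [exact: ind n1 n2 h | exact: val_q].
have h' := val_q _ _ n1 h; rewrite opprK in h'.
by apply: (excl 1); split; [exact: ind n2 n1 h' | exact: h].
Qed.

End TateSections.

Section Primitivity.
Context {R : realType} {X : riemann_surface R}.
Implicit Types (phi : chart R X) (x : X) (p q : local_coefs X).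

(** An odd order thus rules out e-th roots for even e. *)
Lemma power_order_dvd k e q p phi x (m : int) : kdifferential k p ->
  eq_section q (power_section p e) -> atlas X phi -> chart_dom phi x ->
  order_at (q phi) (phi x) m -> (e %| `|m|)%N.
Proof.
move=> [mp np] qp aphi dx qm.
have cx : chart_cod phi (phi x) by exists x.
have [m' pm'] := nonzero_order mp np aphi dx.
have pe : order_at (q phi) (phi x) (m' * e%:Z).
  exact: order_at_near (qp _ aphi _ cx) (order_atX e pm').
by rewrite (order_at_uniq qm pe) abszM dvdn_mull.
Qed.

End Primitivity.

(** * Choice of the points *)

Section Points.
Context {R : realType}.
Local Notation C := (Cplx R).

Lemma fin_eventually (n : nat) (P : 'I_n -> R -> Prop) :
  (forall i, exists s0 : R, forall s, s0 <= s -> P i s) ->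
  exists s0 : R, forall s, s0 <= s -> forall i, P i s.
Proof.
move=> /choice [f fP]; exists (\sum_(i < n) `|f i|) => s hs i; apply: fP.
apply: le_trans hs; rewrite (bigD1 i) //=; apply: le_trans (ler_norm _) _.
by rewrite lerDl sumr_ge0.
Qed.

Lemma expz_large_neq (a r : R) (e : int) : 0 < a -> e != 0 ->
  exists s0 : R, forall s, s0 <= s -> a * s ^ e != r.
Proof.
move=> a0 e0; have [r0|r0] := leP r 0.
  exists 1 => s s1; rewrite gt_eqF // (le_lt_trans r0) // mulr_gt0 // exprz_gt0 //.
  exact: lt_le_trans ltr01 s1.
(* Beyond r / a the product a s exceeds r, beyond a / r the product r s exceeds a; this settles
   positive and negative exponents respectively. *)
exists (1 + r / a + a / r) => s hs.
have p1 : 0 < r / a by rewrite divr_gt0.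
have p2 : 0 < a / r by rewrite divr_gt0.
have s1 : 1 <= s by apply: le_trans hs; lra.
have sr : r < a * s by rewrite mulrC -ltr_pdivrMr //; apply: lt_le_trans hs; lra.
have sa : a < r * s by rewrite mulrC -ltr_pdivrMr //; apply: lt_le_trans hs; lra.
have s0 : 0 < s by lra.
case: e e0 => [[|n]|n] // _.
  rewrite gt_eqF // (lt_le_trans sr) // ler_pM2l //.
  by rewrite -exprnP exprS ler_peMr ?(ltW s0) // exprn_ege1.
rewrite NegzE -exprnN lt_eqF // ltr_pdivrMr ?exprn_gt0 // (lt_le_trans sa) //.
by rewrite ler_pM2l // exprS ler_peMr ?(ltW s0) // exprn_ege1.
Qed.

Lemma cmod_realX (s : R) (e : int) : 0 < s -> cmod ((s%:C%C : C) ^ e) = s ^ e.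
Proof.
by move=> s0; case: e => n; rewrite ?NegzE ?exprnN ?cmodV cmodX cmod_real gtr0_norm.
Qed.

(** Two points move with a large real parameter [s] while the others sit at positive integers, which
    the growing or decaying moduli avoid. The exponents will be such that [s] drops out of the
    product. *)
Lemma choose_two_points n (i1 i2 : 'I_n) (b : C) (e1 e2 : int) : i1 != i2 -> b != 0 ->
  e1 != 0 -> e2 != 0 ->
  (exists s0 : R, forall s, s0 <= s -> b * (s%:C%C : C) ^ e1 != s%:C%C ^ e2) ->
  exists (c : 'I_n -> C) (s : C), [/\ injective c, forall i, c i != 0, s != 0,
    c i1 = b * s ^ e1 /\ c i2 = s ^ e2 &
    forall i, i != i1 -> i != i2 -> c i = i.+1%:R].
Proof.
move=> i12 b0 e10 e20 [s1 s1P].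
have bp : 0 < cmod b by rewrite cmod_gt0.
have [s2 s2P] := @fin_eventually n (fun i s => cmod b * s ^ e1 != i.+1%:R) (fun i => expz_large_neq _ bp e10).
have [s3 s3P] := @fin_eventually n (fun i s => 1 * s ^ e2 != i.+1%:R) (fun i => expz_large_neq _ ltr01 e20).
pose s := 1 + `|s1| + `|s2| + `|s3|.
have n1 := normr_ge0 s1; have n2 := normr_ge0 s2; have n3 := normr_ge0 s3.
have l1 := ler_norm s1; have l2 := ler_norm s2; have l3 := ler_norm s3.
have sp : 0 < s by rewrite /s; lra.
have h1 := s1P s ltac:(rewrite /s; lra).
have h2 := s2P s ltac:(rewrite /s; lra).
have h3 := s3P s ltac:(rewrite /s; lra).
have sC0 : (s%:C%C : C) != 0 by rewrite -cmod_gt0 cmod_real normr_gt0 gt_eqF.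
pose c i : C := if i == i1 then b * s%:C%C ^ e1 else if i == i2 then s%:C%C ^ e2 else i.+1%:R.
have ci1 : c i1 = b * s%:C%C ^ e1 by rewrite /c eqxx.
have ci2 : c i2 = s%:C%C ^ e2 by rewrite /c eq_sym (negPf i12) eqxx.
have cj i : i != i1 -> i != i2 -> c i = i.+1%:R.
  by move=> /negPf j1 /negPf j2; rewrite /c j1 j2.
have d1 j : c i1 = c j -> j != i1 -> False.
  move=> E j1; have [j2|j2] := eqVneq j i2.
    by move: h1; rewrite -ci1 -ci2 E j2 eqxx.
  have := h2 j; rewrite -(cmod_realX _ sp) -cmodM -ci1 E cj // cmod_nat eqxx //.
have d2 j : c i2 = c j -> j != i2 -> j != i1 -> False.
  move=> E j2 j1.
  by have := h3 j; rewrite mul1r -(cmod_realX _ sp) -ci2 E cj // cmod_nat eqxx.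
exists c, (s%:C%C); split=> //.
- move=> i j E; apply/eqP/negPn/negP => ij.
  have [I1|I1] := eqVneq i i1; first by subst i; apply: (d1 j E); rewrite eq_sym.
  have [J1|J1] := eqVneq j i1; first by subst j; apply: (d1 i (esym E)).
  have [I2|I2] := eqVneq i i2; first by subst i; apply: (d2 j E); rewrite // eq_sym.
  have [J2|J2] := eqVneq j i2; first by subst j; apply: (d2 i (esym E)).
  have := congr1 cmod E; rewrite !cj // !cmod_nat => /eqP; rewrite eqr_nat eqSS => /eqP E'.
  by move/eqP: ij; apply; exact: val_inj.
- move=> i; rewrite /c; case: ifP => _; first by rewrite mulf_neq0 // expfz_neq0.
  by case: ifP => _; rewrite ?expfz_neq0 // pnatr_eq0.
Qed.

Lemma complex_rootz (t : C) (e : int) : t != 0 -> e != 0 -> exists2 b : C, b != 0 & b ^ e = t.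
Proof.
move=> t0; have H (u : C) j : u != 0 -> exists2 b : C, b != 0 & b ^+ j.+1 = u.
  move=> u0; have [b bE] := complex_root u (ltn0Sn j); exists b => //.
  by apply: contra_neq u0 => b00; rewrite -bE b00 expr0n.
case: e => [[|j]|j] // _; first by have [b b0 bE] := H t j t0; exists b.
have [|b b0 bE] := H t^-1 j; first by rewrite invr_eq0.
by exists b => //; rewrite NegzE -exprnN bE invrK.
Qed.

Lemma prod_split2 (n : nat) (F : 'I_n -> C) i1 i2 : i1 != i2 ->
  \prod_(i < n) F i = F i1 * (F i2 * \prod_(i < n | (i != i1) && (i != i2)) F i).
Proof. by move=> i12; rewrite (bigD1 i1) //= (bigD1 i2) //= eq_sym. Qed.

(** The exponents nu i2 and - nu i1 make the product independent of [s], and [b] solves b^(nu i1) =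
    t / S. The two points differ for large [s] because their quotient has modulus |b| s^(nu i1 + nu
    i2), with nonzero exponent. *)
Lemma points_generic n (nu : 'I_n -> int) (t : C) i1 i2 : t != 0 -> i1 != i2 ->
  nu i1 != 0 -> nu i2 != 0 -> nu i1 + nu i2 != 0 ->
  exists c : 'I_n -> C, [/\ injective c, forall i, c i != 0 & \prod_(i < n) c i ^ nu i = t].
Proof.
move=> t0 i12 n1 n2 n12.
pose S := \prod_(i < n | (i != i1) && (i != i2)) (i.+1%:R : C) ^ nu i.
have S0 : S != 0.
  by apply/prodf_neq0 => i _; rewrite expfz_neq0 // pnatr_eq0.
have [|b b0 bE] := @complex_rootz (t / S) (nu i1) _ n1; first by rewrite mulf_neq0 ?invr_eq0.
have n1' : - nu i1 != 0 by rewrite oppr_eq0.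
have bp : 0 < cmod b by rewrite cmod_gt0.
have [|c [s [ci c0 s0 [c1 c2] cj]]] := @choose_two_points n i1 i2 b (nu i2) (- nu i1) i12 b0 n2 n1'.
  have [s0 s0P] := expz_large_neq 1 bp n12; exists (1 + `|s0|) => s hs.
  have sp : 0 < s by have := normr_ge0 s0; lra.
  have sC0 : (s%:C%C : C) != 0 by rewrite -cmod_gt0 cmod_real normr_gt0 gt_eqF.
  have ss0 : s0 <= s by have := ler_norm s0; lra.
  have := s0P s ss0; apply: contra_neq => E.
  rewrite -(cmod_realX _ sp) -cmodM expfzDr // mulrCA E -expfzDr // subrr expr0z.
  exact: cmod1.
exists c; split=> //; rewrite (prod_split2 _ i12) c1 c2 expfzMl bE.
rewrite (eq_bigr (fun i : 'I_n => (i.+1%:R : C) ^ nu i)) => [|i /andP[j1 j2]]; last by rewrite cj.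
rewrite -/S !exprz_exp.
have AB : s ^ (nu i2 * nu i1) * s ^ (- nu i1 * nu i2) = 1.
  by rewrite -expfzDr // mulNr mulrC subrr expr0z.
rewrite -[RHS]mulr1 -AB; move: (s ^ _) (s ^ _) => A B.
by field.
Qed.

(** With opposite orders only the ratio [x] of the two points counts; they are taken as x s and
    s. *)
Lemma points_pair n (nu : 'I_n -> int) (x : C) i1 i2 : x != 0 -> x != 1 -> i1 != i2 ->
  nu i2 = - nu i1 -> (forall i, i != i1 -> i != i2 -> nu i = 0) ->
  exists c : 'I_n -> C, [/\ injective c, forall i, c i != 0 & \prod_(i < n) c i ^ nu i = x ^ nu i1].
Proof.
move=> x0 x1 i12 n12 nj.
have [|c [s [ci c0 s0 [c1 c2] cj]]] := @choose_two_points n i1 i2 x 1 1 i12 x0 isT isT.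
  exists 1 => s s1; have sC0 : (s%:C%C : C) != 0.
    by rewrite -cmod_gt0 cmod_real normr_gt0 gt_eqF //; lra.
  by rewrite expr1z -subr_eq0 -{2}[s%:C%C]mul1r -mulrBl mulf_neq0 // subr_eq0.
exists c; split=> //; rewrite (prod_split2 _ i12) c1 c2 !expr1z big1 => [|i /andP[j1 j2]]; last first.
  by rewrite nj // expr0z.
by rewrite mulr1 n12 expfzMl -mulrA -expfzDr // subrr expr0z mulr1.
Qed.

End Points.

Lemma dvd_even (k e : nat) : k \in [:: 1; 2; 4]%N -> (1 < e)%N -> (e %| k)%N -> ~~ odd e.
Proof.
move=> hk e1 ek; have e4 : (e %| 4)%N.
  by apply: dvdn_trans ek _; move: hk; rewrite !inE => /or3P[] /eqP ->.
have le4 := dvdn_leq (isT : 0 < 4)%N e4.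
by move: le4 e4 e1; case: e {ek} => [|[|[|[|[|]]]]].
Qed.

(** * Differentials with prescribed orders, and the cases of the theorem *)

Section Stratum.
Context {R : realType}.
Local Notation C := (Cplx R).

(** The product condition involves no power of q, so q can be taken after the points. The last
    hypothesis lists the sources of primitivity: k = 1, an odd order, or an anti-invariant square
    root. *)
Lemma tate_stratum (k n : nat) (mu : 'I_n -> int) (c : 'I_n -> C) :
  k \in [:: 1; 2; 4]%N -> injective c -> (forall i, c i != 0) ->
  \sum_(i < n) mu i = 0 -> \prod_(i < n) c i ^ mu i = 1 ->
  (k = 1%N \/ (exists i, odd (absz (mu i))) \/
   exists2 nu : 'I_n -> int, (forall i, mu i = nu i * 2) & \prod_(i < n) c i ^ nu i = -1) ->
  primitive_stratum_nonempty R 1 k mu.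
Proof.
move=> hk ci c0 smu pmu prim.
(* q S < 1 ensures that the c i lie in distinct q^Z-orbits. *)
pose S : R := \sum_(i < n) \sum_(j < n) cmod (c i) / cmod (c j).
have S0 : 0 <= S by rewrite sumr_ge0 // => i _; rewrite sumr_ge0 // => j _; rewrite divr_ge0 ?cmod_ge0.
have Sij i j : cmod (c i) / cmod (c j) <= S.
  rewrite /S (bigD1 i) //= (bigD1 j) //= -addrA lerDl addr_ge0 // sumr_ge0 // => *.
    by rewrite divr_ge0 ?cmod_ge0.
  by rewrite sumr_ge0 // => *; rewrite divr_ge0 ?cmod_ge0.
(* Then 3 q + 3 q S = 1, whence both 3 q <= 1 and q S < 1; the summand 1 covers S = 0. *)
pose q : R := (3 * (1 + S))^-1.
have D0 : 0 < 3 * (1 + S) by rewrite mulr_gt0 //; lra.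
have q0 : 0 < q by rewrite invr_gt0.
have qE : q * (3 * (1 + S)) = 1 by rewrite mulVf // gt_eqF.
have qS0 : 0 <= q * S by rewrite mulr_ge0 // ltW.
have q3 : 3 * q <= 1 by move: qE qS0; rewrite !mulrDr mulr1 mulrCA; lra.
have qS : q * S < 1 by move: qE q0; rewrite !mulrDr mulr1 mulrCA; lra.
exists (tate_surface q0 q3); split; [exact: tate_compact | exact: tate_genus1 |].
pose F := theta_quot q c mu.
have Fq z : z != 0 -> F (q%:C%C * z) = F z by move=> z0; rewrite /F theta_quotM // pmu mul1r.
have Fo a : a != 0 -> exists m, order_at F a m.
  by move=> a0; eexists; exact: theta_quot_order.
have prI : injective (fun i => tate_proj q (c i)).
  move=> i j /(tate_projP q0 (c0 i) (c0 j)) [m mE]; apply: ci.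
  have cpos l : 0 < cmod (c l) by rewrite cmod_gt0.
  have small a b (m' : int) : 1 <= m' -> cmod (c a) = q ^ m' * cmod (c b) -> False.
    move=> m1 E; have := q_expz_le q0 q3 m1; rewrite expr1z => qm.
    have : cmod (c a) / cmod (c a) <= q * S.
      rewrite {1}E -mulrA; apply: ler_pM => //; first exact/ltW/exprz_gt0.
      by rewrite divr_ge0 ?cmod_ge0.
    by rewrite mulfV ?gt_eqF // leNgt qS.
  have cE : cmod (c j) = q ^ m * cmod (c i) by rewrite mE cmodM cmod_qX.
  have [m0|[m1|m1]] : m = 0 \/ (1 <= m \/ 1 <= - m) by clear; lia.
  + by rewrite mE m0 expr0z mul1r.
  + by case: (small _ _ _ m1 cE).
  + case: (small i j _ m1); rewrite cE mulrA -expfzDr ?gt_eqF // addNr expr0z mul1r //.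
exists (fun i => tate_proj q (c i)), (tate_coefs k F); split; first exact: prI.
- have kd : kdifferential k (tate_coefs (q0 := q0) (q3 := q3) k F).
    split; first exact: tate_coefs_section.
    move=> H; have n1 : (1 : C) != 0 by exact: oner_neq0.
    have [d1 c1] := tate_chart_center q0 q3 n1.
    have [m hm] := Fo 1 n1; have om := tate_coefs_order k n1 hm.
    apply: (order_at_not_vanish om).
    have a1 : atlas (tate_surface q0 q3) (tate_chart q0 q3 1) by exists 1.
    apply: (H _ a1); rewrite -{2}c1; by exists (tate_proj q 1).
  split=> // e e1 ek [p pk pE].
  have ee := dvd_even hk e1 ek.
  case: prim => [k1|[[i oi]|[nu nuE nuP]]].
  + by move: ek e1; rewrite k1 dvdn1 => /eqP ->.
  + have [dx cx] := tate_chart_center q0 q3 (c0 i).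
    have ai : atlas (tate_surface q0 q3) (tate_chart q0 q3 (c i)) by exists (c i).
    have mi : order_at (tate_coefs (q0 := q0) (q3 := q3) k F (tate_chart q0 q3 (c i)))
        (tate_chart q0 q3 (c i) (tate_proj q (c i))) (mu i).
      rewrite cx; apply: tate_coefs_order => //.
      have := theta_quot_order q0 q3 c0 mu (c0 i).
      by rewrite (big_pred1 i) // => j /=; exact: (inj_eq prI).
    have := power_order_dvd pk pE ai dx mi.
    rewrite -dvdn2 in ee => /(dvdn_trans ee); by rewrite dvdn2 oi.
  + pose H := theta_quot q c nu.
    have snu : \sum_(i < n) nu i = 0.
      apply: (@mulIf _ (2 : int)) => //; rewrite mul0r mulr_suml -[RHS]smu.
      by apply: eq_bigr => i _; rewrite nuE.
    have FH : F = (fun z => H z ^+ 2).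
      apply/funext => z; rewrite /F /H /theta_quot -prodrXl.
      by apply: eq_bigr => i _; rewrite nuE -exprz_exp.
    have Hq z : z != 0 -> H (q%:C%C * z) = - H z.
      by move=> z0; rewrite /H theta_quotM // nuP mulN1r.
    have Ho a : a != 0 -> exists m, order_at H a m.
      by move=> a0; eexists; exact: theta_quot_order.
    (* As e is even, the (e/2)-th power of an e-th root is a square root, of weight k/2. *)
    have e2 : (e./2 * 2)%N = e by rewrite muln2 even_halfK.
    have jE : (k %/ e * e./2 * 2)%N = k by rewrite -mulnA e2 divnK.
    apply: (tate_antiperiodic_square Ho Hq (section_exp e./2 pk.1)).
    rewrite jE -FH => phi aphi a ca; apply: dnear_mono (pE phi aphi a ca) => z ->.
    by rewrite /power_section -exprM e2.
- move=> phi [a a0 ->] x dx; have [z [_ z0 xE ->]] := tate_chart_dom dx.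
  apply: tate_coefs_order => //; rewrite xE.
  exact: theta_quot_order.
Qed.

End Stratum.

Lemma int_even_split (n : nat) (mu : 'I_n -> int) : (exists i, odd (absz (mu i))) \/
  exists nu : 'I_n -> int, forall i, mu i = nu i * 2.
Proof.
have [/existsP h|h] := boolP [exists i, odd (absz (mu i))]; [by left|right].
exists (fun i => (mu i %/ 2)%Z) => i.
have h2 : (2 %| absz (mu i))%N by rewrite dvdn2; apply: contra h => o; apply/existsP; exists i.
by rewrite divzK // /dvdz.
Qed.

(** If the first order a cancels both b and d, then b + d = -2a is nonzero. *)
Lemma three_nonzero_pair (n : nat) (mu : 'I_n -> int) (s : seq 'I_n) : uniq s ->
  {in s, forall i, mu i != 0} -> (3 <= size s)%N ->
  exists i1 i2, [/\ i1 != i2, mu i1 != 0, mu i2 != 0 & mu i1 + mu i2 != 0].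
Proof.
case: s => [|a [|b [|d s]]] //= /and3P[]; rewrite !inE !negb_or.
move=> /and3P[ab ad _] /andP[bd _] _ H _.
have Ha : mu a != 0 by apply: H; rewrite inE eqxx.
have Hb : mu b != 0 by apply: H; rewrite !inE eqxx orbT.
have Hd : mu d != 0 by apply: H; rewrite !inE eqxx !orbT.
have [sab|sab] := eqVneq (mu a + mu b) 0; last by exists a, b.
have [sad|sad] := eqVneq (mu a + mu d) 0; last by exists a, d.
exists b, d; split=> //; apply: contra_neq Ha => sbd; lia.
Qed.

Lemma root_unity_neq1 (R : realType) (m : nat) : (2 < m)%N ->
  exists x : Cplx R, [/\ x != 0, x != 1 & x ^+ m = 1].
Proof.
case: m => // m; rewrite ltnS => m1.
have m0 : (0 < m)%N by exact: ltn_trans m1.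
(* A root of 1 + X + ... + X^m: it is a root of X^(m+1) - 1, and it is not 1, where the sum is m +
   1. *)
have [x xE] := complex_acf_axiom (fun=> -1 : R[i]) m0.
have S0 : \sum_(i < m.+1) x ^+ i = 0.
  by rewrite big_ord_recr /= xE -mulr_sumr mulN1r subrr.
have xm : x ^+ m.+1 = 1 by apply/eqP; rewrite -subr_eq0 subrX1 S0 mulr0.
exists x; split=> //.
  by apply/eqP => x0; move: xm; rewrite x0 expr0n => /eqP; rewrite eq_sym oner_eq0.
apply/eqP => x1; move: S0; rewrite x1.
under eq_bigr do rewrite expr1n.
by rewrite sumr_const card_ord => /eqP; rewrite pnatr_eq0.
Qed.

Section Orders.
Context (n : nat) (mu : 'I_n -> int).

(** Indices rather than values, because the same order may occur at several points. *)
Definition nonzero_index := [seq i <- enum 'I_n | mu i != 0].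

Lemma nonzero_index_uniq : uniq nonzero_index.
Proof. by rewrite filter_uniq // enum_uniq. Qed.

Lemma mem_nonzero_index i : (i \in nonzero_index) = (mu i != 0).
Proof. by rewrite mem_filter mem_enum andbT. Qed.

Lemma sum_nonzero_index : \sum_(i < n) mu i = \sum_(i <- nonzero_index) mu i.
Proof.
rewrite big_filter big_enum_cond /= [RHS]big_mkcond /=; apply: eq_bigr => i _.
by case: eqP => // ->.
Qed.

End Orders.

Lemma prod_double (R : realType) (n : nat) (mu nu : 'I_n -> int) (c : 'I_n -> Cplx R) :
  (forall i, mu i = nu i * 2) -> \prod_(i < n) c i ^ nu i = -1 ->
  \prod_(i < n) c i ^ mu i = 1.
Proof.
move=> nuE cP; transitivity ((\prod_(i < n) c i ^ nu i) ^+ 2).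
  by rewrite -prodrXl; apply: eq_bigr => i _; rewrite nuE -exprz_exp.
by rewrite cP sqrrN expr1n.
Qed.

Lemma stratum_nonempty (R : realType) (k n : nat) (mu : 'I_n -> int) :
  k \in [:: 1; 2; 4]%N -> \sum_(i < n) mu i = 0 ->
  let s := nonzero_index mu in
  [\/ size s = 0%N /\ k = 1%N,
      exists i1 i2 (m : int), [/\ s = [:: i1; i2], mu i1 = m, mu i2 = - m & (2 <= `|m|)] |
      (3 <= size s)%N] ->
  primitive_stratum_nonempty R 1 k mu.
Proof.
move=> hk smu s.
have us : uniq s := nonzero_index_uniq mu.
have ms i : (i \in s) = (mu i != 0) := mem_nonzero_index mu i.
case=> [[s0 k1]|[i1 [i2 [m [sE m1 m2 mm]]]]|s3].
- have mu0 i : mu i = 0.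
    by apply/eqP/negPn; rewrite -ms; move/size0nil: s0 => ->.
  apply: (@tate_stratum R k n mu (fun i => i.+1%:R)) => //.
  + by move=> i j /eqP; rewrite eqr_nat eqSS => /eqP /val_inj.
  + by move=> i; rewrite pnatr_eq0.
  + by rewrite big1 // => i _; rewrite mu0 expr0z.
  + by left.
- have i12 : i1 != i2 by move: us; rewrite sE /= inE andbT.
  have muj i : i != i1 -> i != i2 -> mu i = 0.
    move=> j1 j2; apply/eqP/negPn; rewrite -ms sE !inE negb_or j1 j2 //.
  have [[i0 oi]|[nu nuE]] := int_even_split mu.
  (* An odd [m] with |m| >= 2 has |m| >= 3, so [root_unity_neq1] supplies the ratio of the two
     points. *)
  + have om : odd (absz m).
      have [E|j1] := eqVneq i0 i1; first by rewrite -m1 -E.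
      have [E|j2] := eqVneq i0 i2; first by move: oi; rewrite E m2 abszN.
      by move: oi; rewrite muj.
    have m3 : (2 < absz m)%N by move: om mm; lia.
    have [x [x0 x1 xm]] := root_unity_neq1 R m3.
    have [|c [ci c0 cP]] := points_pair x0 x1 i12 _ muj; first by rewrite m1 m2.
    apply: (tate_stratum hk ci c0 smu) => //; last by right; left; exists i0.
    rewrite cP m1; case: (intP m) xm => [|j|j] xm; rewrite ?expr0z //.
    by rewrite -exprnN (_ : x ^+ j.+1 = 1) ?invr1 // -xm abszN.
  (* For even orders the ratio satisfies x^(nu i1) = -1, so it is not 1, and the product for [mu] is
     the square of -1. *)
  + have nu0 : nu i1 != 0 by apply: contraTneq mm => h; rewrite -m1 nuE h mul0r.
    have N1 : (-1 : Cplx R) != 0 by rewrite oppr_eq0 oner_eq0.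
    have [x x0 xE] := complex_rootz N1 nu0.
    have x1 : x != 1.
      apply/eqP => x1; move: xE; rewrite x1 exp1rz => /eqP.
      by rewrite -subr_eq0 opprK -(natrD _ 1 1) pnatr_eq0.
    have [||c [ci c0 cP]] := points_pair (nu := nu) x0 x1 i12.
    * by have := m2; rewrite -m1 !nuE; lia.
    * by move=> i j1 j2; have := muj i j1 j2; rewrite nuE; lia.
    rewrite xE in cP.
    apply: (tate_stratum hk ci c0 smu); last by right; right; exists nu.
    exact: prod_double nuE cP.
- have [i1 [i2 [i12 n1 n2 n12]]] : exists i1 i2, [/\ i1 != i2, mu i1 != 0, mu i2 != 0 & mu i1 + mu i2 != 0].
    by apply: (three_nonzero_pair us) s3 => i; rewrite ms.
  have [oi|[nu nuE]] := int_even_split mu.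
    have [c [ci c0 cP]] := points_generic (oner_neq0 (Cplx R)) i12 n1 n2 n12.
    by apply: (tate_stratum hk ci c0 smu cP); right; left.
  have N1 : (-1 : Cplx R) != 0 by rewrite oppr_eq0 oner_eq0.
  have [|||c [ci c0 cP]] := points_generic (nu := nu) N1 i12.
  + by move: n1; rewrite nuE; lia.
  + by move: n2; rewrite nuE; lia.
  + by move: n12; rewrite !nuE; lia.
  apply: (tate_stratum hk ci c0 smu); last by right; right; exists nu.
  exact: prod_double nuE cP.
Qed.

Lemma sum_two (n : nat) (mu : 'I_n -> int) : \sum_(i < n) mu i = 0 ->
  size (nonzero_index mu) = 2%N -> exists i1 i2,
    [/\ nonzero_index mu = [:: i1; i2], mu i1 != 0 & mu i2 = - mu i1].
Proof.
move=> smu; have ms := mem_nonzero_index mu; move: smu; rewrite sum_nonzero_index.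
case: (nonzero_index mu) ms => [|a [|b []]] //= ms smu _.
exists a, b; split=> //; first by rewrite -ms inE eqxx.
by move: smu; rewrite !big_cons big_nil addr0; lia.
Qed.

Lemma stratum_orders (R : realType) (k n : nat) (mu : 'I_n -> int) :
  (0 < k)%N -> (forall i, - k%:Z < mu i) -> \sum_(i < n) mu i = 0 ->
  primitive_stratum_nonempty R 1 k mu ->
  let s := nonzero_index mu in
  [\/ size s = 0%N /\ k = 1%N,
      exists i1 i2 (m : int), [/\ s = [:: i1; i2], mu i1 = m, mu i2 = - m & (2 <= `|m|)] |
      (3 <= size s)%N].
Proof.
move=> k0 hmu smu [E [cE gE [c [q [ci [[mq nq] pq] dq]]]]] s.
have ms i : (i \in s) = (mu i != 0) := mem_nonzero_index mu i.
have [om [hom om0]] := genus1_form gE.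
have hs2 := sum_two smu.
move: hs2 ms; have := sum_nonzero_index mu; rewrite smu -/s.
case: s => [|a [|b [|d s]]] hs hs2 ms; last by constructor 3.
(* With all orders 0 and k > 1, [q] would be a k-th power, against primitivity for e = k. *)
- constructor 1; split=> //; apply/eqP/negPn/negP => k1.
  have q0 phi : atlas E phi -> forall x, chart_dom phi x -> order_at (q phi) (phi x) 0.
    move=> aphi x dx; have := dq phi aphi x dx; rewrite big1 // => i _.
    by apply/eqP/negPn; rewrite -ms.
  have h := power_of_form cE hom om0 mq k0 q0.
  have k2 : (1 < k)%N by move: k0 k1; case: (k) => [|[]].
  by apply: (pq k k2 (dvdnn k)); rewrite divnn k0.
(* A single nonzero order would be the whole sum. *)
- have := ms a; rewrite inE eqxx; move: hs; rewrite big_cons big_nil addr0 => <-.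
  by rewrite eqxx.
- have [//|i1 [i2 [[sa sb] n1 n2]]] := hs2.
  subst a b; constructor 2; exists i1, i2, (mu i1); split=> //.
  rewrite leNgt; apply/negP => m1.
  have i12 : i1 != i2.
    by apply: contra_neq n1 => h; move: n2; rewrite -h; lia.
  have muj i : i != i1 -> i != i2 -> mu i = 0.
    by move=> j1 j2; apply/eqP/negPn; rewrite -ms !inE negb_or j1 j2.
  have qi phi i : atlas E phi -> chart_dom phi (c i) -> order_at (q phi) (phi (c i)) (mu i).
    move=> aphi dx; have := dq phi aphi (c i) dx.
    by rewrite (big_pred1 i) // => j /=; exact: (inj_eq ci).
  have qx phi x : atlas E phi -> chart_dom phi x -> x <> c i1 -> x <> c i2 ->
      order_at (q phi) (phi x) 0.
    move=> aphi dx x1 x2; have := dq phi aphi x dx; rewrite big1 // => i /eqP ix.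
    by apply: muj; apply/eqP => E0; [apply: x1 | apply: x2]; rewrite -ix E0.
  (* The sign decides which of the two points is the zero of [q], that is, plays the role of x1. *)
  have [m1' | m1'] : mu i1 = 1 \/ mu i1 = -1 by clear -m1 n1; lia.
  + apply: (no_simple_pole (x1 := c i1) (x2 := c i2) cE hom om0 mq k0 _ _ qx).
      by move=> phi aphi dx; rewrite -m1'; exact: qi.
    by move=> phi aphi dx; rewrite -m1' -n2; exact: qi.
  + apply: (no_simple_pole (x1 := c i2) (x2 := c i1) cE hom om0 mq k0).
    * by move=> phi aphi dx; have := qi phi i2 aphi dx; rewrite n2 m1' opprK.
    * by move=> phi aphi dx; rewrite -m1'; exact: qi.
    * by move=> phi x aphi dx x1 x2; exact: qx.
Qed.

Theorem proposition3p8 (R : realType) (k n : nat) (mu : 'I_n -> int)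
  (hk : k \in [:: 1; 2; 4]%N)
  (hmu : forall i, - k%:Z < mu i)
  (hsum : \sum_(i < n) mu i = 0) :
  let nonzero_orders := [seq mu i | i <- enum 'I_n & mu i != 0] in
  let n0 := size nonzero_orders in
  primitive_stratum_nonempty R 1 k mu <->
    [\/ n0 = 0%N /\ k = 1%N,
        n0 = 2%N /\ (exists m : int,
          perm_eq nonzero_orders [:: m; - m] /\ (2 <= `|m|)) |
        (3 <= n0)%N].
Proof.
move=> nonzero_orders n0.
have k0 : (0 < k)%N by move: hk; rewrite !inE => /or3P[] /eqP ->.
have n0E : n0 = size (nonzero_index mu) by rewrite /n0 size_map.
split=> [/(stratum_orders k0 hmu hsum)|h].
  rewrite n0E; case=> [h|[i1 [i2 [m [sE m1 m2 mm]]]]|h].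
  - by constructor 1.
  - constructor 2; rewrite sE; split=> //; exists m; split=> //.
    by rewrite /nonzero_orders -/(nonzero_index mu) sE /= m1 m2.
  - by constructor 3.
apply: stratum_nonempty => //; rewrite -n0E.
case: h => [h|[n2 [m [pm mm]]]|h]; [by constructor 1 | constructor 2 | by constructor 3].
rewrite n0E in n2; have [i1 [i2 [sE m1 m2]]] := sum_two hsum n2.
exists i1, i2, (mu i1); split=> //.
(* The orders are given only up to permutation, so mu i1 is m or - m; both have the same absolute
   value. *)
have : mu i1 \in [:: m; - m].
  rewrite -(perm_mem pm) /nonzero_orders -/(nonzero_index mu) sE /= inE eqxx //.
by rewrite !inE => /orP[] /eqP ->; rewrite ?normrN.
Qed.
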